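(* In dimension $3$ over $\mathbb{R}$ there exist, up to linear conjugation, only finitely many superflows (irreducible as well as reducible), and they are all solenoidal, i.e. their vector fields are divergence-free.
   Context: Projective flow: for $\Phi:\mathbb{R}^n\to\mathbb{R}^n$ (possibly defined only locally) put $\Phi^t(\mathbf{x})=t^{-1}\Phi(\mathbf{x}t)$. A projective flow is a solution of $\Phi^{t+s}=\Phi^t\circ\Phi^s$ with $\lim_{t\to0}\Phi(\mathbf{x}t)/t=\mathbf{x}$. Its vector field is $\frac{d}{dt}\big(t^{-1}\Phi(\mathbf{x}t)\big)|_{t=0}$; it is homogeneous of degree $2$. Superflow: let $n\ge2$ and let $\Gamma\hookrightarrow\mathrm{GL}(n,\mathbb{R})$ be a faithful representation of a finite group, identified with its image. A projective flow $\Phi$ is a $\Gamma$-superflow if (i) its vector field $\mathbf{Q}=(Q_1,\dots,Q_n)\ne 0$ has components that are rational functions homogeneous of degree $2$ and satisfies $\gamma^{-1}\circ\mathbf{Q}\circ\gamma=\mathbf{Q}$ for all $\gamma\in\Gamma$; and (ii) every other vector field $\mathbf{Q}'$ (with rational components homogeneous of degree $2$) satisfying $\gamma^{-1}\circ\mathbf{Q}'\circ\gamma=\mathbf{Q}'$ for all $\gamma\in\Gamma$ is either a scalar multiple of $\mathbf{Q}$ or has a common denominator of higher degree than that of $\mathbf{Q}$. A superflow is a $\Gamma$-superflow for some such $\Gamma$. It is reducible or irreducible according to whether the representation $\Gamma\hookrightarrow\mathrm{GL}(n,\mathbb{R})$, considered as a complex representation, is reducible or irreducible. Two flows are linearly conjugate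 if their vector fields satisfy $\mathbf{Q}'=L^{-1}\circ\mathbf{Q}\circ L$ for some invertible linear map $L$. *)

(* Defs.v *)
From HB Require Import structures.
From mathcomp Require Import all_boot all_order all_algebra all_fingroup.
From mathcomp Require Import generic_quotient fraction mxrepresentation.
From mathcomp Require Import boolp classical_sets reals topology normedtype derive.
From mathcomp Require mpoly.
(* The notations of mpoly clash with those of the analysis library. *)
Import -(notations) mpoly.

Set Implicit Arguments.
Unset Strict Implicit.
Unset Printing Implicit Defensive.

Import Order.TTheory GRing.Theory Num.Theory.
Import numFieldNormedType.Exports.
Local Open Scope classical_set_scope.
Local Open Scope quotient_scope.
Local Open Scope ring_scope.

Notation ratfun R n := {fraction (mpoly n R)}.

(* Points and vector fields are column vectors, so that a linear map L acts by *)
(* x |-> L *m x.                                                               *)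
Notation vfield R n := 'cV[ratfun R n]_n.

Section RationalVectorFields.
Variables (R : realType) (n : nat).

Definition toratfun (p : mpoly n R) : ratfun R n := FracField.tofrac p.

Definition constfun (c : R) : ratfun R n := toratfun (mpolyC n c).

(* The polynomial x |-> p (L *m x). *)
Definition poly_comp (L : 'M[R]_n) (p : mpoly n R) : mpoly n R :=
  comp_mpoly [tuple \sum_(j < n) L i j *: mpolyX R (mnm1 j) | i < n] p.

(* Computed on a representative N / D of q; the result does not depend on it   *)
(* when L is invertible. For singular L the new denominator may vanish.        *)
Definition ratfun_comp (L : 'M[R]_n) (q : ratfun R n) : ratfun R n :=
  toratfun (poly_comp L (repr q).1) / toratfun (poly_comp L (repr q).2).

(* Quotient rule, on a representative N / D of q. *)
Definition ratfun_deriv (i : 'I_n) (q : ratfun R n) : ratfun R n :=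
  let N := (repr q).1 in let D := (repr q).2 in
  toratfun (mderiv i N * D - N * mderiv i D) / toratfun D ^+ 2.

Definition divergence (Q : vfield R n) : ratfun R n :=
  \sum_(i < n) ratfun_deriv i (Q i 0).

(* L^-1 o Q o L *)
Definition lin_conj (L : 'M[R]_n) (Q : vfield R n) : vfield R n :=
  map_mx constfun (invmx L) *m map_mx (ratfun_comp L) Q.

(* The zero polynomial is homogeneous of every degree. *)
Definition ratfun_homog (d : nat) (q : ratfun R n) : Prop :=
  exists (k : nat) (N D : mpoly n R),
    [/\ D != 0, N \is (@ishomog1 n R (k + d)%N mdeg),
        D \is (@ishomog1 n R k mdeg) & q = toratfun N / toratfun D].

Definition vf_homog (d : nat) (Q : vfield R n) : Prop :=
  forall i, ratfun_homog d (Q i 0).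

(* Q takes the value v at x; in particular Q has no pole at x. *)
Definition vf_value (Q : vfield R n) (x v : 'cV[R]_n) : Prop :=
  forall i, exists N D : mpoly n R,
    [/\ Q i 0 = toratfun N / toratfun D, meval (x ^~ 0) D != 0
      & v i 0 = meval (x ^~ 0) N / meval (x ^~ 0) D].

Definition common_denom (Q : vfield R n) (D : mpoly n R) : Prop :=
  D != 0 /\ forall i, exists N : mpoly n R, Q i 0 = toratfun N / toratfun D.

Definition least_common_denom (Q : vfield R n) (D : mpoly n R) : Prop :=
  common_denom Q D /\
  forall D', common_denom Q D' -> (mmeasure mdeg D <= mmeasure mdeg D')%N.

(* mmeasure mdeg D is the total degree of D plus one for D != 0. *)
Definition higher_denom (Q' Q : vfield R n) : Prop :=
  forall D' D, least_common_denom Q' D' -> least_common_denom Q D ->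
    (mmeasure mdeg D < mmeasure mdeg D')%N.

End RationalVectorFields.

Record local_map (R : realType) (n : nat) := LocalMap {
  lm_dom : set 'cV[R]_n;
  lm_fun :> 'cV[R]_n -> 'cV[R]_n
}.

Section Flows.
Variables (R : realType) (n : nat).
Implicit Types Phi : local_map R n.

(* Phi^t(x) = t^-1 Phi(x t), extended by its limit Phi^0(x) = x at t = 0. *)
Definition flow Phi (t : R) (x : 'cV[R]_n) : 'cV[R]_n :=
  if t == 0 then x else t^-1 *: Phi (t *: x).

Definition flow_dom Phi (t : R) (x : 'cV[R]_n) : Prop :=
  t = 0 \/ lm_dom Phi (t *: x).

(* The (open) set of points around which Phi^t is defined for all small t. It  *)
(* need not contain the origin, nor be the whole space: the flow of a vector   *)
(* field with poles is only defined away from them.                            *)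
Definition flow_base Phi : set 'cV[R]_n :=
  [set x | \forall tx \near ((0 : R), x), flow_dom Phi tx.1 tx.2].

Definition projective_flow Phi : Prop :=
  [/\ open (lm_dom Phi), flow_base Phi !=set0,
      forall x, flow_base Phi x ->
        (t^-1 *: Phi (t *: x)) @[t --> (0 : R)^'] --> x
    & forall (s t : R) x,
        flow_dom Phi s x -> flow_dom Phi t (flow Phi s x) ->
        flow_dom Phi (t + s) x ->
        flow Phi (t + s) x = flow Phi t (flow Phi s x)].

(* Q is rational, hence determined by its values on a nonempty open set. *)
Definition has_vfield Phi (Q : vfield R n) : Prop :=
  forall x v : 'cV[R]_n, flow_base Phi x -> vf_value Q x v ->
    is_derive (0 : R) (1 : R) (fun t : R => flow Phi t x) v.

Definition invariant_vfield (gT : finGroupType) (G : {group gT})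
    (rG : mx_representation R G n) (Q : vfield R n) : Prop :=
  forall g, g \in G -> lin_conj (rG g) Q = Q.

Definition superflow_of (gT : finGroupType) (G : {group gT})
    (rG : mx_representation R G n) Phi : Prop :=
  projective_flow Phi /\
  exists Q : vfield R n,
    [/\ has_vfield Phi Q, Q != 0, vf_homog 2 Q, invariant_vfield rG Q
      & forall Q' : vfield R n, vf_homog 2 Q' -> invariant_vfield rG Q' ->
          (exists c : R, Q' = constfun n c *: Q) \/ higher_denom Q' Q].

(* rG is arbitrary: its complexification may be reducible or irreducible. *)
Definition superflow Phi : Prop :=
  exists (gT : finGroupType) (G : {group gT}) (rG : mx_representation R G n),
    mx_faithful rG /\ superflow_of rG Phi.

Definition linearly_conjugate Phi Phi' : Prop :=
  exists (Q Q' : vfield R n) (L : 'M[R]_n),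
    [/\ has_vfield Phi Q, has_vfield Phi' Q', L \in unitmx & Q' = lin_conj L Q].

Definition solenoidal Phi : Prop :=
  exists2 Q : vfield R n, has_vfield Phi Q & divergence Q = 0.

End Flows.

(* Main.v *)
(** Write the vector field of a superflow as P / D in lowest terms, with D of degree d. As
polynomial rings are factorial, every symmetry scales D by a character chi with values +1 and -1,
and P transforms by the same character; minimality says that (P, D) is, up to proportionality, the
only covariant pair of degree at most d. So each covariant pair built from P and D (the gradient of
P . x, (div P) x, cross products, Laplacians) either has degree more than d or is proportional to
(P, D); for instance, this forces grad (P . x) to be a multiple of P. We may assume that the group
is orthogonal.

If the group has a common eigenvector, these proportionalities are differential equations that
leave three fields up to linear conjugation. Otherwise -1 is not in the group, so g |-> det(g) g
embeds it in SO(3); counting the stabilisers of rotation axes shows that either three axes are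
permuted transitively or the group has order 60 with axes as for the icosahedron, hence the order
is at most 60. In both cases products and power sums h of the linear forms of the axes are
semi-invariants, and the covariant fields grad h and x cross grad h bound d and make P / D
divergence-free.
Finally, a group of order at most 60 embeds in the symmetric group on 60 points and has finitely many
irreducible representations, and isomorphic representations have linearly conjugate fields. *)

From HB Require Import structures.
From mathcomp Require Import all_boot all_order all_algebra all_fingroup.
From mathcomp Require Import generic_quotient fraction pgroup mxrepresentation complex.
From mathcomp Require Import boolp reals.
From mathcomp Require Import ring lra zify.
From mathcomp Require mpoly.
Import -(notations) mpoly.
Require Import Defs.

Set Implicit Arguments.
Unset Strict Implicit.
Unset Printing Implicit Defensive.

Import Order.TTheory GRing.Theory Num.Theory.
Local Open Scope ring_scope.

(** The fields of groups without a common eigenvector are never listed: that they are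
    divergence-free is read off from competing covariant fields, and finiteness comes from counting
    representations. With [w = x + iy], the three explicit fields are [z (-y, x, 0)], the conjugate
    of [w^2], and the conjugate of [w^3] divided by [z]. The final list keeps just those classes
    that some superflow realises. Homogeneity is treated as one more symmetry: degree [d] means
    eigenvalue [2^d] under [x |-> 2x], so a single argument about reduced denominators yields both
    the homogeneity of [D] and the characters. One device recurs near an axis: a semi-invariant [f]
    two degrees below a minimal object vanishes, since [z^2 f] and [(x^2 + y^2) f] would both be
    proportional to that object, hence to each other. The exclusion of -1 is parity: [P] and [D]
    have degrees [d + 2] and [d], so -1 scales both by the same sign, whereas covariance asks for
    opposite signs. The bound 60 is the order of the icosahedral rotation group. *)

Section Divisibility.
Variable A : idomainType.
Implicit Types (a b c p u : A) (s : seq A).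

Definition divides a b := exists c, b = a * c.

Definition prime_elt p :=
  [/\ p != 0, ~ divides p 1 &
      forall a b, divides p (a * b) -> divides p a \/ divides p b].

(** The factors are prime, not merely irreducible, so uniqueness of the factorisation is built
    in. *)
Definition factorial_dom := forall a, a != 0 -> exists s u,
  [/\ divides u 1, {in s, forall p, prime_elt p} & a = u * \prod_(p <- s) p].

Lemma divides_mulr a b c : divides a b -> divides a (b * c).
Proof. by case=> d ->; exists (d * c); rewrite mulrA. Qed.

Lemma divides_mull a b c : divides a b -> divides a (c * b).
Proof. by move=> h; rewrite mulrC; exact: divides_mulr. Qed.

Lemma divides_refl a : divides a a.
Proof. by exists 1; rewrite mulr1. Qed.

Lemma divides_trans a b c : divides a b -> divides b c -> divides a c.
Proof. by move=> [x ->] [y ->]; exists (x * y); rewrite mulrA. Qed.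

Lemma divides_prod s a : a \in s -> divides a (\prod_(p <- s) p).
Proof.
elim: s => // b s IH; rewrite inE big_cons => /orP[/eqP->|/IH].
  by apply: divides_mulr; exact: divides_refl.
exact: divides_mull.
Qed.

Lemma prime_divides_prod p s : prime_elt p -> divides p (\prod_(x <- s) x) ->
  exists2 x, x \in s & divides p x.
Proof.
move=> [p0 p1 pP]; elim: s => [|x s IH]; first by rewrite big_nil.
rewrite big_cons => /pP[h|/IH[y ys h]]; first by exists x; rewrite ?mem_head.
by exists y => //; rewrite inE ys orbT.
Qed.

Lemma prime_not_divides_unit p u : prime_elt p -> divides u 1 -> ~ divides p u.
Proof. by case=> _ h _ hu hp; apply: h; exact: divides_trans hp hu. Qed.

Lemma prime_associate p x : prime_elt p -> prime_elt x -> divides p x ->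
  divides x p.
Proof.
move=> [p0 p1 pP] [x0 x1 xP] [r xr].
have [|//|[t rt]] := xP p r; first by rewrite -xr; exact: divides_refl.
case: p1; exists t; apply: (mulfI x0).
by rewrite mulr1 {1}xr {1}rt; ring.
Qed.

(** This is what makes a reduced denominator divide every other one: each prime of the product
    misses some [N i], so it must divide [E], and the primes are cancelled one at a time. *)
Lemma prod_divides_cancel (s : seq A) (I : Type) (N : I -> A) E :
  {in s, forall p, prime_elt p /\ exists i, ~ divides p (N i)} ->
  (forall i, divides (\prod_(p <- s) p) (E * N i)) ->
  divides (\prod_(p <- s) p) E.
Proof.
elim: s E => [|p s IH] E hs hE; first by rewrite big_nil; exists E; rewrite mul1r.
have [[p0 p1 pP] [i hi]] := hs p (mem_head _ _).
have : divides p (E * N i).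
  by apply: divides_trans (hE i); apply: divides_prod; rewrite mem_head.
case/pP => [[E1 eE]|//].
have [|j|c ec] := IH E1.
- by move=> x xs; apply: hs; rewrite inE xs orbT.
- have [c ec] := hE j; exists c; apply: (mulfI p0).
  by move: ec; rewrite eE big_cons -!mulrA.
- by rewrite big_cons eE; exists c; rewrite ec mulrA.
Qed.

End Divisibility.

Arguments factorial_dom : clear implicits.

(** * Gauss's lemma: polynomials over a factorial domain *)

Section FactorialPoly.
Variable A : idomainType.
Hypothesis facA : factorial_dom A.
Implicit Types (p c : A) (f g h : {poly A}).

(** A prime dividing the product divides one of the two leading coefficients; subtracting that
    leading term keeps the divisibility and lowers the total size. *)
Lemma prime_polyC p : prime_elt p -> prime_elt p%:P.
Proof.
move=> [p0 p1 pP]; split; first by rewrite polyC_eq0.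
  move=> [f /(congr1 (fun f => f`_0))]; rewrite coefCM coef1 /= => e.
  by apply: p1; exists (f`_0).
move=> f g; have [n] := ubnP (size f + size g)%N; elim: n f g => // n IH f g ln.
have [->|f0] := eqVneq f 0; first by left; exists 0; rewrite mulr0.
have [->|g0] := eqVneq g 0; first by right; exists 0; rewrite mulr0.
move=> [h fgh].
have lead_red (k : {poly A}) c : k != 0 -> lead_coef k = p * c ->
  (size (k - (p * c) *: 'X^((size k).-1))%R < size k)%N.
  move=> k0 ek; have sk : (0 < size k)%N by rewrite size_poly_gt0.
  have le : (size (k - (p * c) *: 'X^((size k).-1))%R <= size k)%N.
    rewrite (leq_trans (size_polyD _ _)) // geq_max leqnn size_polyN /=.
    rewrite (leq_trans (size_scale_leq _ _)) // size_polyXn prednK //.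
  rewrite ltn_neqAle le andbT; apply/eqP => es.
  have : lead_coef (k - (p * c) *: 'X^((size k).-1)) = 0.
    by rewrite lead_coefE es coefB coefZ coefXn eqxx mulr1 -ek lead_coefE subrr.
  by move/eqP; rewrite lead_coef_eq0 -size_poly_eq0 es size_poly_eq0 (negPf k0).
have : divides p (lead_coef f * lead_coef g).
  by exists (lead_coef h); rewrite -lead_coefM fgh lead_coefM lead_coefC.
case/pP => [[c ec]|[c ec]].
- have lt := lead_red f c f0 ec.
  have [||[f' ef]|] := IH (f - (p * c) *: 'X^((size f).-1)) g.
  + by rewrite ltnS in ln; apply: leq_trans ln; rewrite -addSn leq_add2r.
  + exists (h - (c *: 'X^((size f).-1)) * g); rewrite mulrBl fgh mulrBr.
    congr (_ - _); rewrite -!mul_polyC polyCM; ring.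
  + left; exists (f' + c *: 'X^((size f).-1)); rewrite mulrDr -ef.
    by rewrite mul_polyC scalerA subrK.
  + by right.
- have lt := lead_red g c g0 ec.
  have [||//|[g' eg]] := IH f (g - (p * c) *: 'X^((size g).-1)).
  + by rewrite ltnS in ln; apply: leq_trans ln; rewrite -addnS leq_add2l.
  + exists (h - f * (c *: 'X^((size g).-1))); rewrite mulrBr fgh mulrBr.
    congr (_ - _); rewrite -!mul_polyC polyCM; ring.
  + by left.
  + right; exists (g' + c *: 'X^((size g).-1)); rewrite mulrDr -eg.
    by rewrite mul_polyC scalerA subrK.
Qed.

(** Pseudo-division yields factorisations only up to a scalar [c]. Each prime of [c] divides [g] or
    [h], so [c] can be distributed over the two factors. *)
Lemma poly_cancel_scalar c f g h : c != 0 -> c *: f = g * h ->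
  exists c1 c2 g' h', [/\ c1 != 0, c2 != 0, g = c1 *: g', h = c2 *: h' & f = g' * h'].
Proof.
move=> c0; have [s [u [[v uv] sP ec]]] := facA c0; rewrite {c}ec in c0 *.
elim: s sP g h c0 => [|p s IH] sP g h c0 e.
  move: c0 e; rewrite big_nil mulr1 => u0 e.
  have v0 : v != 0 by apply: contraTneq isT => v0; move: uv; rewrite v0 mulr0 => /eqP; rewrite oner_eq0.
  exists u, 1, (v *: g), h; split; rewrite ?oner_eq0 ?scale1r //.
    by rewrite scalerA -uv scale1r.
  by rewrite -scalerAl -e scalerA mulrC -uv scale1r.
have [p0 p1 pP] : prime_elt p%:P by apply: prime_polyC; apply: sP; rewrite mem_head.
rewrite polyC_eq0 in p0.
have c0' : u * \prod_(j <- s) j != 0.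
  by move: c0; rewrite big_cons !mulf_eq0 !negb_or => /and3P[-> _ ->].
have sP' : {in s, forall p, prime_elt p}.
  by move=> x xs; apply: sP; rewrite inE xs orbT.
have P0 : p%:P != 0 :> {poly A} by rewrite polyC_eq0.
have {}e : p%:P * ((u * \prod_(j <- s) j) *: f) = g * h.
  by rewrite -e big_cons mul_polyC scalerA; congr (_ *: _); ring.
have : divides p%:P (g * h) by rewrite -e; exists ((u * \prod_(j <- s) j) *: f).
case/pP => [[g1 eg]|[h1 eh]].
- have {}e : (u * \prod_(j <- s) j) *: f = g1 * h.
    by apply: (mulfI P0); rewrite e eg mulrA.
  have [c1 [c2 [g' [h' [c10 c20 e1 e2 e3]]]]] := IH sP' _ _ c0' e.
  by exists (p * c1), c2, g', h'; split; rewrite ?mulf_neq0 // eg e1 mul_polyC scalerA.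
- have {}e : (u * \prod_(j <- s) j) *: f = g * h1.
    by apply: (mulfI P0); rewrite e eh; ring.
  have [c1 [c2 [g' [h' [c10 c20 e1 e2 e3]]]]] := IH sP' _ _ c0' e.
  by exists c1, (p * c2), g', h'; split; rewrite ?mulf_neq0 // eh e2 mul_polyC scalerA.
Qed.

(** The hypothesis says that [f] is primitive: the scalar that [poly_cancel_scalar] pulls out of it
    has no prime factor, so it is a unit and pseudo-divisibility becomes divisibility. *)
Lemma pdivides_primitive f g : (forall p, prime_elt p -> ~ divides p%:P f) ->
  Pdiv.Idomain.dvdp f g -> divides f g.
Proof.
move=> prf /Pdiv.Idomain.dvdpP[[c q] /= c0 e].
have [c1 [c2 [q' [f' [c10 c20 eq ef eg]]]]] := poly_cancel_scalar c0 e.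
have [s [u [[v uv] sP ec]]] := facA c20.
case: s sP ec => [_|p s sP].
  rewrite big_nil mulr1 => ec; exists (q' * v%:P).
  rewrite eg ef ec -mul_polyC; transitivity (q' * f' * (u * v)%:P); last by rewrite polyCM; ring.
  by rewrite -uv mulr1.
rewrite big_cons => ec; case: (prf p); first by apply: sP; rewrite mem_head.
by exists ((u * \prod_(j <- s) j) *: f'); rewrite ef ec mul_polyC scalerA; congr (_ *: _); ring.
Qed.

(** The pseudo-gcd of [f] and [g] has either the size of [f], and then [f] divides [g], or size one,
    and then coprimality sends [f] into the other factor. *)
Lemma irreducible_prime f : (1 < size f)%N ->
  (forall p, prime_elt p -> ~ divides p%:P f) ->
  (forall g h, f = g * h -> (size g <= 1)%N \/ (size h <= 1)%N) -> prime_elt f.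
Proof.
move=> sf prf irf; have f0 : f != 0 by rewrite -size_poly_gt0; apply: ltn_trans sf.
split=> //.
  move=> [g eg]; have g0 : g != 0 by apply: contraTneq isT => g0; move: eg; rewrite g0 mulr0 => /eqP; rewrite oner_eq0.
  have := size_mul f0 g0; rewrite -eg size_poly1.
  by move: sf; rewrite -size_poly_gt0 in g0; move: g0; lia.
move=> g h fgh; set d := Pdiv.Idomain.gcdp f g.
have /Pdiv.Idomain.dvdpP[[c q] /= c0 e] := Pdiv.Idomain.dvdp_gcdl f g.
have [c1 [c2 [q' [d' [c10 c20 eq ed ef]]]]] := poly_cancel_scalar c0 e.
have d'0 : d' != 0 by apply: contraNneq f0 => z; rewrite ef z mulr0.
have q'0 : q' != 0 by apply: contraNneq f0 => z; rewrite ef z mul0r.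
case: (irf _ _ ef) => sz.
- left; apply: pdivides_primitive => //.
  apply: Pdiv.Idomain.dvdp_trans (Pdiv.Idomain.dvdp_gcdr f g).
  have [a qa] : exists a, q' = a%:P by exists q'`_0; exact: size1_polyC.
  apply/Pdiv.Idomain.dvdpP; exists (a, c2%:P) => /=.
    by rewrite qa polyC_eq0 in q'0.
  by rewrite ed ef qa -!mul_polyC; ring.
- right; apply: pdivides_primitive => //.
  have cop : Pdiv.Idomain.coprimep f g.
    by rewrite Pdiv.Idomain.coprimep_def ed size_scale // eqn_leq sz size_poly_gt0.
  rewrite -(Pdiv.Idomain.Gauss_dvdpr _ cop).
  case: fgh => k ek; apply/Pdiv.Idomain.dvdpP; exists (1, k) => /=.
    exact: oner_neq0.
  by rewrite scale1r ek mulrC.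
Qed.

(** A prime dividing [f] divides its leading coefficient, so it is associate to one of the finitely
    many primes there; dividing by that one shortens the list, which makes the process end. *)
Lemma extract_content f : f != 0 -> exists (s : seq A) g,
  [/\ {in s, forall p, prime_elt p}, f = \prod_(p <- s) p%:P * g, size g = size f &
      (forall p, prime_elt p -> ~ divides p%:P g)].
Proof.
move=> f0; have l0 : lead_coef f != 0 by rewrite lead_coef_eq0.
have [s [u [uu sP el]]] := facA l0; have [n] := ubnP (size s).
elim: n f f0 l0 s sP el => // n IH f f0 l0 s sP el ln.
have [[p [pP [g eg]]]|no] := pselect (exists p, prime_elt p /\ divides p%:P f); last first.
  exists [::], f; split => //; first by rewrite big_nil mul1r.
  by move=> p pP hp; apply: no; exists p.
have [p0 _ pp] := pP.
have : divides p (lead_coef f) by exists (lead_coef g); rewrite eg lead_coefM lead_coefC.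
rewrite el => /pp[/(prime_not_divides_unit pP uu)//|].
move=> /(prime_divides_prod pP)[x xs px].
have xP := sP _ xs; have [y ey] := prime_associate pP xP px.
have [x0 _ _] := xP.
have eg' : f = x%:P * (y%:P * g) by rewrite mulrA -polyCM -ey.
set g' := y%:P * g in eg'.
have g'0 : g' != 0 by apply: contraNneq f0 => z; rewrite eg' z mulr0.
have lg' : lead_coef g' = u * \prod_(j <- rem x s) j.
  apply: (mulfI x0); rewrite -[in LHS](lead_coefC x) -lead_coefM -eg' el.
  by rewrite (perm_big _ (perm_to_rem xs)) big_cons /= mulrCA.
have [|||s' [h [s'P eh sh hP]]] := IH g' g'0 _ (rem x s) _ lg'.
- by rewrite lead_coef_eq0.
- by move=> z /mem_rem; exact: sP.
- by rewrite size_rem //; move: ln; case: (s) xs => // ? ?; rewrite ltnS.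
exists (x :: s'), h; split => //.
- by move=> z; rewrite inE => /orP[/eqP->|/s'P].
- by rewrite big_cons eg' eh mulrA.
- by rewrite sh eg' mul_polyC size_scale.
Qed.

(** A splitting into two nonconstant factors lowers the size; without one, [f] is its content times
    a primitive polynomial that is either constant or prime. *)
Lemma factorial_poly : factorial_dom {poly A}.
Proof.
move=> f; have [n] := ubnP (size f); elim: n f => // n IH f ln f0.
have [[g [h [efgh sg sh]]]|irr] := pselect (exists g h, [/\ f = g * h, (1 < size g)%N & (1 < size h)%N]).
  have g0 : g != 0 by apply: contraNneq f0 => z; rewrite efgh z mul0r.
  have h0 : h != 0 by apply: contraNneq f0 => z; rewrite efgh z mulr0.
  have sz : size f = (size g + size h).-1 by rewrite efgh size_mul.
  have [|s [u [uu sP eg]]] := IH g _ g0; first by move: ln; rewrite ltnS; lia.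
  have [|t [v [vv tP eh]]] := IH h _ h0; first by move: ln; rewrite ltnS; lia.
  exists (s ++ t), (u * v); split.
  - by case: uu vv => [a ea] [b eb]; exists (a * b); rewrite mulrACA -ea -eb mulr1.
  - by move=> p; rewrite mem_cat => /orP[/sP|/tP].
  - by rewrite efgh big_cat /= eg eh; ring.
have [s [g [sP ef sg gP]]] := extract_content f0.
have sP' : {in [seq p%:P | p <- s], forall q : {poly A}, prime_elt q}.
  by move=> q /mapP[p ps ->]; apply: prime_polyC; exact: sP.
have [s1|s1] := leqP (size g) 1.
- have gc : g = (g`_0)%:P by exact: size1_polyC.
  have g00 : g`_0 != 0.
    by apply: contraNneq f0 => z; rewrite ef gc z polyC0 mulr0.
  have [t [u [[v uv] tP eg]]] := facA g00.
  exists ([seq p%:P | p <- s] ++ [seq p%:P | p <- t]), u%:P; split.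
  + by exists v%:P; rewrite -polyCM -uv.
  + move=> q; rewrite mem_cat => /orP[/sP'//|/mapP[p pt ->]].
    by apply: prime_polyC; exact: tP.
  + rewrite {1}ef {1}gc eg big_cat /= !big_map polyCM rmorph_prod /=; ring.
- exists (rcons [seq p%:P | p <- s] g), 1; split.
  + exact: divides_refl.
  + move=> q; rewrite mem_rcons inE => /orP[/eqP->|/sP'//].
    apply: irreducible_prime => // h k e.
    have [?|h1] := leqP (size h) 1; first by left.
    have [?|k1] := leqP (size k) 1; first by right.
    case: irr; exists (\prod_(p <- s) p%:P * h), k; split => //; first by rewrite ef e mulrA.
    by rewrite -rmorph_prod /= mul_polyC size_scale //; apply: contraNneq f0 => z; rewrite ef -rmorph_prod /= z polyC0 mul0r.
  + by rewrite mul1r -cats1 big_cat /= big_seq1 big_map.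
Qed.

End FactorialPoly.

(** * Factoriality of multivariate polynomials *)

Section FactorialMpoly.

Lemma factorial_iso (A B : idomainType) (f : {rmorphism A -> B}) (g : {rmorphism B -> A}) :
  cancel f g -> cancel g f -> factorial_dom A -> factorial_dom B.
Proof.
move=> fK gK facA b b0; have a0 : g b != 0 by rewrite -(inj_eq (can_inj fK)) gK rmorph0.
have divf x y : divides x y -> divides (f x) (f y).
  by case=> z ->; exists (f z); rewrite rmorphM.
have divg x y : divides x y -> divides (g x) (g y).
  by case=> z ->; exists (g z); rewrite rmorphM.
have [s [u [uu sP eb]]] := facA _ a0.
exists [seq f x | x <- s], (f u); split.
- by rewrite -(rmorph1 f); exact: divf.
- move=> _ /mapP[x xs ->]; have [x0 x1 xp] := sP _ xs; split.
  + by rewrite -(rmorph0 f) (inj_eq (can_inj fK)).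
  + by move=> /divg; rewrite fK rmorph1.
  + move=> y z /divg; rewrite fK rmorphM => /xp[]/divf; rewrite gK; tauto.
- by rewrite -{1}(gK b) eb rmorphM rmorph_prod big_map.
Qed.

Lemma mpoly_rmorph_ext (R : comNzRingType) n (S : comNzRingType) (f g : {rmorphism mpoly n R -> S}) :
  (forall c, f (mpolyC n c) = g (mpolyC n c)) ->
  (forall i, f (mpolyX R (mnm1 i)) = g (mpolyX R (mnm1 i))) -> f =1 g.
Proof.
move=> hC hX p; rewrite (mpolyE p) !rmorph_sum; apply: eq_bigr => m _.
rewrite -mul_mpolyC !rmorphM hC; congr (_ * _).
rewrite mpolyXE_id !rmorph_prod; apply: eq_bigr => i _.
by rewrite !rmorphXn hX.
Qed.

Lemma factorial_mpoly (R : fieldType) n : factorial_dom (mpoly n R).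
Proof.
elim: n => [|n IH].
  move=> p p0; exists [::], p; split => //; last by rewrite big_nil mulr1.
  have [c ep] : exists c, p = mpolyC 0 c.
    eexists; apply: msize1_polyC; rewrite msizeE; apply/bigmax_leqP_seq => -[m] _ _.
    by rewrite tuple0 mdegE big_ord0.
  exists (mpolyC 0 c^-1); rewrite ep -mpolyCM divff //.
  by apply: contraNneq p0 => z; rewrite ep z mpolyC0.
(* Evaluation of the polynomial variable at the last coordinate, inverse to [muni]. *)
pose f (p : {poly mpoly n R}) : mpoly n.+1 R := (map_poly (@mwiden n R) p).[mpolyX R (mnm1 ord_max)].
have fM : multiplicative f by split=> [p q|]; rewrite /f ?rmorphM ?rmorph1 /= ?hornerM ?hornerC.
have fA : additive f by move=> p q; rewrite /f rmorphB /= hornerD hornerN.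
pose f1 : {rmorphism {poly mpoly n R} -> mpoly n.+1 R} :=
  HB.pack f (GRing.isAdditive.Build _ _ f fA) (GRing.isMultiplicative.Build _ _ f fM).
have f0 : f 0 = 0 := raddf0 f1.
have fD x y : f (x + y) = f x + f y := raddfD f1 x y.
have fX : f 'X = mpolyX R (mnm1 ord_max) by rewrite /f map_polyX hornerX.
have fC c : f c%:P = mwiden c by rewrite /f map_polyC hornerC.
have uX : @muni n R (mpolyX R (mnm1 ord_max)) = 'X.
  rewrite /muni mmapX mmap1U.
  by case: splitP => [j /= e|[[] //]]; have := ltn_ord j; rewrite -e ltnn.
have uW c : @muni n R (mwiden c) = c%:P.
  apply: (@mpoly_rmorph_ext _ _ _ (@muni n R \o @mwiden n R) polyC) => [k|i] /=.
    by rewrite mwidenC muniC.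
  rewrite mwidenX mnmwiden1 /muni mmapX mmap1U.
  case: splitP => [j /= e|[[] //= _ e]]; first by congr (mpolyX _ (mnm1 _))%:P; exact/val_inj/esym.
  by have := ltn_ord i; rewrite e addn0 ltnn.
apply: (@factorial_iso _ _ f1 (@muni n R)) (factorial_poly IH).
- move=> p /=; elim/poly_ind: p => [|p c e]; first by rewrite f0 muni0.
  by rewrite fD (fst fM) fX fC muniD muniM e uX uW.
- apply: (@mpoly_rmorph_ext _ _ _ (f1 \o @muni n R) idfun) => [k|i] /=.
    by rewrite muniC fC mwidenC.
  rewrite /muni mmapX mmap1U; case: splitP => [j /= e|[[] //= _ e]].
    by rewrite fC mwidenX mnmwiden1; congr (mpolyX _ (mnm1 _)); exact/val_inj/esym.
  by rewrite fX; congr (mpolyX _ (mnm1 _)); apply: val_inj; rewrite /= e addn0.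
Qed.
End FactorialMpoly.

Notation var R i := (mpolyX R (mnm1 i)).
Notation homogen d p := (p \is @ishomog1 _ _ d mdeg).

(** * Linear substitutions and homogeneity *)

Section PolyComp.
Variables (R : realType) (n : nat).
Implicit Types (p q : mpoly n R) (A B L : 'M[R]_n).

Lemma mpoly_ring_ind (P : mpoly n R -> Prop) :
  (forall c, P (mpolyC n c)) -> (forall i, P (var R i)) ->
  (forall p q, P p -> P q -> P (p + q)) -> (forall p q, P p -> P q -> P (p * q)) ->
  forall p, P p.
Proof.
move=> hC hX hD hM p; rewrite (mpolyE p).
apply: (big_ind P) => [|//|m _]; first by rewrite -mpolyC0.
rewrite -mul_mpolyC; apply: (hM) => //; rewrite mpolyXE_id.
apply: (big_ind P _ hM) => [|i _]; first by rewrite -mpolyC1.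
elim: (m i) => [|k IH]; first by rewrite expr0 -mpolyC1.
by rewrite exprS; exact: hM.
Qed.

HB.instance Definition _ L := GRing.RMorphism.copy (@poly_comp R n L)
  (comp_mpoly [tuple \sum_(j < n) L i j *: var R j | i < n]).
HB.instance Definition _ L := GRing.Linear.copy (@poly_comp R n L)
  (comp_mpoly [tuple \sum_(j < n) L i j *: var R j | i < n]).

Lemma poly_compC L c : poly_comp L (mpolyC n c) = mpolyC n c.
Proof. exact: comp_mpolyC. Qed.

Lemma poly_compX L i : poly_comp L (var R i) = \sum_(j < n) mpolyC n (L i j) * var R j.
Proof.
rewrite /poly_comp comp_mpolyXU -tnth_nth tnth_mktuple.
by apply: eq_bigr => j _; rewrite mul_mpolyC.
Qed.

Lemma poly_comp1 p : poly_comp 1%:M p = p.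
Proof.
move: p; apply: (@mpoly_rmorph_ext _ _ _ (@poly_comp R n 1%:M) idfun) => [c|i] /=.
  exact: poly_compC.
rewrite poly_compX (bigD1 i) //= mxE eqxx mpolyC1 mul1r big1 ?addr0 // => j ji.
by rewrite mxE eq_sym (negPf ji) mpolyC0 mul0r.
Qed.

Lemma poly_comp_comp A B p : poly_comp A (poly_comp B p) = poly_comp (B *m A) p.
Proof.
move: p; apply: (@mpoly_rmorph_ext _ _ _ (@poly_comp R n A \o @poly_comp R n B) (@poly_comp R n (B *m A))) => [c|i] /=.
  by rewrite !poly_compC.
rewrite !poly_compX rmorph_sum /=.
under eq_bigr => j _ do rewrite rmorphM /= poly_compC poly_compX mulr_sumr.
rewrite exchange_big /=; apply: eq_bigr => k _.
rewrite mxE rmorph_sum mulr_suml; apply: eq_bigr => j _.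
by rewrite rmorphM mulrA.
Qed.

Lemma poly_compK L : L \in unitmx -> cancel (@poly_comp R n L) (poly_comp (invmx L)).
Proof. by move=> uL p; rewrite poly_comp_comp mulmxV // poly_comp1. Qed.

Lemma poly_comp_eq0 L p : L \in unitmx -> (poly_comp L p == 0) = (p == 0).
Proof. move=> uL; apply/eqP/eqP => [h|->]; last exact: rmorph0.
by rewrite -(poly_compK uL p) h rmorph0. Qed.

Lemma mderiv_var (i j : 'I_n) : mderiv i (var R j) = (i == j)%:R.
Proof.
rewrite mderivX mnm1E; have [->|ne] := eqVneq i j.
  rewrite scale1r -mpolyX0; congr mpolyX; apply/mnmP => k; by rewrite mnmBE mnm0E subnn.
by rewrite scale0r.
Qed.

Lemma mderiv_poly_comp L p k :
  mderiv k (poly_comp L p) = \sum_(i < n) mpolyC n (L i k) * poly_comp L (mderiv i p).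
Proof.
elim/mpoly_ring_ind: p => [c|j|p q IHp IHq|p q IHp IHq].
- by rewrite poly_compC mderivC big1 // => i _; rewrite mderivC rmorph0 mulr0.
- rewrite poly_compX raddf_sum /=.
  under eq_bigr => i _ do rewrite mderiv_mulC mderiv_var.
  rewrite (bigD1 k) //= eqxx mulr1 big1 ?addr0; last by move=> i ik; rewrite eq_sym (negPf ik) mulr0.
  rewrite (bigD1 j) //= mderiv_var eqxx rmorph1 mulr1 big1 ?addr0 // => i ij.
  by rewrite mderiv_var (negPf ij) rmorph0 mulr0.
- rewrite rmorphD mderivD IHp IHq -big_split; apply: eq_bigr => i _ /=.
  by rewrite mderivD rmorphD mulrDr.
- rewrite rmorphM mderivM IHp IHq mulr_suml mulr_sumr -big_split; apply: eq_bigr => i _ /=.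
  rewrite mderivM rmorphD !rmorphM /=; ring.
Qed.

Lemma mcoeff_poly_comp_scalar (a : R) p m :
  mcoeff m (poly_comp a%:M p) = a ^+ mdeg m * mcoeff m p.
Proof.
have compX (k : multinom n) : poly_comp a%:M (mpolyX R k) = a ^+ mdeg k *: mpolyX R k.
  rewrite [in LHS]mpolyXE_id rmorph_prod /=.
  have -> : \prod_(i < n) poly_comp a%:M (var R i ^+ k i) = \prod_(i < n) (mpolyC n (a ^+ k i) * var R i ^+ k i).
    apply: eq_bigr => i _; rewrite rmorphXn /= poly_compX (bigD1 i) //= big1 ?addr0.
      by rewrite mxE eqxx exprMn rmorphXn.
    by move=> j ji; rewrite mxE eq_sym (negPf ji) mpolyC0 mul0r.
  by rewrite big_split /= -mul_mpolyC mdegE expr_sum rmorph_prod [in RHS]mpolyXE_id.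
elim/mpolyind: p => [|c k p mp c0 IH]; first by rewrite rmorph0 mcoeff0 mulr0.
rewrite rmorphD /= linearZ /= compX !mcoeffD !mcoeffZ IH mulrDr mcoeffX.
by case: eqVneq => [->|_]; rewrite ?mulr0 ?mulr1 //; congr (_ + _); rewrite mulrC.
Qed.

(** The powers of 2 are distinct, so the eigenvalue under the dilatation by 2 detects the degree of
    every monomial. Stability of homogeneity under substitution and differentiation then follows by
    commuting operators. *)
Lemma homogenP d p : reflect (poly_comp 2%:M p = mpolyC n (2 ^+ d) * p) (homogen d p).
Proof.
apply: (iffP idP) => [/dhomogP hp|e].
  apply/mpolyP => m; rewrite mcoeff_poly_comp_scalar mcoeffCM.
  by case: (boolP (m \in msupp p)) => [/hp->//|/memN_msupp_eq0->]; rewrite !mulr0.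
apply/dhomogP => m mp; move/mpolyP/(_ m): e.
rewrite mcoeff_poly_comp_scalar mcoeffCM; move/mulIf.
rewrite -mcoeff_msupp => /(_ mp) /eqP; rewrite -!natrX eqr_nat eqn_exp2l //.
by move/eqP.
Qed.

Lemma homogen_eigen (c : R) p : p != 0 -> poly_comp 2%:M p = mpolyC n c * p ->
  exists d, homogen d p.
Proof.
move=> p0 e; exists (mdeg (mlead p)); apply/homogenP; rewrite e; congr (mpolyC n _ * _).
move/mpolyP/(_ (mlead p)): e; rewrite mcoeff_poly_comp_scalar mcoeffCM => /mulIf -> //.
by rewrite -mcoeff_msupp mlead_supp.
Qed.

Lemma homogen_poly_comp L d p : homogen d p -> homogen d (poly_comp L p).
Proof.
move/homogenP => e; apply/homogenP.
by rewrite poly_comp_comp scalar_mxC -poly_comp_comp e rmorphM /= poly_compC.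
Qed.

Lemma homogen_mderiv d p i : homogen d p -> homogen d.-1 (mderiv i p).
Proof.
case: d => [|d] hp.
  (* In degree 0 the predecessor is truncated to 0; the claim survives because the derivative of a
     constant is 0. *)
  suff -> : mderiv i p = 0 by exact: dhomog0.
  rewrite (@msize1_polyC _ _ p) ?mderivC // msizeE.
  by apply/bigmax_leqP_seq => m mp _; rewrite (dhomogP _ _ _ hp m mp).
apply/homogenP; move/homogenP: hp => /(congr1 (mderiv i)).
rewrite mderiv_mulC mderiv_poly_comp (bigD1 i) //= mxE eqxx big1 ?addr0.
  rewrite exprS mpolyCM -mulrA => /mulfI -> //.
  by rewrite mpolyC_eq0 pnatr_eq0.
by move=> j ji; rewrite mxE (negPf ji) mpolyC0 mul0r.
Qed.

Lemma euler_identity d p : homogen d p ->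
  \sum_(i < n) var R i * mderiv i p = mpolyC n d%:R * p.
Proof.
move/dhomogP => hp; rewrite {2}(mpolyE p) mulr_sumr.
under eq_bigr => i _ do rewrite {1}(mpolyE p) raddf_sum mulr_sumr.
rewrite exchange_big /=; apply: eq_big_seq => m mp.
under eq_bigr => i _ do rewrite mderivZ mderivX -scalerAr.
rewrite mul_mpolyC -scaler_sumr scalerA (mulrC d%:R) -scalerA; congr (_ *: _).
have -> : d = (\sum_(i < n) m i)%N by rewrite -mdegE; exact/esym/hp.
rewrite natr_sum scaler_suml; apply: eq_bigr => i _.
rewrite -scalerAr -mpolyXD; have [->|mi] := posnP (m i); first by rewrite !scale0r.
congr (_ *: mpolyX _ _); apply/mnmP => j; rewrite mnmDE mnmBE mnm1E.
by case: eqVneq => [<-|_]; [rewrite subnKC|rewrite subn0].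
Qed.

Lemma homogenC (c : R) : homogen 0%N (mpolyC n c).
Proof. by apply/homogenP; rewrite poly_compC expr0 mpolyC1 mul1r. Qed.

Lemma homogen_var (i : 'I_n) : homogen 1%N (var R i).
Proof. by rewrite dhomogX; apply/eqP; exact: mdeg1. Qed.

Lemma homogen_mulC d (c : R) p : homogen d p -> homogen d (mpolyC n c * p).
Proof. by move=> hp; rewrite -[d]add0n; apply: dhomogM => //; exact: homogenC. Qed.

Lemma msize_homogen d p : p != 0 -> homogen d p -> mmeasure mdeg p = d.+1.
Proof.
move=> p0 hp; rewrite mpolySpred //; congr _.+1; apply/esym.
exact: dhomog_uniq p0 hp (dhomog_msize hp).
Qed.

Lemma homogen0_const p : homogen 0%N p -> exists c : R, p = mpolyC n c.
Proof.
move=> hp; eexists; apply: msize1_polyC; rewrite msizeE.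
by apply/bigmax_leqP_seq => m mp _; rewrite (dhomogP _ _ _ hp m mp).
Qed.

Lemma homogen_mderiv_eq0 d p : homogen d.+1 p -> (forall i, mderiv i p = 0) -> p = 0.
Proof.
move=> hp h; have := euler_identity hp; rewrite big1 => [|i _]; last by rewrite h mulr0.
move/esym/eqP; rewrite mulf_eq0 mpolyC_eq0 pnatr_eq0 /=.
by move/eqP.
Qed.

Lemma homogen_msize p q : p != 0 -> mmeasure mdeg q = mmeasure mdeg p ->
  divides p q -> exists c : R, q = mpolyC n c * p.
Proof.
move=> p0 sz [r eq]; have [r0|r0] := eqVneq r 0.
  by exists 0; rewrite eq r0 mulr0 mpolyC0 mul0r.
have p1 : (0 < mmeasure mdeg p)%N by rewrite lt0n mmeasure_poly_eq0.
move: sz; rewrite eq msizeM // => sz.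
have /msize_poly1P[c _ ->] : mmeasure mdeg r == 1%N.
  by move: p1 sz; move: (mmeasure _ p) (mmeasure _ r) => a b; lia.
by exists c; rewrite mulrC.
Qed.

End PolyComp.

(** * Rational vector fields as polynomial vectors over a common denominator *)

Section RationalFields.
Variables (R : realType) (n : nat).
Implicit Types (p q N D E : mpoly n R) (L M : 'M[R]_n) (P : 'I_n -> mpoly n R).

HB.instance Definition _ := GRing.RMorphism.copy (@toratfun R n) (@FracField.tofrac (mpoly n R)).

Lemma toratfun_eq p q : (toratfun p == toratfun q) = (p == q).
Proof. exact: tofrac_eq. Qed.

Lemma toratfun_eq0 p : (toratfun p == 0) = (p == 0).
Proof. exact: tofrac_eq0. Qed.

Lemma ratfun_repr (f : ratfun R n) : f = toratfun (repr f).1 / toratfun (repr f).2.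
Proof.
have d0 := denom_ratioP (repr f).
apply: (canRL (mulfK _)); first by rewrite toratfun_eq0.
rewrite -{1}[f]reprK /toratfun; unlock FracField.tofrac.
rewrite -[LHS]FracField.pi_mul; apply/eqmodP; rewrite /= FracField.equivfE.
by rewrite /FracField.mulf !(numer_Ratio, denom_Ratio) ?oner_neq0 ?mulr1 // mulrC.
Qed.

Lemma eq_frac N D N' D' : D != 0 -> D' != 0 ->
  toratfun N / toratfun D = toratfun N' / toratfun D' <-> N * D' = N' * D.
Proof.
move=> D0 D0'; split=> [/eqP|e]; last apply/eqP.
  by rewrite eqr_div ?toratfun_eq0 // -!rmorphM toratfun_eq => /eqP.
by rewrite eqr_div ?toratfun_eq0 // -!rmorphM toratfun_eq e.
Qed.

Lemma ratfun_comp_frac L N D : L \in unitmx -> D != 0 ->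
  ratfun_comp L (toratfun N / toratfun D) =
  toratfun (poly_comp L N) / toratfun (poly_comp L D).
Proof.
move=> uL D0; rewrite /ratfun_comp; set f := toratfun N / toratfun D.
have d0 := denom_ratioP (repr f).
have /(eq_frac _ _ d0 D0) e : toratfun (repr f).1 / toratfun (repr f).2 = toratfun N / toratfun D.
  exact/esym/(ratfun_repr f).
have pc0 p : p != 0 -> poly_comp L p != 0 by rewrite poly_comp_eq0.
by apply/(eq_frac _ _ (pc0 _ d0) (pc0 _ D0)); rewrite -!rmorphM e.
Qed.

Lemma ratfun_deriv_frac i N D : D != 0 ->
  ratfun_deriv i (toratfun N / toratfun D) =
  toratfun (mderiv i N * D - N * mderiv i D) / toratfun D ^+ 2.
Proof.
move=> D0; rewrite /ratfun_deriv; set f := toratfun N / toratfun D.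
have d0 := denom_ratioP (repr f).
have /(eq_frac _ _ d0 D0) e : toratfun (repr f).1 / toratfun (repr f).2 = toratfun N / toratfun D.
  exact/esym/(ratfun_repr f).
rewrite -!rmorphXn /=; apply: (proj2 (eq_frac _ _ (expf_neq0 2 d0) (expf_neq0 2 D0))).
move: (congr1 (mderiv i) e); rewrite !mderivM.
move: e {d0}; move: (repr f).1 (repr f).2 => N1 D1 e e'.
have {}e' : mderiv i N1 * D = mderiv i N * D1 + N * mderiv i D1 - N1 * mderiv i D.
  by rewrite -e' addrK.
transitivity (mderiv i N1 * D * (D1 * D) - (N1 * D) * mderiv i D1 * D); first by ring.
rewrite e' e; transitivity (mderiv i N * D1 * D1 * D - (N1 * D) * mderiv i D * D1); first by ring.
by rewrite e; ring.
Qed.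

Definition fracv P D : vfield R n := \col_i (toratfun (P i) / toratfun D).

Definition mulv M P (i : 'I_n) : mpoly n R := \sum_j mpolyC n (M i j) * P j.

Lemma mulv_mul M L P i : mulv M (mulv L P) i = mulv (M *m L) P i.
Proof.
rewrite /mulv; under eq_bigr => j _ do rewrite mulr_sumr.
rewrite exchange_big; apply: eq_bigr => k _; rewrite mxE rmorph_sum mulr_suml.
by apply: eq_bigr => j _; rewrite rmorphM mulrA.
Qed.

Lemma mulv1 P i : mulv 1%:M P i = P i.
Proof.
rewrite /mulv (bigD1 i) //= mxE eqxx mpolyC1 mul1r big1 ?addr0 // => j ji.
by rewrite mxE eq_sym (negPf ji) mpolyC0 mul0r.
Qed.

Lemma mulv_ext M P P' i : P =1 P' -> mulv M P i = mulv M P' i.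
Proof. by move=> e; apply: eq_bigr => j _; rewrite e. Qed.

Lemma mulvZ M (c : R) P i : mulv M (fun j => mpolyC n c * P j) i = mpolyC n c * mulv M P i.
Proof. by rewrite /mulv mulr_sumr; apply: eq_bigr => j _; rewrite mulrCA. Qed.

Lemma poly_comp_mulv L M P i :
  poly_comp L (mulv M P i) = mulv M (fun j => poly_comp L (P j)) i.
Proof.
by rewrite /mulv rmorph_sum; apply: eq_bigr => j _; rewrite rmorphM /= poly_compC.
Qed.

Lemma eq_fracv P D P' D' : D != 0 -> D' != 0 ->
  fracv P D = fracv P' D' <-> forall i, P i * D' = P' i * D.
Proof.
move=> D0 D0'; split=> [/matrixP e i|e].
  by move: (e i 0); rewrite !mxE => /eq_frac->.
by apply/matrixP => i j; rewrite !mxE; apply/eq_frac.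
Qed.

Lemma lin_conj_fracv L P D : L \in unitmx -> D != 0 ->
  lin_conj L (fracv P D) =
  fracv (mulv (invmx L) (fun i => poly_comp L (P i))) (poly_comp L D).
Proof.
move=> uL D0; apply/matrixP => i j; rewrite !mxE /mulv rmorph_sum mulr_suml.
apply: eq_bigr => k _; rewrite !mxE ratfun_comp_frac // rmorphM mulrA.
by [].
Qed.

Lemma constfunZ_fracv (c : R) P D :
  constfun n c *: fracv P D = fracv (fun i => mpolyC n c * P i) D.
Proof. by apply/matrixP => i j; rewrite !mxE rmorphM mulrA. Qed.

Lemma fracv_common_denom P D : D != 0 -> common_denom (fracv P D) D.
Proof. by move=> D0; split=> // i; exists (P i); rewrite mxE. Qed.

Lemma common_denom_fracv Q D : common_denom Q D -> exists P, Q = fracv P D.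
Proof.
move=> [D0 /fin_all_exists[P eP]]; exists P.
by apply/matrixP => i j; rewrite ord1 mxE eP.
Qed.

Lemma common_denom_exists (Q : vfield R n) : exists D, common_denom Q D.
Proof.
exists (\prod_i (repr (Q i 0)).2); split.
  by apply/prodf_neq0 => i _; exact: denom_ratioP.
move=> i; exists ((repr (Q i 0)).1 * \prod_(j | j != i) (repr (Q j 0)).2).
rewrite [in LHS](ratfun_repr (Q i 0)); apply/eq_frac.
- exact: denom_ratioP.
- by apply/prodf_neq0 => j _; exact: denom_ratioP.
- rewrite (bigD1 i) //= -mulrA; congr (_ * _); exact: mulrC.
Qed.

Lemma fracv_exists (Q : vfield R n) : exists P D, D != 0 /\ Q = fracv P D.
Proof.
by have [D DQ] := common_denom_exists Q; have [P eP] := common_denom_fracv DQ; exists P, D; split => //; case: DQ.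
Qed.

(** Primes shared by the denominator and all numerators are removed until none remains; then
    [prod_divides_cancel] applies. This divisibility is what turns symmetries of the field into
    semi-invariance of its denominator. *)
Lemma divisor_denom_exists (Q : vfield R n) :
  exists D, common_denom Q D /\ forall E, common_denom Q E -> divides D E.
Proof.
have [D0 D0Q] := common_denom_exists Q.
have [s [u [uu sP eD]]] := factorial_mpoly (proj1 D0Q).
have [m] := ubnP (size s); elim: m s D0 D0Q eD sP => // m IH s D [D0 DQ] eD sP lm.
have /fin_all_exists[N eN] := DQ.
have [[p [ps pN]]|no] := pselect (exists p, p \in s /\ forall i, divides p (N i)).
  have [p0 _ _] := sP _ ps.
  have eD' : D = p * (u * \prod_(j <- rem p s) j).
    by rewrite eD (perm_big _ (perm_to_rem ps)) big_cons /= mulrCA.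
  have D'0 : u * \prod_(j <- rem p s) j != 0.
    by apply: contraNneq D0 => z; rewrite eD' z mulr0.
  apply: (IH (rem p s) (u * \prod_(j <- rem p s) j)) => //.
  - split=> // i; have [N' eN'] := pN i; exists N'; rewrite eN; apply/eq_frac => //.
    by rewrite eN' eD'; ring.
  - by move=> x /mem_rem; exact: sP.
  - by rewrite size_rem //; move: lm; case: (s) ps => // ? ?; rewrite ltnS.
exists D; split=> // E [E0 /fin_all_exists[K eK]].
have : divides (\prod_(p <- s) p) E.
  apply: (@prod_divides_cancel _ s _ N) => [p ps|i]; last first.
    have /eq_frac e : toratfun (N i) / toratfun D = toratfun (K i) / toratfun E by rewrite -eN -eK.
    exists (u * K i); rewrite mulrC e // eD; ring.
  split; first exact: sP.
  apply: contrapT => h; apply: no; exists p; split=> // i.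
  by apply: contrapT => h'; apply: h; exists i.
case: uu => v ev [c ->]; exists (v * c); rewrite eD mulrACA -ev; ring.
Qed.

End RationalFields.

(** * Minimal covariant pairs *)

Section MinimalPairs.
Variables (R : realType) (n : nat).
Implicit Types (p q D E : mpoly n R) (L : 'M[R]_n) (P : 'I_n -> mpoly n R).

Definition semi L (c : R) p := poly_comp L p = mpolyC n c * p.

Definition covv L (c : R) P := forall i, poly_comp L (P i) = mpolyC n c * mulv L P i.

(** Numerator and denominator share the sign [chi t], which makes the quotient invariant. Indexing
    by a bare type lets the notion serve groups as well as conjugated and reindexed families. *)
Definition cov_pair (T : Type) (M : T -> 'M[R]_n) d P D := [/\ D != 0,
  exists i, P i != 0, homogen d D, forall i, homogen (d + 2)%N (P i) &
  exists2 chi : T -> R, forall t, chi t ^+ 2 = 1 &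
    forall t, semi (M t) (chi t) D /\ covv (M t) (chi t) P].

(** Proportionality of the two fields is written with cleared denominators, so that competitors are
    compared inside the polynomial ring. *)
Definition min_pair (T : Type) (M : T -> 'M[R]_n) d P D := cov_pair M d P D /\
  forall d' P' D', cov_pair M d' P' D' -> (d' <= d)%N ->
    d' = d /\ exists2 c : R, c != 0 & forall i, D * P' i = mpolyC n c * D' * P i.

Definition superfield (gT : finGroupType) (G : {group gT})
    (rG : mx_representation R G n) (Q : vfield R n) : Prop :=
  [/\ Q != 0, vf_homog 2 Q, invariant_vfield rG Q
    & forall Q' : vfield R n, vf_homog 2 Q' -> invariant_vfield rG Q' ->
          (exists c : R, Q' = constfun n c *: Q) \/ higher_denom Q' Q].

(** The subgroup type turns a representation, constrained only on [G], into a family over a whole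
    type. *)
Definition rep_family (gT : finGroupType) (G : {group gT})
  (rG : mx_representation R G n) (t : subg_of G) : 'M[R]_n := rG (sgval t).

Lemma fracv_eq0 P D : D != 0 -> (fracv P D == 0) = [forall i, P i == 0].
Proof.
move=> D0; apply/eqP/forallP => [/matrixP e i|e].
  by move: (e i 0); rewrite !mxE => /eqP; rewrite mulf_eq0 invr_eq0 !toratfun_eq0 (negPf D0) orbF.
by apply/matrixP => i j; rewrite !mxE (eqP (e i)) rmorph0 mul0r.
Qed.

Lemma fracv_neq0 P D : D != 0 -> fracv P D != 0 <-> exists i, P i != 0.
Proof. by move=> D0; rewrite fracv_eq0 // negb_forall; split=> [/existsP|h]; last apply/existsP. Qed.

Lemma divisor_least (Q : vfield R n) D : common_denom Q D ->
  (forall E, common_denom Q E -> divides D E) -> least_common_denom Q D.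
Proof.
move=> DQ h; split=> // E EQ; have [c eE] := h _ EQ.
have [E0 _] := EQ; have [D0 _] := DQ.
have c0 : c != 0 by apply: contraNneq E0 => z; rewrite eE z mulr0.
rewrite eE msizeM //.
have : (0 < mmeasure mdeg c)%N by rewrite lt0n mmeasure_poly_eq0.
by move: (mmeasure _ c) (mmeasure _ D) => a b; lia.
Qed.

(* A denominator of least degree is unique up to a constant, so symmetries of Q scale it. *)
Lemma denom_eigen L (c : R) P D : L \in unitmx -> c != 0 -> D != 0 ->
  (forall E, common_denom (fracv P D) E -> divides D E) ->
  mmeasure mdeg (poly_comp L D) = mmeasure mdeg D ->
  lin_conj L (fracv P D) = constfun n c *: fracv P D ->
  exists2 a : R, a != 0 & semi L a D /\ forall i, poly_comp L (P i) = mpolyC n (a * c) * mulv L P i.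
Proof.
move=> uL c0 D0 hD sz; rewrite lin_conj_fracv // constfunZ_fracv => e.
have LD0 : poly_comp L D != 0 by rewrite poly_comp_eq0.
have [a ea] : exists a : R, poly_comp L D = mpolyC n a * D.
  apply: homogen_msize => //; apply: hD; split=> // i.
  exists (mpolyC n c^-1 * mulv (invmx L) (fun i => poly_comp L (P i)) i).
  move/(eq_fracv _ _ LD0 D0)/(_ i): e => e.
  rewrite mxE; apply/eq_frac => //; rewrite -mulrA e !mulrA -mpolyCM mulVf // mpolyC1 mul1r.
  by [].
have a0 : a != 0 by apply: contraNneq LD0 => z; rewrite ea z mpolyC0 mul0r.
exists a => //; split=> // i.
have {}e j : mulv (invmx L) (fun i => poly_comp L (P i)) j = mpolyC n (a * c) * P j.
  move/(eq_fracv _ _ LD0 D0)/(_ j): e; rewrite ea => e; apply: (mulIf D0); rewrite e.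
  rewrite mpolyCM; ring.
rewrite -mulvZ -(mulv_ext _ _ e) mulv_mul mulmxV // mulv1.
by [].
Qed.

Lemma fracv_homogen d P D : D != 0 -> homogen d D ->
  (forall i, homogen (d + 2)%N (P i)) -> vf_homog 2 (fracv P D).
Proof. by move=> D0 hD hP i; exists d, (P i), D; rewrite mxE. Qed.

Lemma two_unit : (2%:M : 'M[R]_n) \in unitmx.
Proof. by rewrite unitmxE det_scalar unitfE expf_neq0 // pnatr_eq0. Qed.

Lemma mulv_scalar (a : R) P i : mulv a%:M P i = mpolyC n a * P i.
Proof.
rewrite /mulv (bigD1 i) //= mxE eqxx big1 ?addr0 // => j ji.
by rewrite mxE eq_sym (negPf ji) mpolyC0 mul0r.
Qed.

(** Degree 2 appears as the conjugation eigenvalue [2^2 / 2 = 2], the form in which [denom_eigen]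
    accepts homogeneity. *)
Lemma vf_homog_scaling (Q : vfield R n) : vf_homog 2 Q ->
  lin_conj 2%:M Q = constfun n 2 *: Q.
Proof.
move=> hQ; apply/matrixP => i j; rewrite !mxE (bigD1 i) //= big1 ?addr0; last first.
  move=> k ki; rewrite invmx_scalar !mxE eq_sym (negPf ki) mulr0n.
  by rewrite /constfun mpolyC0 rmorph0 mul0r.
rewrite invmx_scalar !mxE eqxx mulr1n ord1; have [k [N [D [D0 hN hD ->]]]] := hQ i.
rewrite (ratfun_comp_frac _ two_unit D0) !mulrA -!rmorphM /=.
move/homogenP: hN => ->; move/homogenP: hD => ->.
have c0 : mpolyC n (2 ^+ k : R) != 0 by rewrite mpolyC_eq0 expf_neq0 // pnatr_eq0.
apply/eq_frac; rewrite ?mulf_neq0 // !mulrA -mpolyCM exprD.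
have -> : 2^-1 * (2 ^+ k * 2 ^+ 2) = 2 * 2 ^+ k :> R.
  by field.
rewrite mpolyCM; ring.
Qed.

Lemma msize_scaling (a : R) D : a != 0 ->
  mmeasure mdeg (poly_comp a%:M D) = mmeasure mdeg D.
Proof.
move=> a0; have nz m : (m \in msupp (poly_comp a%:M D)) = (m \in msupp D).
  rewrite !mcoeff_msupp mcoeff_poly_comp_scalar mulf_eq0 expf_eq0 (negPf a0) andbF.
  by [].
apply/eqP; rewrite eqn_leq !msizeE; apply/andP; split; apply/bigmax_leqP_seq => m mp _.
  by rewrite -msizeE; apply: msize_mdeg_lt; rewrite -nz.
by rewrite -msizeE; apply: msize_mdeg_lt; rewrite nz.
Qed.

Lemma semi_mul A B (a b : R) p : semi A a p -> semi B b p -> semi (A *m B) (a * b) p.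
Proof.
move=> sA sB; rewrite /semi -poly_comp_comp sA rmorphM /= poly_compC sB.
by rewrite mulrA mpolyCM.
Qed.

Lemma unity_root_sqr (b : R) m : (0 < m)%N -> b ^+ m = 1 -> b ^+ 2 = 1.
Proof.
move=> m0 e; rewrite -(real_normK (num_real b)).
have : `|b| ^+ m = 1 by rewrite -normrX e normr1.
by move/eqP; rewrite pexpr_eq1 // => /eqP->; rewrite expr1n.
Qed.

(** A matrix of finite order scales [D] by a root of unity, and the real ones are 1 and -1. *)
Lemma rep_semi_sqr (gT : finGroupType) (G : {group gT}) (rG : mx_representation R G n)
  g (b : R) D : g \in G -> D != 0 -> semi (rG g) b D -> b ^+ 2 = 1.
Proof.
move=> Gg D0 sb; have pw k : semi (rG (g ^+ k)%g) (b ^+ k) D.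
  elim: k => [|k IH]; first by rewrite expg0 repr_mx1 /semi poly_comp1 expr0 mpolyC1 mul1r.
  by rewrite expgS exprS repr_mxM ?groupX //; exact: semi_mul.
apply: (@unity_root_sqr _ #[g]%g); first exact: order_gt0.
have := pw #[g]%g; rewrite expg_order repr_mx1 /semi poly_comp1 -{1}[D]mul1r => /(mulIf D0)/esym/eqP.
by rewrite -mpolyC1 mpolyC_eq => /eqP.
Qed.

Lemma cov_lin_conj L (c : R) P D : L \in unitmx -> D != 0 -> semi L c D -> covv L c P ->
  lin_conj L (fracv P D) = fracv P D.
Proof.
move=> uL D0 sD cP; rewrite lin_conj_fracv //.
apply/eq_fracv; rewrite ?poly_comp_eq0 // => i.
rewrite (mulv_ext _ _ cP) mulvZ mulv_mul mulVmx // mulv1 sD; ring.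
Qed.

(** The reduced denominator is an eigenvector of the dilatation and of every group element, so the
    reduced pair is homogeneous and covariant. Minimality is the superflow condition restricted to
    competitors of degree at most [d]. *)
Lemma superfield_min_pair (gT : finGroupType) (G : {group gT})
  (rG : mx_representation R G n) (Q : vfield R n) : superfield rG Q ->
  exists d P D, Q = fracv P D /\ min_pair (rep_family rG) d P D.
Proof.
move=> [Q0 hQ iQ mQ]; have [D [DQ hD]] := divisor_denom_exists Q.
have [P eQ] := common_denom_fracv DQ; have [D0 _] := DQ.
subst Q.
have two0 : (2 : R) != 0 by rewrite pnatr_eq0.
(* The hypothesis gives homogeneous denominators component by component; treating the dilatation as
   a symmetry with factor 2 transfers homogeneity to the reduced common denominator. *)
have [a a0 [sD cP]] := denom_eigen two_unit two0 D0 hD (msize_scaling D two0) (vf_homog_scaling hQ).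
have [d dD] := homogen_eigen D0 sD.
have ea : a = 2 ^+ d.
  have /homogenP e := dD; move: sD; rewrite /semi e => /(mulIf D0)/eqP.
  by rewrite mpolyC_eq => /eqP.
have dP i : homogen (d + 2)%N (P i).
  apply/homogenP; rewrite cP mulv_scalar ea mulrA -mpolyCM exprD -mulrA.
  by congr (mpolyC n (_ * _) * _); rewrite expr2.
exists d, P, D; split=> //; split.
- split=> //; first exact: (proj1 (fracv_neq0 P D0) Q0).
  have : forall t : subg_of G, exists a : R, a ^+ 2 = 1 /\ (semi (rep_family rG t) a D /\ covv (rep_family rG t) a P).
    move=> t; have ug : rep_family rG t \in unitmx by apply: repr_mx_unit; exact: subgP.
    have sz : mmeasure mdeg (poly_comp (rep_family rG t) D) = mmeasure mdeg D.
      by rewrite !(@msize_homogen _ _ d) ?poly_comp_eq0 //; exact: homogen_poly_comp.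
    have inv : lin_conj (rep_family rG t) (fracv P D) = constfun n 1 *: fracv P D.
      by rewrite /constfun mpolyC1 rmorph1 scale1r; apply: iQ; exact: subgP.
    have [b b0 [sb cb]] := denom_eigen ug (oner_neq0 R) D0 hD sz inv.
    exists b; split; last by split=> // i; rewrite cb mulr1.
    exact: rep_semi_sqr (subgP t) D0 sb.
  by move=> /choice[chi h]; exists chi => t; case: (h t).
- move=> d' P' D' [D'0 P'0 dD' dP' [chi _ h]] le.
  have [||[c ec]|hi] := mQ (fracv P' D').
  + exact: fracv_homogen dP'.
  + move=> g Gg; have [sg cg] := h (subg G g).
    rewrite /rep_family ?subgK // in sg cg; apply: cov_lin_conj cg => //.
    exact: repr_mx_unit.
  + have c0 : c != 0.
      have := proj2 (fracv_neq0 P' D'0) P'0; rewrite ec; apply: contraNneq => ->.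
      by rewrite /constfun mpolyC0 rmorph0 scale0r.
    rewrite constfunZ_fracv in ec; move/(eq_fracv _ _ D'0 D0): ec => ec.
    split; last by exists c => // i; rewrite mulrC ec; ring.
    apply/eqP; rewrite eqn_leq le /= -ltnS -(msize_homogen D'0 dD') -(msize_homogen D0 dD).
    apply: (divisor_least DQ hD).2; split=> // i.
    exists (mpolyC n c^-1 * P' i); rewrite mxE; apply/eq_frac => //.
    by rewrite -mulrA ec !mulrA -mpolyCM mulVf // mpolyC1 mul1r.
  (* Here the competitor would need a denominator of degree above [d], but its least one is no
     larger than [D'], of degree at most [d]. *)
  + have [D1 [D1Q hD1]] := divisor_denom_exists (fracv P' D').
    have lt := hi _ _ (divisor_least D1Q hD1) (divisor_least DQ hD).
    have := (divisor_least D1Q hD1).2 _ (fracv_common_denom P' D'0).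
    rewrite (msize_homogen D'0 dD') => le'; move: lt; rewrite (msize_homogen D0 dD) => lt.
    by have := leq_trans lt le'; rewrite ltnS ltnNge le.
Qed.

End MinimalPairs.

(** * Transport of minimal pairs by linear maps *)

Section Conjugation.
Variables (R : realType) (n : nat).
Implicit Types (p q D E : mpoly n R) (L B : 'M[R]_n) (P : 'I_n -> mpoly n R).

Lemma mulvZp L p P i : mulv L (fun j => p * P j) i = p * mulv L P i.
Proof. by rewrite /mulv mulr_sumr; apply: eq_bigr => j _; rewrite mulrCA. Qed.

Lemma mulv_eq0 L P : L \in unitmx -> mulv L P =1 (fun=> 0) -> P =1 (fun=> 0).
Proof.
move=> uL h i; rewrite -[LHS]mulv1 -(mulVmx uL) -mulv_mul (mulv_ext _ _ h).
by rewrite /mulv big1 // => j _; rewrite mulr0.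
Qed.

Lemma homogen_mulv L d P i : (forall j, homogen d (P j)) -> homogen d (mulv L P i).
Proof. by move=> h; apply: rpred_sum => j _; exact: homogen_mulC. Qed.

(** The push-forward [x |-> B P (B^-1 x)], numerator of the conjugation by [invmx B]. *)
Definition pushv B P i := mulv B (fun j => poly_comp (invmx B) (P j)) i.

Lemma semi_conj B L (c : R) p : B \in unitmx -> semi L c p ->
  semi (B *m L *m invmx B) c (poly_comp (invmx B) p).
Proof.
move=> uB s; rewrite /semi poly_comp_comp !mulmxA mulVmx // mul1mx -poly_comp_comp s.
by rewrite rmorphM /= poly_compC.
Qed.

Lemma covv_conj B L (c : R) P : B \in unitmx -> covv L c P ->
  covv (B *m L *m invmx B) c (pushv B P).
Proof.
move=> uB s i; rewrite /pushv poly_comp_mulv.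
have e j : poly_comp (B *m L *m invmx B) (poly_comp (invmx B) (P j)) =
    mpolyC n c * mulv L (fun k => poly_comp (invmx B) (P k)) j.
  rewrite poly_comp_comp !mulmxA mulVmx // mul1mx -poly_comp_comp s.
  by rewrite rmorphM /= poly_compC poly_comp_mulv.
rewrite (mulv_ext _ _ e) mulvZ; congr (_ * _); rewrite !mulv_mul.
by rewrite -!mulmxA mulVmx // mulmx1.
Qed.

Lemma cov_pair_conj (T : Type) (M : T -> 'M[R]_n) d P D B : B \in unitmx ->
  cov_pair M d P D ->
  cov_pair (fun t => B *m M t *m invmx B) d (pushv B P) (poly_comp (invmx B) D).
Proof.
move=> uB [D0 [i0 P0] hD hP [chi h1 h2]]; split.
- by rewrite poly_comp_eq0 ?unitmx_inv.
- apply: contrapT => no; move/eqP: P0; apply.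
  have z : pushv B P =1 (fun=> 0).
    by move=> i; apply: contrapT => h; apply: no; exists i; apply/eqP.
  have := mulv_eq0 uB z i0; move/eqP; rewrite poly_comp_eq0 ?unitmx_inv //.
  by move/eqP.
- exact: homogen_poly_comp.
- by move=> i; apply: homogen_mulv => j; exact: homogen_poly_comp.
- exists chi => // t; case: (h2 t) => s c; split; [exact: semi_conj|exact: covv_conj].
Qed.

Lemma eq_cov_pair (T : Type) (M M' : T -> 'M[R]_n) d P D : M =1 M' ->
  cov_pair M d P D -> cov_pair M' d P D.
Proof.
by move=> e [D0 P0 hD hP [chi h1 h2]]; split=> //; exists chi => // t; rewrite -e.
Qed.

Lemma min_pair_conj (T : Type) (M : T -> 'M[R]_n) d P D B : B \in unitmx ->
  min_pair M d P D ->
  min_pair (fun t => B *m M t *m invmx B) d (pushv B P) (poly_comp (invmx B) D).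
Proof.
move=> uB [cp mp]; split; first exact: cov_pair_conj.
move=> d' P' D' cp' le.
have uB' : invmx B \in unitmx by rewrite unitmx_inv.
have /mp : cov_pair M d' (pushv (invmx B) P') (poly_comp B D').
  have := cov_pair_conj uB' cp'; rewrite invmxK; apply: eq_cov_pair => t.
  by rewrite -!mulmxA mulVmx // mulmx1 mulmxA mulVmx // mul1mx.
case/(_ le) => -> [c c0 h]; split=> //; exists c => // i.
have e j : poly_comp (invmx B) D * poly_comp (invmx B) (pushv (invmx B) P' j) =
   mpolyC n c * D' * poly_comp (invmx B) (P j).
  by rewrite -rmorphM h !rmorphM /= poly_compC poly_compK.
transitivity (mulv B (fun j => poly_comp (invmx B) D * poly_comp (invmx B) (pushv (invmx B) P' j)) i).
  rewrite mulvZp; congr (_ * _); rewrite /pushv invmxK.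
  under mulv_ext => j.
    rewrite poly_comp_mulv.
    rewrite (@mulv_ext _ _ _ _ P'); last by move=> k; rewrite poly_compK.
    over.
  by rewrite mulv_mul mulmxV // mulv1.
by rewrite (mulv_ext _ _ e) mulvZp.
Qed.

Lemma fracv_push B P D : B \in unitmx -> D != 0 ->
  fracv (pushv B P) (poly_comp (invmx B) D) = lin_conj (invmx B) (fracv P D).
Proof. by move=> uB D0; rewrite lin_conj_fracv ?unitmx_inv // invmxK. Qed.

Lemma lin_conj_comp L B P D : L \in unitmx -> B \in unitmx -> D != 0 ->
  lin_conj L (lin_conj B (fracv P D)) = lin_conj (B *m L) (fracv P D).
Proof.
move=> uL uB D0; have uBL : B *m L \in unitmx by rewrite unitmx_mul uB.
have BD0 : poly_comp B D != 0 by rewrite poly_comp_eq0.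
have eV : invmx L *m invmx B = invmx (B *m L).
  rewrite -[LHS]mulmx1 -(mulmxV uBL) mulmxA -[_ *m _ *m (B *m L)]mulmxA.
  by rewrite (mulmxA _ B) mulVmx // mul1mx mulVmx // mul1mx.
rewrite (lin_conj_fracv _ uB D0) (lin_conj_fracv _ uL BD0) (lin_conj_fracv _ uBL D0).
rewrite poly_comp_comp; set F := mulv _ _; set F' := mulv _ _.
suff -> : F = F' by [].
apply: funext => i; rewrite /F /F' -eV -mulv_mul.
apply: mulv_ext => j; rewrite poly_comp_mulv.
by apply: mulv_ext => k; rewrite poly_comp_comp.
Qed.

Lemma lin_conj_mul L B (Q : vfield R n) : L \in unitmx -> B \in unitmx ->
  lin_conj L (lin_conj B Q) = lin_conj (B *m L) Q.
Proof.
by move=> uL uB; have [P [D [D0 ->]]] := fracv_exists Q; exact: lin_conj_comp.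
Qed.

Lemma lin_conj1 (Q : vfield R n) : lin_conj 1%:M Q = Q.
Proof.
have [P [D [D0 ->]]] := fracv_exists Q.
rewrite lin_conj_fracv ?unitmx1 // poly_comp1 invmx1.
set F := mulv _ _; suff -> : F = P by [].
by apply: funext => i; rewrite /F mulv1 poly_comp1.
Qed.

End Conjugation.

(** Cholesky factorisation by induction on the dimension: the Schur complement of the first diagonal
    entry is again positive definite. *)
Lemma pos_def_factor (R : realType) n (S : 'M[R]_n) : S^T = S ->
  (forall x : 'cV[R]_n, x != 0 -> 0 < (x^T *m S *m x) 0 0) -> exists B : 'M[R]_n, S = B^T *m B.
Proof.
elim: n S => [|n IH] S sS pS; first by exists 0; apply/matrixP => -[].
pose S1 : 'M[R]_(1 + n) := S; pose r := ursubmx S1; pose T := drsubmx S1.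
have [a ea] : exists a, ulsubmx S1 = a%:M by exists (ulsubmx S1 0 0); rewrite {1}[ulsubmx S1]mx11_scalar.
have eS : S1 = block_mx a%:M r r^T T.
  by rewrite -[LHS]submxK -ea; congr block_mx; rewrite /r trmx_ursub; congr dlsubmx; exact/esym/sS.
have sT : T^T = T by rewrite /T trmx_drsub; congr drsubmx; exact: sS.
have form (u : 'cV[R]_1) (y : 'cV[R]_n) : (col_mx u y)^T *m S1 *m col_mx u y =
    (u^T *m a%:M + y^T *m r^T) *m u + (u^T *m r + y^T *m T) *m y.
  by rewrite eS tr_col_mx mul_row_block mul_row_col.
have a0 : 0 < a.
  have := pS (col_mx (1%:M : 'cV[R]_1) (0 : 'cV[R]_n)) _; rewrite -/S1 (form 1%:M 0).
  rewrite trmx0 !mul0mx mulmx0 !addr0 trmx1 mul1mx mulmx1 mxE eqxx mulr1n; apply.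
  apply/eqP => /(congr1 (fun A : 'cV[R]_(1 + n) => A (lshift n 0) 0)).
  by rewrite col_mxEu !mxE => /eqP; rewrite oner_eq0.
pose s := Num.sqrt a; have s2 : s * s = a by rewrite -expr2 sqr_sqrtr // ltW.
have s0 : s != 0 by rewrite gt_eqF // sqrtr_gt0.
have [||B' eB] := IH (T - a^-1 *: (r^T *m r)).
- by rewrite linearB linearZ /= trmx_mul trmxK sT.
(* For fixed [y] the first coordinate [- a^-1 r y] minimises the form, and the minimum is the Schur
   complement at [y]. *)
- move=> y y0; have := pS (col_mx (- (a^-1 *: (r *m y)) : 'cV[R]_1) y) _; rewrite -/S1 form.
  have -> : (- (a^-1 *: (r *m y)))^T = - (a^-1 *: (y^T *m r^T)).
    by rewrite -trmx_mul; apply/matrixP => i j; rewrite !mxE.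
  have -> : - (a^-1 *: (y^T *m r^T)) *m a%:M + y^T *m r^T = 0.
    by rewrite mulNmx -scalemxAl mul_mx_scalar scalerA mulVf ?gt_eqF // scale1r addNr.
  have -> : - (a^-1 *: (y^T *m r^T)) *m r + y^T *m T = y^T *m (T - a^-1 *: (r^T *m r)).
    by rewrite mulmxBr -scalemxAr mulmxA mulNmx -scalemxAl addrC.
  rewrite mul0mx add0r; apply.
  apply/eqP => /(congr1 (fun A : 'cV[R]_(1 + n) => dsubmx A)); rewrite col_mxKd => z.
  by move/eqP: y0; apply; rewrite z; apply/matrixP => i j; rewrite !mxE.
pose C : 'M[R]_(1 + n) := block_mx s%:M (s^-1 *: r) 0 B'.
suff : S1 = C^T *m C by move=> h; exists C; exact: h.
rewrite eS /C tr_block_mx mulmx_block !trmx0 !mul0mx !mulmx0 ?addr0.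
rewrite tr_scalar_mx -scalar_mxM s2 -eB; congr block_mx.
- by rewrite mul_scalar_mx scalerA divff // scale1r.
- by rewrite mul_mx_scalar linearZ /= scalerA divff // scale1r.
- have -> : (s^-1 *: r)^T = s^-1 *: r^T by apply/matrixP => i j; rewrite !mxE.
  by rewrite -scalemxAl -scalemxAr scalerA -invfM s2 addrC subrK.
Qed.

(** Averaging [g^T g] over the group gives an invariant positive definite form; once it is written
    [B^T B], conjugation by [B] turns it into the standard one. *)
Lemma orthogonalizable (R : realType) n (gT : finGroupType) (G : {group gT})
  (rG : mx_representation R G n) : exists2 B : 'M[R]_n, B \in unitmx &
    forall t, let O := B *m rep_family rG t *m invmx B in O^T *m O = 1%:M.
Proof.
pose S := \sum_(g in G) (rG g)^T *m rG g.
have sum_sq k (y : 'cV[R]_k) : (y^T *m y) 0 0 = \sum_i y i 0 ^+ 2.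
  by rewrite mxE; apply: eq_bigr => i _; rewrite !mxE.
have sq_gt0 k (y : 'cV[R]_k) : y != 0 -> 0 < (y^T *m y) 0 0.
  move=> y0; rewrite sum_sq lt_def sumr_ge0 ?andbT => [|i _]; last exact: sqr_ge0.
  apply: contraNneq y0 => /eqP; rewrite psumr_eq0 => [/allP h|i _]; last exact: sqr_ge0.
  apply/eqP/matrixP => i j; rewrite ord1 mxE; apply/eqP.
  by have := h i (mem_index_enum i); rewrite sqrf_eq0.
have sS : S^T = S.
  by rewrite /S linear_sum /=; apply: eq_bigr => g _; rewrite trmx_mul trmxK.
have pS (x : 'cV[R]_n) : x != 0 -> 0 < (x^T *m S *m x) 0 0.
  move=> x0; rewrite /S mulmx_sumr mulmx_suml summxE.
  rewrite (bigD1 1%g) //= ltr_wpDr //.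
    apply: sumr_ge0 => g _; rewrite mulmxA -trmx_mul -mulmxA sum_sq.
    by apply: sumr_ge0 => i _; exact: sqr_ge0.
  by rewrite repr_mx1 trmx1 mulmx1 mulmx1; exact: sq_gt0.
have [B eB] := pos_def_factor sS pS.
have uB : B \in unitmx.
  rewrite -unitmx_tr -row_free_unit -kermx_eq0; apply/negPn/negP => /rowV0Pn[v].
  rewrite sub_kermx => /eqP vB v0.
  have := pS v^T; rewrite trmx_eq0 => /(_ v0).
  by rewrite eB trmxK !mulmxA vB !mul0mx mxE ltxx.
exists B => // t O; have Gt : sgval t \in G := subgP t.
have SM : (rep_family rG t)^T *m S *m rep_family rG t = S.
  rewrite /S mulmx_sumr mulmx_suml [RHS](reindex_inj (mulIg (sgval t))) /=.
  rewrite [RHS](eq_bigl (mem G)) => [|g]; last by rewrite groupMr.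
  by apply: eq_bigr => g Gg; rewrite repr_mxM // trmx_mul /rep_family !mulmxA.
rewrite /O !trmx_mul trmx_inv; move: SM; rewrite eB => SM.
rewrite !mulmxA -(mulmxA _ B^T B) -(mulmxA (invmx B^T)) -(mulmxA (invmx B^T)) SM.
by rewrite mulmxA mulVmx ?unitmx_tr // mul1mx mulmxV.
Qed.

(** * Differential covariants of orthogonal maps *)

Section Covariants.
Variables (R : realType) (n : nat).
Implicit Types (p q f : mpoly n R) (L : 'M[R]_n) (P V W : 'I_n -> mpoly n R) (a b c : R).

Definition grad p (i : 'I_n) := mderiv i p.
Definition dotv P V := \sum_i P i * V i.
Definition divv P := \sum_i mderiv i (P i).
Definition pos (i : 'I_n) : mpoly n R := var R i.
Definition dirv V P i := \sum_j V j * mderiv j (P i).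
Definition constv (v : 'cV[R]_n) (i : 'I_n) : mpoly n R := mpolyC n (v i 0).

Definition orthogonal L := L^T *m L = 1%:M.

Lemma orthogonalC L : orthogonal L -> L *m L^T = 1%:M.
Proof. exact: mulmx1C. Qed.

Lemma orthogonal_unit L : orthogonal L -> L \in unitmx.
Proof. by case/mulmx1_unit. Qed.

Lemma orthogonal_inv L : orthogonal L -> invmx L = L^T.
Proof.
move=> oL; rewrite -[LHS]mul1mx -oL -mulmxA mulmxV ?mulmx1 //.
exact: orthogonal_unit.
Qed.

Lemma orthogonal_rows L j i : orthogonal L -> \sum_k L j k * L i k = (j == i)%:R.
Proof.
by move=> /orthogonalC/matrixP/(_ j i); rewrite !mxE => <-; apply: eq_bigr => k _; rewrite mxE.
Qed.

Lemma orthogonal_cols L j i : orthogonal L -> \sum_k L k j * L k i = (j == i)%:R.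
Proof. by move=> /matrixP/(_ j i); rewrite !mxE => <-; apply: eq_bigr => k _; rewrite mxE. Qed.

Lemma mderiv_orthogonal L p j : orthogonal L ->
  poly_comp L (mderiv j p) = \sum_k mpolyC n (L j k) * mderiv k (poly_comp L p).
Proof.
move=> oL; under eq_bigr => k _ do rewrite mderiv_poly_comp mulr_sumr.
rewrite exchange_big /= (bigD1 j) //= [X in _ = _ + X]big1 ?addr0 => [|i ij].
  under eq_bigr => k _ do rewrite mulrA -mpolyCM.
  rewrite -mulr_suml -rmorph_sum /=.
  by rewrite orthogonal_rows // eqxx mpolyC1 mul1r.
under eq_bigr => k _ do rewrite mulrA -mpolyCM.
rewrite -mulr_suml -rmorph_sum /=.
by rewrite orthogonal_rows // (eq_sym j) (negPf ij) mpolyC0 mul0r.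
Qed.

(** A gradient transforms by the inverse transpose, which for an orthogonal [L] is [L] itself; this
    is why the group is made orthogonal first. *)
Lemma semi_grad L c p : orthogonal L -> semi L c p -> covv L c (grad p).
Proof.
move=> oL s i; rewrite /grad mderiv_orthogonal // s /mulv mulr_sumr.
by apply: eq_bigr => k _; rewrite mderiv_mulC mulrCA.
Qed.

Lemma mulv_dot L P V : orthogonal L -> dotv (mulv L P) (mulv L V) = dotv P V.
Proof.
move=> oL; rewrite /dotv /mulv.
under eq_bigr => i _.
  rewrite mulr_suml; under eq_bigr => j _ do rewrite mulr_sumr.
  over.
rewrite exchange_big /=; apply: eq_bigr => j _.
rewrite exchange_big /= (bigD1 j) //= [X in _ + X = _]big1 ?addr0 => [|k kj].
  under eq_bigr => i _ do rewrite mulrACA -mpolyCM.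
  rewrite -mulr_suml -rmorph_sum /=.
  by rewrite orthogonal_cols // eqxx mpolyC1 mul1r.
under eq_bigr => i _ do rewrite mulrACA -mpolyCM.
rewrite -mulr_suml -rmorph_sum /=.
by rewrite orthogonal_cols // (eq_sym j) (negPf kj) mpolyC0 mul0r.
Qed.

Lemma cov_dot L a b P V : orthogonal L -> covv L a P -> covv L b V ->
  semi L (a * b) (dotv P V).
Proof.
move=> oL cP cV; rewrite /semi -[in RHS](mulv_dot P V oL) /dotv rmorph_sum mulr_sumr.
by apply: eq_bigr => i _; rewrite rmorphM /= cP cV mpolyCM mulrACA.
Qed.

Lemma cov_pos L : covv L 1 pos.
Proof. by move=> i; rewrite /pos poly_compX mpolyC1 mul1r. Qed.

Lemma semi_mulp L a b p q : semi L a p -> semi L b q -> semi L (a * b) (p * q).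
Proof. by move=> sp sq; rewrite /semi rmorphM /= sp sq mpolyCM mulrACA. Qed.

Lemma semi_expp L a p k : semi L a p -> semi L (a ^+ k) (p ^+ k).
Proof.
move=> sp; elim: k => [|k IH]; first by rewrite /semi rmorph1 mpolyC1 mul1r.
by rewrite !exprS; exact: semi_mulp.
Qed.

Lemma semi_const L c : semi L 1 (mpolyC n c).
Proof. by rewrite /semi poly_compC mpolyC1 mul1r. Qed.

Lemma cov_scale L a b p P : semi L a p -> covv L b P -> covv L (a * b) (fun i => p * P i).
Proof.
move=> sp cP i; rewrite rmorphM /= sp cP mulvZp mpolyCM; exact: mulrACA.
Qed.

Lemma cov_sub L a P V : covv L a P -> covv L a V -> covv L a (fun i => P i - V i).
Proof.
move=> cP cV i; rewrite rmorphB /= cP cV -mulrBr; congr (_ * _).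
by rewrite /mulv -sumrB; apply: eq_bigr => j _; rewrite mulrBr.
Qed.

Lemma cov_add L a P V : covv L a P -> covv L a V -> covv L a (fun i => P i + V i).
Proof.
move=> cP cV i; rewrite rmorphD /= cP cV -mulrDr; congr (_ * _).
by rewrite /mulv -big_split; apply: eq_bigr => j _; rewrite /= mulrDr.
Qed.

Lemma cov_const L c (v : 'cV[R]_n) : L *m v = c *: v -> c ^+ 2 = 1 -> covv L c (constv v).
Proof.
move=> /matrixP e c2 i; rewrite /constv poly_compC /mulv.
under eq_bigr => j _ do rewrite -mpolyCM.
rewrite -rmorph_sum /= -mpolyCM; congr (mpolyC n _).
by move: (e i 0); rewrite !mxE => ->; rewrite mulrA -expr2 c2 mul1r.
Qed.

Lemma cov_dir L a b V P : orthogonal L -> covv L a V -> covv L b P ->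
  covv L (a * b) (dirv V P).
Proof.
move=> oL cV cP i; rewrite /dirv rmorph_sum /=.
transitivity (dotv (mulv L (fun j => mpolyC n a * V j)) (mulv L (fun k => mpolyC n b * mderiv k (mulv L P i)))).
  apply: eq_bigr => j _; rewrite rmorphM /= cV -mulvZ; congr (_ * _).
  rewrite mderiv_orthogonal // cP /mulv; apply: eq_bigr => k _.
  by rewrite mderiv_mulC.
rewrite mulv_dot // /dotv /mulv mulr_sumr.
under eq_bigr => j _ do rewrite raddf_sum /= !mulr_sumr.
rewrite exchange_big /=; apply: eq_bigr => k _.
rewrite !mulr_sumr; apply: eq_bigr => j _; rewrite mderiv_mulC mpolyCM; ring.
Qed.

Lemma cov_div L c P : orthogonal L -> covv L c P -> semi L c (divv P).
Proof.
move=> oL cP; rewrite /semi /divv rmorph_sum /=.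
under eq_bigr => i _ do rewrite mderiv_orthogonal // cP.
rewrite exchange_big mulr_sumr /=; apply: eq_bigr => k _.
under eq_bigr => i _ do rewrite mderiv_mulC /mulv raddf_sum /= !mulr_sumr.
rewrite exchange_big /= (bigD1 k) //= [X in _ + X = _]big1 ?addr0 => [|j jk].
  rewrite (eq_bigr (fun i => mpolyC n (L i k * L i k) * (mpolyC n c * mderiv k (P k)))).
    rewrite -mulr_suml -rmorph_sum /=.
    by rewrite orthogonal_cols // eqxx mpolyC1 mul1r.
  by move=> i _; rewrite mderiv_mulC mpolyCM; ring.
rewrite (eq_bigr (fun i => mpolyC n (L i k * L i j) * (mpolyC n c * mderiv k (P j)))).
  rewrite -mulr_suml -rmorph_sum /=.
  by rewrite orthogonal_cols // (eq_sym k) (negPf jk) mpolyC0 mul0r.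
by move=> i _; rewrite mderiv_mulC mpolyCM; ring.
Qed.

Lemma homogen_dot d e P V : (forall i, homogen d (P i)) -> (forall i, homogen e (V i)) ->
  homogen (d + e)%N (dotv P V).
Proof. by move=> hP hV; apply: rpred_sum => i _; apply: dhomogM. Qed.

Lemma homogen_div d P : (forall i, homogen d (P i)) -> homogen d.-1 (divv P).
Proof. by move=> h; apply: rpred_sum => i _; exact: homogen_mderiv. Qed.

Lemma homogen_pos i : homogen 1%N (pos i).
Proof. exact: homogen_var. Qed.

Lemma dotvC P V : dotv P V = dotv V P.
Proof. by apply: eq_bigr => i _; rewrite mulrC. Qed.

Lemma dotv_scale p P V : dotv (fun i => p * P i) V = p * dotv P V.
Proof. by rewrite /dotv mulr_sumr; apply: eq_bigr => i _; rewrite mulrA. Qed.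

Lemma divv_scale p P : divv (fun i => p * P i) = dotv (grad p) P + p * divv P.
Proof.
by rewrite /divv /dotv mulr_sumr -big_split; apply: eq_bigr => i _; rewrite /= mderivM.
Qed.

Lemma euler_grad d p : homogen d p -> dotv pos (grad p) = mpolyC n d%:R * p.
Proof. exact: euler_identity. Qed.

End Covariants.

(** * Comparing covariants with a minimal pair *)

Section MinimalPairTools.
Variables (R : realType) (n : nat) (T : Type) (M : T -> 'M[R]_n).
Variables (d : nat) (P : 'I_n -> mpoly n R) (D : mpoly n R) (chi : T -> R).

(** A minimal pair with its character made explicit, since the comparisons need covariants of a
    prescribed character. *)
Record minimal_with : Prop := MinimalWith {
  mw_denom0 : D != 0;
  mw_field0 : exists i, P i != 0;
  mw_denom_homog : homogen d D;
  mw_field_homog : forall i, homogen (d + 2)%N (P i);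
  mw_sqr : forall t, chi t ^+ 2 = 1;
  mw_denom : forall t, semi (M t) (chi t) D;
  mw_field : forall t, covv (M t) (chi t) P;
  mw_min : forall d' P' D', cov_pair M d' P' D' -> (d' <= d)%N ->
    d' = d /\ exists2 c : R, c != 0 & forall i, D * P' i = mpolyC n c * D' * P i
}.

Hypothesis mw : minimal_with.

(** The competitor is [P'] over the unchanged denominator [D]. *)
Lemma minimal_field P' : (forall i, homogen (d + 2)%N (P' i)) ->
  (forall t, covv (M t) (chi t) P') -> exists c : R, forall i, P' i = mpolyC n c * P i.
Proof.
move=> hP' cP'; have [[i Pi]|no] := pselect (exists i, P' i != 0); last first.
  exists 0 => i; rewrite mpolyC0 mul0r; apply: contrapT => h; apply: no.
  by exists i; apply/eqP.
have [|_ [c _ h]] := @mw_min mw d P' D _ (leqnn d).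
  split => //; [exact: mw_denom0|by exists i|exact: mw_denom_homog|].
  by exists chi => t; [exact: (mw_sqr mw)|split; [exact: (mw_denom mw)|exact: cP']].
exists c => j; apply: (mulfI (mw_denom0 mw)); rewrite h; ring.
Qed.

(** The competitor is the unchanged [P] over the denominator [D']. *)
Lemma minimal_denom D' : homogen d D' -> (forall t, semi (M t) (chi t) D') ->
  exists c : R, D' = mpolyC n c * D.
Proof.
move=> hD' sD'; have [->|D'0] := eqVneq D' 0; first by exists 0; rewrite mpolyC0 mul0r.
have [_ [c c0 h]] : d = d /\ exists2 c : R, c != 0 & forall i, D * P i = mpolyC n c * D' * P i.
  apply: (mw_min mw) => //; split => //; [exact: mw_field0|exact: mw_field_homog|].
  by exists chi => t; [exact: (mw_sqr mw)|split; [exact: sD'|exact: (mw_field mw)]].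
have [i Pi] := mw_field0 mw; exists c^-1.
by rewrite (mulIf Pi (h i)) mulrA -mpolyCM mulVf // mpolyC1 mul1r.
Qed.

Lemma minimal_other d' P' D' (psi : T -> R) : (d' <= d)%N -> D' != 0 ->
  (exists i, P' i != 0) -> homogen d' D' -> (forall i, homogen (d' + 2)%N (P' i)) ->
  (forall t, psi t ^+ 2 = 1) -> (forall t, semi (M t) (psi t) D') ->
  (forall t, covv (M t) (psi t) P') ->
  d' = d /\ exists2 c : R, c != 0 & forall i, D * P' i = mpolyC n c * D' * P i.
Proof.
move=> le D'0 P'0 hD' hP' psi2 sD' cP'; apply: (mw_min mw) => //; split => //.
by exists psi.
Qed.

(** The tool behind the degree bounds: it is fed a pair of lower degree, possibly with another
    character [psi], whose field would vanish only in an absurd case. *)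
Lemma minimal_lower d' P' D' (psi : T -> R) : (d' < d)%N -> D' != 0 ->
  homogen d' D' -> (forall i, homogen (d' + 2)%N (P' i)) ->
  (forall t, psi t ^+ 2 = 1) -> (forall t, semi (M t) (psi t) D') ->
  (forall t, covv (M t) (psi t) P') -> forall i, P' i = 0.
Proof.
move=> lt D'0 hD' hP' psi2 sD' cP' i; apply: contrapT => h.
have P'0 : exists i, P' i != 0 by exists i; apply/eqP.
have [e _] := minimal_other (ltnW lt) D'0 P'0 hD' hP' psi2 sD' cP'.
by rewrite e ltnn in lt.
Qed.

End MinimalPairTools.

Lemma min_pair_character (R : realType) n (T : Type) (M : T -> 'M[R]_n) d P D :
  min_pair M d P D -> exists chi, minimal_with M d P D chi.
Proof.
by move=> [[D0 P0 hD hP [chi h1 h2]] mp]; exists chi; split => // t; case: (h2 t).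
Qed.

(** * Divergence of a quotient field *)

Section Divergence.
Variables (R : realType) (n : nat).
Implicit Types (L : 'M[R]_n) (P : 'I_n -> mpoly n R) (D : mpoly n R).

Lemma divergence_fracv P D : D != 0 ->
  (divergence (fracv P D) = 0) <-> (D * divv P = dotv (grad D) P).
Proof.
move=> D0; have -> : divergence (fracv P D) =
    toratfun (D * divv P - dotv (grad D) P) / toratfun D ^+ 2.
  rewrite /divergence; under eq_bigr => i _ do rewrite mxE ratfun_deriv_frac //.
  rewrite -mulr_suml -rmorph_sum /=; congr (toratfun _ / _).
  rewrite /divv /dotv mulr_sumr -sumrB; apply: eq_bigr => i _.
  by rewrite mulrC (mulrC (P i)).
split=> [/eqP|->]; last by rewrite subrr rmorph0 mul0r.
by rewrite mulf_eq0 invr_eq0 expf_eq0 !toratfun_eq0 (negPf D0) orbF subr_eq0 => /eqP.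
Qed.

(** The trace of the Jacobian is unchanged by any invertible conjugation, so the divergence may be
    computed after making the group orthogonal. *)
Lemma divergence_lin_conj L (Q : vfield R n) : L \in unitmx ->
  divergence Q = 0 -> divergence (lin_conj L Q) = 0.
Proof.
move=> uL; have [P [D [D0 ->]]] := fracv_exists Q; move/(divergence_fracv _ D0) => h.
have LD0 : poly_comp L D != 0 by rewrite poly_comp_eq0.
rewrite lin_conj_fracv //; apply/(divergence_fracv _ LD0).
have coef k j : \sum_i mpolyC n (invmx L i j) * mpolyC n (L k i) = mpolyC n (k == j)%:R.
  have /matrixP/(_ k j) := mulmxV uL; rewrite !mxE => <-; rewrite rmorph_sum.
  by apply: eq_bigr => i _; rewrite rmorphM mulrC.
have delta (F : 'I_n -> 'I_n -> mpoly n R) :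
    \sum_i \sum_j \sum_k mpolyC n (invmx L i j) * mpolyC n (L k i) * F k j = \sum_k F k k.
  rewrite exchange_big /=; under eq_bigr => j _ do rewrite exchange_big /=.
  rewrite exchange_big /=; apply: eq_bigr => k _.
  under eq_bigr => j _ do rewrite -mulr_suml coef.
  rewrite (bigD1 k) //= eqxx mpolyC1 mul1r big1 ?addr0 // => j jk.
  by rewrite eq_sym (negPf jk) mpolyC0 mul0r.
have -> : divv (mulv (invmx L) (fun i => poly_comp L (P i))) = poly_comp L (divv P).
  rewrite /divv rmorph_sum /= -(delta (fun k j => poly_comp L (mderiv k (P j)))).
  apply: eq_bigr => i _; rewrite /mulv raddf_sum /=; apply: eq_bigr => j _.
  by rewrite mderiv_mulC mderiv_poly_comp mulr_sumr; apply: eq_bigr => k _; rewrite mulrA.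
rewrite -rmorphM h /dotv rmorph_sum /= -(delta (fun k j => poly_comp L (grad D k * P j))).
apply: eq_bigr => i _; rewrite /grad mderiv_poly_comp /mulv mulr_sumr.
apply: eq_bigr => j _; rewrite mulr_suml; apply: eq_bigr => k _.
rewrite rmorphM /=; ring.
Qed.

End Divergence.

(** * Cross products in dimension three *)

Definition i0 : 'I_3 := @Ordinal 3 0 isT.
Definition i1 : 'I_3 := @Ordinal 3 1 isT.
Definition i2 : 'I_3 := @Ordinal 3 2 isT.

Lemma forall3 (Q : 'I_3 -> Prop) : Q i0 -> Q i1 -> Q i2 -> forall i, Q i.
Proof.
move=> h0 h1 h2 [[|[|[|//]]] lt].
- by rewrite (_ : Ordinal lt = i0) //; exact: val_inj.
- by rewrite (_ : Ordinal lt = i1) //; exact: val_inj.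
- by rewrite (_ : Ordinal lt = i2) //; exact: val_inj.
Qed.

Lemma sum3 (V : nmodType) (F : 'I_3 -> V) : \sum_i F i = F i0 + F i1 + F i2.
Proof.
rewrite !big_ord_recl big_ord0 addr0 addrA.
by congr (F _ + F _ + F _); exact: val_inj.
Qed.

Lemma prod3 (A : pzRingType) (F : 'I_3 -> A) : \prod_i F i = F i0 * F i1 * F i2.
Proof.
rewrite !big_ord_recl big_ord0 mulr1 mulrA.
by congr (F _ * F _ * F _); exact: val_inj.
Qed.

Definition vec3 (T : Type) (a b c : T) (i : 'I_3) : T :=
  match val i with 0 => a | 1 => b | _ => c end.

Definition cross (A : comPzRingType) (u v : 'I_3 -> A) : 'I_3 -> A :=
  vec3 (u i1 * v i2 - u i2 * v i1) (u i2 * v i0 - u i0 * v i2) (u i0 * v i1 - u i1 * v i0).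

Lemma det2 (A : comPzRingType) (B : 'M[A]_2) :
  \det B = B ord0 ord0 * B ord_max ord_max - B ord0 ord_max * B ord_max ord0.
Proof.
rewrite (expand_det_row B ord0) big_ord_recl big_ord1 /cofactor !det_mx11 !mxE /=.
rewrite addn0 expr0 mul1r.
have e1 : lift ord0 0 = ord_max :> 'I_2 by exact: val_inj.
have e2 : lift ord_max 0 = ord0 :> 'I_2 by exact: val_inj.
rewrite -[lift ord0 ord0]/(lift ord0 0) !e1 !e2 /= expr1; ring.
Qed.

Lemma cofactor3 (A : comPzRingType) (L : 'M[A]_3) j :
  (cofactor L i0 j = cross (L i1) (L i2) j) * (cofactor L i1 j = cross (L i2) (L i0) j) *
  (cofactor L i2 j = cross (L i0) (L i1) j).
Proof.
have l00 : lift i0 ord0 = i1 by exact: val_inj.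
have l01 : lift i0 ord_max = i2 by exact: val_inj.
have l10 : lift i1 ord0 = i0 by exact: val_inj.
have l11 : lift i1 ord_max = i2 by exact: val_inj.
have l20 : lift i2 ord0 = i0 by exact: val_inj.
have l21 : lift i2 ord_max = i1 by exact: val_inj.
rewrite /cofactor !det2 !mxE !(l00, l01, l10, l11, l20, l21) /cross.
by do !split; move: j; apply: forall3; rewrite !(l00, l01, l10, l11, l20, l21) /vec3 /=; ring.
Qed.

Lemma det3 (A : comPzRingType) (L : 'M[A]_3) : \det L =
  L i0 i0 * (L i1 i1 * L i2 i2 - L i1 i2 * L i2 i1)
  - L i0 i1 * (L i1 i0 * L i2 i2 - L i1 i2 * L i2 i0)
  + L i0 i2 * (L i1 i0 * L i2 i1 - L i1 i1 * L i2 i0).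
Proof.
rewrite (expand_det_row L i0) sum3 !cofactor3 /cross /vec3 /=; ring.
Qed.

Section Cross.
Variable A : comPzRingType.
Implicit Types (u v w : 'I_3 -> A).

Lemma crossE u v : (cross u v i0 = u i1 * v i2 - u i2 * v i1) *
  (cross u v i1 = u i2 * v i0 - u i0 * v i2) * (cross u v i2 = u i0 * v i1 - u i1 * v i0).
Proof. by []. Qed.

Lemma vec3E (T : Type) (a b c : T) : (vec3 a b c i0 = a) * (vec3 a b c i1 = b) * (vec3 a b c i2 = c).
Proof. by []. Qed.

End Cross.

Section CrossCovariance.
Variable R : realType.
Implicit Types (L : 'M[R]_3) (P V : 'I_3 -> mpoly 3 R).

Lemma cofactor_orthogonal L i j : orthogonal L -> cofactor L i j = \det L * L i j.
Proof.
move=> oL; have := mul_mx_adj L; rewrite -(mulmx1 (\adj L)) => /(congr1 (fun B => L^T *m B)).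
rewrite mulmx1 mulmxA oL mul1mx mul_mx_scalar => /matrixP/(_ j i).
by rewrite !mxE.
Qed.

(** Cross products transform by the cofactor matrix, and for an orthogonal [L] that matrix is
    [\det L] times [L]; hence the extra sign. *)
Lemma cross_orthogonal L P V i : orthogonal L ->
  cross (mulv L P) (mulv L V) i = mpolyC 3 (\det L) * mulv L (cross P V) i.
Proof.
move=> oL; transitivity (\sum_j mpolyC 3 (cofactor L i j) * cross P V j).
  move: i; apply: forall3; rewrite sum3 !cofactor3 /mulv /cross !sum3 /vec3 /= !mpolyCB !mpolyCM; ring.
rewrite /mulv mulr_sumr; apply: eq_bigr => j _.
by rewrite cofactor_orthogonal // mpolyCM mulrA.
Qed.

Lemma cov_cross L (a b : R) P V : orthogonal L -> covv L a P -> covv L b V ->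
  covv L (\det L * (a * b)) (cross P V).
Proof.
move=> oL cP cV i.
have -> : poly_comp L (cross P V i) =
    cross (fun j => poly_comp L (P j)) (fun j => poly_comp L (V j)) i.
  by move: i; apply: forall3; rewrite !crossE rmorphB !rmorphM.
transitivity (mpolyC 3 (a * b) * cross (mulv L P) (mulv L V) i).
  move: i; apply: forall3; rewrite !crossE !cP !cV mpolyCM; ring.
by rewrite cross_orthogonal // [in RHS]mpolyCM; ring.
Qed.

Lemma homogen_cross d e P V : (forall i, homogen d (P i)) -> (forall i, homogen e (V i)) ->
  forall i, homogen (d + e)%N (cross P V i).
Proof.
by move=> hP hV; apply: forall3; rewrite !crossE; apply: rpredB; apply: dhomogM.
Qed.

End CrossCovariance.

(** * Radial polynomials *)

Section Radial.
Variable R : realType.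
Implicit Types (f g p : mpoly 3 R) (L : 'M[R]_3) (P : 'I_3 -> mpoly 3 R).

Definition sqnorm : mpoly 3 R := dotv (@pos R 3) (@pos R 3).

Lemma semi_sqnorm L : orthogonal L -> semi L 1 sqnorm.
Proof. by move=> oL; rewrite -[1]mulr1; apply: cov_dot => //; exact: cov_pos. Qed.

Lemma homogen_sqnorm : homogen 2%N sqnorm.
Proof. by apply: (@homogen_dot _ _ 1 1); exact: homogen_pos. Qed.

Lemma homogen_exp d p k : homogen d p -> homogen (d * k)%N (p ^+ k).
Proof. exact: dhomogMn. Qed.

Lemma mderiv_pos (i j : 'I_3) : mderiv i (pos R j) = (i == j)%:R.
Proof. exact: mderiv_var. Qed.

Lemma mderiv_sqnorm i : mderiv i sqnorm = 2 * pos R i.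
Proof.
rewrite /sqnorm /dotv raddf_sum /= (bigD1 i) //= big1 ?addr0 => [|j ji].
  by rewrite mderivM !mderiv_pos eqxx /=; ring.
by rewrite mderivM !mderiv_pos eq_sym (negPf ji) mul0r mulr0 addr0.
Qed.

Lemma pos_neq0 i : pos R i != 0 :> mpoly 3 R.
Proof.
apply: contraTneq isT => e; have := mderiv_pos i i; rewrite e raddf0 eqxx => /esym/eqP.
by rewrite oner_eq0.
Qed.

Lemma sqnorm_neq0 : sqnorm != 0.
Proof.
apply: contraTneq isT => e; have := mderiv_sqnorm i0; rewrite e raddf0 => /esym/eqP.
by rewrite mulf_eq0 (negPf (pos_neq0 _)) orbF -mpolyC_nat mpolyC_eq0 pnatr_eq0.
Qed.

Lemma mpolyC_natE k : mpolyC 3 (k%:R : R) = k%:R.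
Proof. exact: mpolyC_nat. Qed.

Lemma rotation_invariant_grad e f i : homogen e f ->
  (forall i j, pos R j * mderiv i f = pos R i * mderiv j f) ->
  sqnorm * mderiv i f = e%:R * pos R i * f.
Proof.
move=> hf inv; rewrite /sqnorm /dotv mulr_suml.
under eq_bigr => j _ do rewrite -mulrA inv mulrCA.
rewrite -mulr_sumr (euler_identity hf) mpolyC_natE; ring.
Qed.

(** The hypothesis says that infinitesimal rotations kill [f]. Taking the divergence of
    [sqnorm * grad f = e f x] gives [sqnorm * l = e (e + 1) f] with [l] the Laplacian, so [sqnorm]
    divides [f] and the quotient satisfies the same hypothesis two degrees lower. *)
Lemma radial_power e f : homogen e f ->
  (forall i j, pos R j * mderiv i f = pos R i * mderiv j f) ->
  f = 0 \/ exists (c : R) k, f = mpolyC 3 c * sqnorm ^+ k /\ e = (2 * k)%N.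
Proof.
elim/ltn_ind: e f => -[|e] IH f hf inv.
  by right; have [c ->] := homogen0_const hf; exists c, 0%N; rewrite mulr1.
have [->|f0] := eqVneq f 0; first by left.
pose l := divv (grad f).
have el : sqnorm * l = (e.+1 * e.+2)%:R * f.
  have e1 : dotv (grad f) (@pos R 3) = e.+1%:R * f.
    by rewrite dotvC (euler_grad hf) mpolyC_natE.
  have e2 : divv (@pos R 3) = 3%:R.
    by rewrite /divv sum3 !mderiv_pos /=; ring.
  have h1 : divv (fun i => sqnorm * grad f i) = 2 * (e.+1%:R * f) + sqnorm * l.
    rewrite divv_scale; congr (_ + _).
    by rewrite -e1 -[in RHS]dotvC -dotv_scale; apply: eq_bigr => i _; rewrite /grad mderiv_sqnorm.
  have h2 : divv (fun i => (e.+1%:R * f) * pos R i) = (e.+1%:R * (e.+1%:R * f)) + e.+1%:R * f * 3.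
    rewrite divv_scale e2; congr (_ + _); rewrite -[in RHS]e1 -dotv_scale; apply: eq_bigr => i _.
    by rewrite /grad -(mpolyC_natE e.+1) mderiv_mulC.
  have h : divv (fun i => sqnorm * grad f i) = divv (fun i => (e.+1%:R * f) * pos R i).
    apply: eq_bigr => i _; congr (mderiv i _); rewrite /grad (rotation_invariant_grad _ hf inv); ring.
  move: h; rewrite h1 h2 => h.
  rewrite natrM; apply: (addrI (2 * (e.+1%:R * f))); rewrite h; ring.
pose g := mpolyC 3 ((e.+1 * e.+2)%:R^-1 : R) * l.
have ne0 : ((e.+1 * e.+2)%:R : R) != 0 by rewrite pnatr_eq0.
have efg : f = sqnorm * g.
  rewrite /g mulrCA el -(mpolyC_natE (e.+1 * e.+2)) mulrA -mpolyCM mulVf // mpolyC1 mul1r.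
  by [].
have hg : homogen e.-1 g.
  apply: homogen_mulC; apply: (@homogen_div _ _ e) => i.
  exact: (@homogen_mderiv _ _ e.+1).
move: g efg hg => g efg hg.
have e2 : e.+1 = (2 + e.-1)%N.
  by apply: (dhomog_uniq f0 hf); rewrite efg; apply: dhomogM => //; exact: homogen_sqnorm.
have [||g0|[c [k [eg ek]]]] := IH e.-1 _ g hg.
- by rewrite ltnS leq_pred.
- move=> i j; apply: (mulfI sqnorm_neq0); have := inv i j; rewrite efg !mderivM !mderiv_sqnorm => h.
  apply: (addrI (2 * pos R i * pos R j * g)); transitivity (pos R j * (2 * pos R i * g + sqnorm * mderiv i g)).
    by ring.
  by rewrite h; ring.
- by move: f0; rewrite efg g0 mulr0 eqxx.
right; exists c, k.+1; split; last by rewrite e2 ek mulnS.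
by rewrite efg eg exprS; ring.
Qed.

End Radial.

(** * Parity of the degree and divergence of the numerator *)

Section OrthogonalMinimal.
Variables (R : realType) (T : Type) (M : T -> 'M[R]_3).
Variables (d : nat) (P : 'I_3 -> mpoly 3 R) (D : mpoly 3 R) (chi : T -> R).
Hypothesis oM : forall t, orthogonal (M t).
Hypothesis mw : minimal_with M d P D chi.

Let q := sqnorm R.

Lemma semi_sqnorm_pow t k : semi (M t) 1 (q ^+ k).
Proof. by rewrite -[1](expr1n _ k); apply: semi_expp; exact: semi_sqnorm. Qed.

(** For [d = 1] the competitor is [D x] over 1; for [d = 2m + 3] it is [grad D] over [q^m], of
    degree [2m]. Neither field can vanish. *)
Lemma trivial_character_even : (forall t, chi t = 1) -> ~~ odd d.
Proof.
move=> chi1; apply/negP => od.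
have sD t : semi (M t) 1 D by rewrite -(chi1 t); exact: (mw_denom mw).
have one2 (t : T) : (1 : R) ^+ 2 = 1 by rewrite expr1n.
have [m em] : exists m, d = m.*2.+1 by exists d./2; rewrite -[LHS]odd_double_half od.
case: m em => [|m] em.
  have h : forall i, D * pos R i = 0.
    apply: (@minimal_lower _ _ _ _ _ _ _ _ mw 0 _ 1 (fun=> 1)) => //.
    - by rewrite em.
    - exact: oner_neq0.
    - by rewrite -mpolyC1; exact: homogenC.
    - by move=> i; rewrite add0n; apply: (@dhomogM _ _ _ 1 _ 1); [have := mw_denom_homog mw; rewrite em|exact: homogen_pos].
    - by move=> t; rewrite -mpolyC1; exact: semi_const.
    - by move=> t; rewrite -[1]mulr1; apply: cov_scale => //; exact: cov_pos.
  by move/eqP: (h i0); rewrite mulf_eq0 (negPf (mw_denom0 mw)) (negPf (pos_neq0 _ _)).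
have h : forall i, grad D i = 0.
  apply: (@minimal_lower _ _ _ _ _ _ _ _ mw (2 * m)%N _ (q ^+ m) (fun=> 1)) => //.
  - by rewrite em mul2n doubleS; lia.
  - by rewrite expf_neq0 // sqnorm_neq0.
  - exact/homogen_exp/homogen_sqnorm.
  - move=> i; have := homogen_mderiv i (mw_denom_homog mw).
    by rewrite em /= mul2n doubleS addn2.
  - by move=> t; exact: semi_sqnorm_pow.
  - by move=> t; exact: semi_grad.
have := mw_denom_homog mw; rewrite em => hD.
by have /eqP := homogen_mderiv_eq0 hD h; rewrite (negPf (mw_denom0 mw)).
Qed.

Lemma minimal_grad_dot : exists c : R, forall i, grad (dotv P (@pos R 3)) i = mpolyC 3 c * P i.
Proof.
apply: (minimal_field mw) => [i|t].
  have := homogen_mderiv i (homogen_dot (mw_field_homog mw) (@homogen_pos R 3)).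
  by rewrite addn1.
apply: semi_grad => //; rewrite -[chi t]mulr1; apply: cov_dot => //; last exact: cov_pos.
exact: (mw_field mw).
Qed.

(** If [f = divv P] were nonzero, [P] would be a multiple of [f x]. Comparison with [grad (P . x)]
    then makes [f] radial, hence of even degree [d + 1] and of trivial character, against
    [trivial_character_even]. *)
Lemma minimal_div0 : divv P = 0.
Proof.
pose f := divv P; apply/eqP; rewrite -/f; apply: contraT => f0.
have sf t : semi (M t) (chi t) f by apply: cov_div => //; exact: (mw_field mw).
have hf : homogen d.+1 f by have := homogen_div (mw_field_homog mw); rewrite addn2.
have [c ec] : exists c : R, forall i, f * pos R i = mpolyC 3 c * P i.
  apply: (minimal_field mw) => [i|t].
    have -> : (d + 2 = d.+1 + 1)%N by rewrite addn1 addn2.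
    by apply: dhomogM => //; exact: homogen_pos.
  by rewrite -[chi t]mulr1; apply: cov_scale => //; exact: cov_pos.
have c0 : c != 0.
  apply: contraNneq f0 => c0; move/eqP: (ec i0); rewrite c0 mpolyC0 mul0r mulf_eq0.
  by rewrite (negPf (pos_neq0 _ _)) orbF.
have [b eb] := minimal_grad_dot.
have dp : mpolyC 3 c * dotv P (@pos R 3) = f * q.
  rewrite /q /sqnorm -!dotv_scale; apply: eq_bigr => i _; by rewrite ec.
have gq i : q * mderiv i f = mpolyC 3 (b - 2) * (f * pos R i).
  have : mpolyC 3 c * grad (dotv P (@pos R 3)) i = mpolyC 3 b * (f * pos R i).
    by rewrite eb ec; ring.
  rewrite /grad -mderiv_mulC dp mderivM mderiv_sqnorm => h.
  apply: (addIr (f * (2 * pos R i))); rewrite mulrC h mpolyCB mpolyC_natE; ring.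
have inv i j : pos R j * mderiv i f = pos R i * mderiv j f.
  apply: (mulfI (sqnorm_neq0 R)); rewrite !(mulrCA (sqnorm R)) !gq; ring.
have [f00|[a [k [ef ek]]]] := radial_power hf inv; first by rewrite f00 eqxx in f0.
have /trivial_character_even : forall t, chi t = 1.
  move=> t; have := sf t; rewrite /semi {1}ef rmorphM /= poly_compC semi_sqnorm_pow.
  rewrite mpolyC1 mul1r -ef -{1}[f]mul1r => /(mulIf f0)/esym/eqP.
  by rewrite -mpolyC1 mpolyC_eq => /eqP.
by move: ek => /(congr1 odd); rewrite /= oddM /= => /negbFE ->.
Qed.

End OrthogonalMinimal.

(** * Polynomials adapted to an axis *)

Section Planar.
Variable R : realType.
Implicit Types (f g p u v : mpoly 3 R) (a b c : R).

Let x : mpoly 3 R := pos R i0.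
Let y : mpoly 3 R := pos R i1.
Let z : mpoly 3 R := pos R i2.

Definition planar_norm : mpoly 3 R := pos R i0 * pos R i0 + pos R i1 * pos R i1.

(* Real and imaginary parts of (x + iy)^m. *)
Fixpoint cpow m : mpoly 3 R * mpoly 3 R :=
  if m is k.+1 then (x * (cpow k).1 - y * (cpow k).2, x * (cpow k).2 + y * (cpow k).1)
  else (1, 0).

Lemma pos_derivs (i : 'I_3) :
  (mderiv i x = (i == i0)%:R) * (mderiv i y = (i == i1)%:R) * (mderiv i z = (i == i2)%:R).
Proof. by rewrite /x /y /z !mderiv_pos. Qed.

Lemma homogen_cpow m : homogen m (cpow m).1 /\ homogen m (cpow m).2.
Proof.
elim: m => [|m [IH1 IH2]] /=.
  by split; [rewrite -mpolyC1; exact: homogenC|exact: dhomog0].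
by split; [apply: rpredB|apply: rpredD]; rewrite -[m.+1]add1n; apply: dhomogM => //; exact: homogen_pos.
Qed.

Lemma cpow_norm m : (cpow m).1 * (cpow m).1 + (cpow m).2 * (cpow m).2 = planar_norm ^+ m.
Proof.
elim: m => [|m IH] /=; first by rewrite expr0; ring.
by rewrite exprS -IH /planar_norm -/x -/y; ring.
Qed.

(** With [w = x + iy]: the conjugate of [w^m] times [w^(m+l)] is [|w|^(2m) w^l]. *)
Lemma cpow_conj m l :
  ((cpow m).1 * (cpow (m + l)).1 + (cpow m).2 * (cpow (m + l)).2 = planar_norm ^+ m * (cpow l).1) /\
  ((cpow m).1 * (cpow (m + l)).2 - (cpow m).2 * (cpow (m + l)).1 = planar_norm ^+ m * (cpow l).2).
Proof.
elim: m => [|m [IH1 IH2]]; first by rewrite add0n expr0 /=; split; ring.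
rewrite addSn /=.
rewrite exprS -!mulrA -IH1 -IH2 /planar_norm -/x -/y; split; ring.
Qed.

Lemma planar_norm_neq0 : planar_norm != 0.
Proof.
apply: contraTneq isT => /(congr1 (mderiv i0)); rewrite raddf0 mderivD !mderivM -/x -/y !pos_derivs /=.
move=> e; have /eqP : 2 * x = 0 by rewrite -e; ring.
by rewrite mulf_eq0 (negPf (pos_neq0 _ _)) orbF -mpolyC_natE mpolyC_eq0 pnatr_eq0.
Qed.

Lemma homogen_planar_norm : homogen 2%N planar_norm.
Proof. by apply: rpredD; apply: (@dhomogM _ _ _ 1 _ 1); exact: homogen_pos. Qed.

(** These are the real and imaginary parts of [(a + ib) w^m], whose squares add up to
    [(a^2 + b^2) |w|^(2m)]. *)
Lemma cpow_combination_neq0 m a b : (a != 0) || (b != 0) ->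
  (mpolyC 3 a * (cpow m).1 - mpolyC 3 b * (cpow m).2 != 0) ||
  (mpolyC 3 b * (cpow m).1 + mpolyC 3 a * (cpow m).2 != 0).
Proof.
apply: contraLR; rewrite !negb_or !negbK => /andP[/eqP e1 /eqP e2].
have : mpolyC 3 (a ^+ 2 + b ^+ 2) * planar_norm ^+ m = 0.
  rewrite -cpow_norm mpolyCD !expr2 !mpolyCM; set A := (cpow m).1; set B := (cpow m).2.
  transitivity ((mpolyC 3 a * A - mpolyC 3 b * B) * (mpolyC 3 a * A - mpolyC 3 b * B) +
    (mpolyC 3 b * A + mpolyC 3 a * B) * (mpolyC 3 b * A + mpolyC 3 a * B)); first by ring.
  by rewrite e1 e2; ring.
move/eqP; rewrite mulf_eq0 expf_eq0 (negPf planar_norm_neq0) andbF orbF mpolyC_eq0.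
by rewrite paddr_eq0 ?sqr_ge0 // !sqrf_eq0.
Qed.

Lemma planar_euler m p : homogen m p -> mderiv i2 p = 0 ->
  x * mderiv i0 p + y * mderiv i1 p = m%:R * p.
Proof.
move=> hp p2; have := euler_grad hp; rewrite /dotv sum3 /grad p2 mulr0 addr0.
by rewrite mpolyC_natE.
Qed.

(* The Cauchy-Riemann equations for u - iv. *)
Lemma cauchy_riemann_homogen m u v : homogen m u -> homogen m v ->
  mderiv i2 u = 0 -> mderiv i2 v = 0 ->
  mderiv i0 u = - mderiv i1 v -> mderiv i1 u = mderiv i0 v ->
  exists a b, u = mpolyC 3 a * (cpow m).1 - mpolyC 3 b * (cpow m).2 /\
    v = - (mpolyC 3 b * (cpow m).1 + mpolyC 3 a * (cpow m).2).
Proof.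
elim: m u v => [|m IH] u v hu hv u2 v2 e1 e2.
  have [a ->] := homogen0_const hu; have [b ->] := homogen0_const hv.
  by exists a, (- b); rewrite /= mpolyCN; split; ring.
have [||||||a [b [ea eb]]] := IH (mderiv i0 u) (mderiv i0 v).
- exact: (@homogen_mderiv _ _ m.+1).
- exact: (@homogen_mderiv _ _ m.+1).
- by rewrite mderiv_comm u2 raddf0.
- by rewrite mderiv_comm v2 raddf0.
- by rewrite {1}e1 raddfN /= mderiv_comm.
- by rewrite mderiv_comm e2.
have m0 : (m.+1%:R : R) != 0 by rewrite pnatr_eq0.
have M0 : (m.+1%:R : mpoly 3 R) != 0 by rewrite -mpolyC_natE mpolyC_eq0.
have ev1 : mderiv i1 v = - mderiv i0 u by rewrite e1 opprK.
exists (a / m.+1%:R), (b / m.+1%:R).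
have ec c : mpolyC 3 c = m.+1%:R * mpolyC 3 (c / m.+1%:R).
  by rewrite -mpolyC_natE -mpolyCM mulrC divfK.
split; apply: (mulfI M0).
  rewrite -planar_euler // e2 ea eb (ec a) (ec b) /=; ring.
rewrite -planar_euler // ev1 ea eb (ec a) (ec b) /=; ring.
Qed.

(** Differentiating in [z] keeps the equation and lowers [c] by one until the derivative vanishes.
    The way back divides by [c], since the equation itself recovers [f] from its derivative. *)
Lemma z_eigen e f c : f != 0 -> homogen e f -> z * mderiv i2 f = mpolyC 3 c * f ->
  exists j g, [/\ (j <= e)%N, c = j%:R, f = z ^+ j * g, mderiv i2 g = 0 & homogen (e - j)%N g].
Proof.
elim: e f c => [|e IH] f c f0 hf ef.
  exists 0%N, f; have [b eb] := homogen0_const hf.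
  have d0 : mderiv i2 f = 0 by rewrite eb mderivC.
  rewrite expr0 mul1r subn0; split=> //; move: ef; rewrite d0 mulr0 => /esym/eqP.
  by rewrite mulf_eq0 (negPf f0) orbF mpolyC_eq0 => /eqP.
have [f2|f2] := eqVneq (mderiv i2 f) 0.
  exists 0%N, f; rewrite expr0 mul1r subn0; split=> //; move: ef; rewrite f2 mulr0 => /esym/eqP.
  by rewrite mulf_eq0 (negPf f0) orbF mpolyC_eq0 => /eqP.
have [||j [g [je ec eg g2 hg]]] := IH (mderiv i2 f) (c - 1) f2.
- exact: (@homogen_mderiv _ _ e.+1).
- have := congr1 (mderiv i2) ef; rewrite mderivM pos_derivs /= mderiv_mulC mpolyCB mpolyC1 => h.
  by rewrite mulrBl -h; ring.
have ec' : c = j.+1%:R by rewrite -natr1 -ec subrK.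
have c0 : c != 0 by rewrite ec' pnatr_eq0.
exists j.+1, (mpolyC 3 c^-1 * g); split=> //.
- rewrite exprS; transitivity (mpolyC 3 c^-1 * (z * mderiv i2 f)); last by rewrite eg; ring.
  by rewrite ef mulrA -mpolyCM mulVf // mpolyC1 mul1r.
- by rewrite mderiv_mulC g2 mulr0.
- by rewrite subSS; exact: homogen_mulC.
Qed.

(** [z^2] and [x^2 + y^2] are independent invariants of degree two of an axial group. If both
    multiples of [p] are multiples of one minimal object, the vanishing coefficients force
    [p = 0]. *)
Lemma incomparable_squares a b p : mpolyC 3 a * (z * z * p) = mpolyC 3 b * (planar_norm * p) ->
  p != 0 -> a = 0 /\ b = 0.
Proof.
move=> e p0; have {}e : mpolyC 3 a * (z * z) = mpolyC 3 b * planar_norm.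
  by apply: (mulIf p0); rewrite -mulrA e mulrA.
have d2 := congr1 (mderiv i2) e; have d0 := congr1 (mderiv i0) e.
rewrite /planar_norm !mderiv_mulC !mderivD !mderivM -/x -/y !pos_derivs /= in d2 d0.
have c2 c (w : mpoly 3 R) : w != 0 -> mpolyC 3 c * (2 * w) = 0 -> c = 0.
  move=> w0 /eqP; rewrite !mulf_eq0 (negPf w0) orbF -mpolyC_natE !mpolyC_eq0 pnatr_eq0 orbF.
  by move/eqP.
split.
  apply: (c2 a z (pos_neq0 _ _)); transitivity (mpolyC 3 a * (1%:R * z + z * 1%:R)); first by ring.
  by rewrite d2; ring.
apply: (c2 b x (pos_neq0 _ _)); transitivity (mpolyC 3 b * (1%:R * x + x * 1%:R + (0%:R * y + y * 0%:R))); first by ring.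
by rewrite -d0; ring.
Qed.

Definition planar_lap p := mderiv i0 (mderiv i0 p) + mderiv i1 (mderiv i1 p).

Lemma homogen_planar_lap m p : homogen m p -> homogen m.-2 (planar_lap p).
Proof. by move=> hp; apply: rpredD; do 2!apply: homogen_mderiv. Qed.

Lemma planar_lap_small m p : (m < 2)%N -> homogen m p -> planar_lap p = 0.
Proof.
move=> m2 hp; have hd i : mderiv i (mderiv i p) = 0.
  have h : homogen 0%N (mderiv i p) by have := homogen_mderiv i hp; case: m m2 {hp} => [|[|]].
  by have [c ->] := homogen0_const h; rewrite mderivC.
by rewrite /planar_lap !hd addr0.
Qed.

End Planar.

(** * Covariants of maps preserving the z axis *)

Section AxialCovariance.
Variables (R : realType) (L : 'M[R]_3) (e : R).
Implicit Types (p q : mpoly 3 R) (V : 'I_3 -> mpoly 3 R) (a b : R).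

Definition axis_z : 'cV[R]_3 := \col_i (i == i2)%:R.

Hypothesis oL : orthogonal L.
Hypothesis eL : L *m axis_z = e *: axis_z.
Hypothesis e2 : e ^+ 2 = 1.

Lemma covv_ext n (K : 'M[R]_n) a (V W : 'I_n -> mpoly n R) : V =1 W -> covv K a V -> covv K a W.
Proof. by move=> h c i; rewrite -h c; congr (_ * _); exact: mulv_ext. Qed.

Lemma semi_cancel n (K : 'M[R]_n) a b (p q : mpoly n R) : q != 0 -> b ^+ 2 = 1 -> semi K b q ->
  semi K a (q * p) -> semi K (a * b) p.
Proof.
move=> q0 b2 sq sp; apply: (mulfI q0).
have -> : q * poly_comp K p = mpolyC n b * (poly_comp K q * poly_comp K p).
  by rewrite sq -!mulrA !(mulrA (mpolyC n b)) -!mpolyCM -!expr2 b2 mpolyC1 !mul1r.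
rewrite -rmorphM /= sp mpolyCM; ring.
Qed.

Lemma covv_cancel n (K : 'M[R]_n) a b (q : mpoly n R) (V : 'I_n -> mpoly n R) : q != 0 -> b ^+ 2 = 1 ->
  semi K b q -> covv K a (fun i => q * V i) -> covv K (a * b) V.
Proof.
move=> q0 b2 sq sp i; apply: (mulfI q0).
have -> : q * poly_comp K (V i) = mpolyC n b * (poly_comp K q * poly_comp K (V i)).
  by rewrite sq -!mulrA !(mulrA (mpolyC n b)) -!mpolyCM -!expr2 b2 mpolyC1 !mul1r.
rewrite -rmorphM /= sp mulvZp mpolyCM; ring.
Qed.

Let E := constv axis_z.

Lemma axis_zE : (E i0 = 0) * (E i1 = 0) * (E i2 = 1).
Proof. by rewrite /E /constv !mxE /= mpolyC0 mpolyC1. Qed.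

Lemma cov_axis : covv L e E.
Proof. exact: cov_const. Qed.

Lemma dot_axis V : dotv V E = V i2.
Proof. by rewrite /dotv sum3 !axis_zE; ring. Qed.

(** The removed vertical part is a scalar of character [a * e] times the axis field of character
    [e], and [e ^+ 2 = 1] restores [a]. *)
Lemma cov_planar a V : covv L a V -> covv L a (vec3 (V i0) (V i1) 0).
Proof.
move=> cV; apply: (@covv_ext _ _ _ (fun i => V i - V i2 * E i)).
  by apply: forall3; rewrite axis_zE ?vec3E; ring.
apply: cov_sub => //; rewrite (_ : a = (a * e) * e); last by rewrite -mulrA -expr2 e2 mulr1.
by apply: cov_scale; [rewrite -dot_axis; apply: cov_dot => //; exact: cov_axis|exact: cov_axis].
Qed.

(** The quarter turn is the cross product with the axis, which explains the sign [\det L * e]. *)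
Lemma cov_quarter_turn a V : covv L a V ->
  covv L (\det L * e * a) (vec3 (- V i1) (V i0) 0).
Proof.
move=> cV; apply: (@covv_ext _ _ _ (cross E V)).
  by apply: forall3; rewrite crossE !axis_zE vec3E; ring.
by rewrite -mulrA; apply: cov_cross => //; exact: cov_axis.
Qed.

Lemma semi_dz a p : semi L a p -> semi L (a * e) (mderiv i2 p).
Proof.
move=> sp; rewrite (_ : mderiv i2 p = dotv (grad p) E); last by rewrite dot_axis.
by apply: cov_dot => //; [exact: semi_grad|exact: cov_axis].
Qed.

Lemma cov_dz a V : covv L a V -> covv L (e * a) (fun i => mderiv i2 (V i)).
Proof.
move=> cV; apply: (@covv_ext _ _ _ (dirv E V)); last by apply: cov_dir => //; exact: cov_axis.
by move=> i; rewrite /dirv sum3 !axis_zE; ring.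
Qed.

Lemma semi_z : semi L e (pos R i2).
Proof.
by rewrite -[e]mul1r -dot_axis; apply: cov_dot => //; [exact: cov_pos|exact: cov_axis].
Qed.

Lemma semi_planar_norm : semi L 1 (planar_norm R).
Proof.
rewrite (_ : planar_norm R = dotv (vec3 (pos R i0) (pos R i1) 0) (@pos R 3)).
  by rewrite -[1]mulr1; apply: cov_dot => //; [apply: cov_planar|]; exact: cov_pos.
by rewrite /planar_norm /dotv sum3 !vec3E; ring.
Qed.

Lemma semi_planar_lap a p : semi L a p -> semi L a (planar_lap p).
Proof.
move=> sp; rewrite (_ : planar_lap p = divv (vec3 (grad p i0) (grad p i1) 0)).
  by apply: cov_div => //; apply: cov_planar; exact: semi_grad.
by rewrite /divv sum3 !vec3E raddf0 addr0.
Qed.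

Lemma det_orthogonal_sqr : \det L ^+ 2 = 1.
Proof. by rewrite expr2 -{1}det_tr -det_mulmx oL det1. Qed.

End AxialCovariance.

Lemma pm1 (R : realType) (a : R) : a ^+ 2 = 1 -> a = 1 \/ a = -1.
Proof.
move=> h; have /eqP : a ^+ 2 = 1 ^+ 2 by rewrite h expr1n.
by rewrite eqf_sqr => /orP[]/eqP->; [left|right].
Qed.

(** * Minimal pairs with an invariant axis; fields tangent to circles *)

Section Axial.
Variables (R : realType) (T : Type) (M : T -> 'M[R]_3) (e : T -> R).
Variables (d : nat) (P : 'I_3 -> mpoly 3 R) (D : mpoly 3 R) (chi : T -> R).
Hypothesis oM : forall t, orthogonal (M t).
Hypothesis eM : forall t, M t *m axis_z R = e t *: axis_z R.
Hypothesis e2 : forall t, e t ^+ 2 = 1.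
Hypothesis mw : minimal_with M d P D chi.

Let x : mpoly 3 R := pos R i0.
Let y : mpoly 3 R := pos R i1.
Let z : mpoly 3 R := pos R i2.
Let q := planar_norm R.
Let delta t := \det (M t) * e t.

Let delta2 t : delta t ^+ 2 = 1.
Proof. by rewrite exprMn det_orthogonal_sqr // e2 mulr1. Qed.

Let chi2 := mw_sqr mw.
Let hP := mw_field_homog mw.
Let hD := mw_denom_homog mw.
Let D0 := mw_denom0 mw.
Let cP := mw_field mw.
Let sD := mw_denom mw.

Let derivs (i : 'I_3) :
  (mderiv i x = (i == i0)%:R) * (mderiv i y = (i == i1)%:R) * (mderiv i z = (i == i2)%:R).
Proof. by rewrite /x /y /z !mderiv_pos. Qed.

Lemma axial_z_degree : exists c : R, forall i, z * mderiv i2 (P i) = mpolyC 3 c * P i.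
Proof.
apply: (minimal_field mw) => [i|t].
  have -> : (d + 2 = 1 + (d + 2).-1)%N by rewrite addn2.
  by apply: dhomogM; [exact: homogen_pos|exact: homogen_mderiv].
have -> : chi t = e t * (e t * chi t) by rewrite mulrA -expr2 e2 mul1r.
by apply: cov_scale; [exact: semi_z|apply: cov_dz].
Qed.

(** The planar part of [P] is a multiple of [P], so a nonzero vertical component would make [P]
    purely vertical. Zero divergence and the proportionality of [grad (z P_2)] to [P] would then
    kill all derivatives of that component, whose degree is positive. *)
Lemma axial_horizontal : P i2 = 0.
Proof.
have [c ec] : exists c : R, forall i, vec3 (P i0) (P i1) 0 i = mpolyC 3 c * P i.
  by apply: (minimal_field mw) => [|t]; [apply: forall3; rewrite vec3E //; exact: dhomog0|exact: cov_planar].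
apply/eqP; apply: contraT => p0.
have c0 : c = 0.
  by move/eqP: (ec i2); rewrite vec3E eq_sym mulf_eq0 (negPf p0) orbF mpolyC_eq0 => /eqP.
have P0 : P i0 = 0 by move: (ec i0); rewrite c0 mpolyC0 mul0r.
have P1 : P i1 = 0 by move: (ec i1); rewrite c0 mpolyC0 mul0r.
have pz : mderiv i2 (P i2) = 0.
  by have := minimal_div0 oM mw; rewrite /divv sum3 P0 P1 !raddf0 !add0r.
have [b eb] := minimal_grad_dot oM mw.
have dp : dotv P (@pos R 3) = z * P i2 by rewrite /dotv sum3 P0 P1 !mul0r !add0r mulrC.
have pd (i : 'I_3) : (i == i2) = false -> P i = 0 -> mderiv i (P i2) = 0.
  move=> ne Pi; apply: (mulfI (pos_neq0 R i2)); move: (eb i); rewrite /grad dp Pi !mulr0.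
  by rewrite mderivM derivs ne mul0r add0r.
have := hP i2; rewrite addn2 => h.
have /eqP := homogen_mderiv_eq0 h (forall3 (Q := fun i => mderiv i (P i2) = 0) (pd i0 erefl P0) (pd i1 erefl P1) pz).
by rewrite (negPf p0).
Qed.

Definition rotational_form := exists a c : R, [/\ a != 0, c != 0,
  forall i, P i = vec3 (- (mpolyC 3 a * z * y)) (mpolyC 3 a * z * x) 0 i & D = mpolyC 3 c].

(** The numerator is the conjugate of [(a + ib) (x + iy)^(k+2)], the gradient of a planar harmonic
    polynomial. *)
Definition harmonic_form := exists k (a b c : R), [/\ (k <= 1)%N, (a != 0) || (b != 0), c != 0,
  forall i, P i = vec3 (mpolyC 3 a * (cpow R k.+2).1 - mpolyC 3 b * (cpow R k.+2).2)
    (- (mpolyC 3 b * (cpow R k.+2).1 + mpolyC 3 a * (cpow R k.+2).2)) 0 i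
  & D = mpolyC 3 c * z ^+ k].

Let field_nonzero : (P i0 != 0) || (P i1 != 0).
Proof.
have [i Pi] := mw_field0 mw; apply: contraT; rewrite negb_or !negbK => /andP[/eqP h0 /eqP h1].
by move: Pi; move: i; apply: forall3; rewrite ?h0 ?h1 ?axial_horizontal eqxx.
Qed.

Section Rotational.
Hypothesis tangent : x * P i0 + y * P i1 = 0.

(** Differentiating the tangency relation and using Euler's identity in the plane gives [s] as the
    planar curl of [P] divided by [d + 3 - b]. Since [b] is a degree in [z], at most [d + 2], the
    divisor is nonzero. *)
Lemma rotational_factor : exists s c j, [/\ homogen d.+1 s, P i0 = - (y * s), P i1 = x * s,
  s = z ^+ j * c & [/\ mderiv i2 c = 0, (j <= d.+1)%N & homogen (d.+1 - j)%N c]].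
Proof.
have [b eb] := axial_z_degree.
have bn : (d + 3)%:R - b != 0.
  have [i Pi] := mw_field0 mw.
  have [j [g [je -> _ _ _]]] := z_eigen Pi (hP i) (eb i).
  by rewrite -natrB ?pnatr_eq0; lia.
have eu i : x * mderiv i0 (P i) + y * mderiv i1 (P i) = ((d + 2)%:R - mpolyC 3 b) * P i.
  have := euler_grad (hP i); rewrite /dotv sum3 /grad eb mpolyC_natE => h.
  by rewrite mulrBl -h addrK.
pose s := mpolyC 3 ((d + 3)%:R - b)^-1 * (mderiv i0 (P i1) - mderiv i1 (P i0)).
have d0 : P i0 + x * mderiv i0 (P i0) + y * mderiv i0 (P i1) = 0.
  transitivity (mderiv i0 (x * P i0 + y * P i1)); last by rewrite tangent raddf0.
  by rewrite mderivD !mderivM !derivs /=; ring.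
have d1 : x * mderiv i1 (P i0) + P i1 + y * mderiv i1 (P i1) = 0.
  transitivity (mderiv i1 (x * P i0 + y * P i1)); last by rewrite tangent raddf0.
  by rewrite mderivD !mderivM !derivs /=; ring.
have inv (p r : mpoly 3 R) : mpolyC 3 ((d + 3)%:R - b) * p = r -> p = mpolyC 3 ((d + 3)%:R - b)^-1 * r.
  by move=> <-; rewrite mulrA -mpolyCM mulVf // mpolyC1 mul1r.
have e3 : mpolyC 3 ((d + 3)%:R - b) = (d + 2)%:R - mpolyC 3 b + 1.
  have -> : (d + 3 = d + 2 + 1)%N by rewrite -addnA.
  by rewrite mpolyCB mpolyC_natE natrD; ring.
have P0 : P i0 = - (y * s).
  apply: etrans (inv _ (- (y * (mderiv i0 (P i1) - mderiv i1 (P i0)))) _) _; last by rewrite /s; ring.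
  rewrite e3 mulrDl -eu mul1r; apply/eqP; rewrite -subr_eq0; apply/eqP.
  by rewrite -[RHS]d0; ring.
have P1 : P i1 = x * s.
  apply: etrans (inv _ (x * (mderiv i0 (P i1) - mderiv i1 (P i0))) _) _; last by rewrite /s; ring.
  rewrite e3 mulrDl -eu mul1r; apply/eqP; rewrite -subr_eq0; apply/eqP.
  by rewrite -[RHS]d1; ring.
have hs : homogen d.+1 s.
  apply: homogen_mulC; have hm i j := homogen_mderiv j (hP i).
  by apply: rpredB; [have := hm i1 i0|have := hm i0 i1]; rewrite addn2.
move: s P0 P1 hs => s P0 P1 hs.
have s0 : s != 0.
  by apply: contraTneq field_nonzero => s0; rewrite P0 P1 s0 !mulr0 oppr0 eqxx.
have [|j [g [je _ es g2 hg]]] := @z_eigen _ _ s b s0 hs.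
  have h : - (y * (z * mderiv i2 s)) = - (y * (mpolyC 3 b * s)).
    transitivity (z * mderiv i2 (P i0)); last by rewrite eb P0; ring.
    by rewrite P0 mderivN mderivM derivs /=; ring.
  exact: (mulfI (pos_neq0 R i1)) (oppr_inj h).
by exists s, g, j.
Qed.

Let turn V : 'I_3 -> mpoly 3 R := vec3 (- V i1) (V i0) 0.

Let cov_turn t a V : covv (M t) a V -> covv (M t) (delta t * a) (turn V).
Proof. exact: cov_quarter_turn. Qed.

Lemma rotational_semi s : P i0 = - (y * s) -> P i1 = x * s ->
  forall t, semi (M t) (delta t * chi t) s.
Proof.
move=> P0 P1 t; rewrite -[delta t * chi t]mulr1; apply: (@semi_cancel _ _ _ _ _ s q).
- exact: planar_norm_neq0.
- by rewrite expr1n.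
- exact: semi_planar_norm.
rewrite (_ : q * s = dotv (turn (@pos R 3)) P).
  by apply: cov_dot => //; rewrite -[delta t]mulr1; apply: cov_turn; exact: cov_pos.
by rewrite /dotv sum3 /turn !vec3E P0 P1 /q /planar_norm -/x -/y; ring.
Qed.

Lemma mderiv_zpow (i : 'I_3) j (g : mpoly 3 R) : i != i2 -> mderiv i (z ^+ j * g) = z ^+ j * mderiv i g.
Proof.
move=> ne; elim: j g => [|j IH] g; first by rewrite expr0 !mul1r.
by rewrite exprSr -mulrA IH mderivM derivs (negPf ne) mul0r add0r mulrA.
Qed.

(** The planar Laplacian of [s] vanishes, because its products with [z^2] and [x^2 + y^2] would give
    two fields proportional to [P]. Zero divergence makes the planar factor [g] of [s] constant on
    circles, so [q * planar_lap g = m^2 g] in degree [m], and [m = 0]. *)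
Lemma rotational_power : exists2 c : R, c != 0 & P i0 = - (y * (mpolyC 3 c * z ^+ d.+1)) /\ P i1 = x * (mpolyC 3 c * z ^+ d.+1).
Proof.
have [s [g [j [hs P0 P1 es [g2 jd hg]]]]] := rotational_factor.
have s0 : s != 0.
  by apply: contraTneq field_nonzero => s0; rewrite P0 P1 s0 !mulr0 oppr0 eqxx.
have x0 : x != 0 := pos_neq0 R i0.
have z0 : z != 0 := pos_neq0 R i2.
have g0 : g != 0 by apply: contraNneq s0 => g0; rewrite es g0 mulr0.
have ss := rotational_semi P0 P1.
have lap0 : planar_lap s = 0.
  have [d1|d2] := ltnP d.+1 2; first exact: planar_lap_small d1 hs.
  apply/eqP; apply: contraT => l0.
  have ed : (d + 2 = (2 + d.-1) + 1)%N by move: d2; case: (d) => // k _; rewrite addn1 addnC.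
  have hl : homogen d.-1 (planar_lap s) by exact: (homogen_planar_lap hs).
  have ht : forall i, homogen 1%N (turn (@pos R 3) i).
    by apply: forall3; rewrite /turn vec3E ?rpredN; [exact: homogen_pos|exact: homogen_pos|exact: dhomog0].
  have key r : homogen 2%N r -> (forall t, semi (M t) 1 r) -> exists c : R, r * planar_lap s = mpolyC 3 c * s.
    move=> hr sr; have [|t|c ec] := @minimal_field _ _ _ _ _ _ _ _ mw (fun i => (r * planar_lap s) * turn (@pos R 3) i).
    - by move=> i; rewrite ed; apply: dhomogM => //; apply: dhomogM.
    - have -> : chi t = (1 * (delta t * chi t)) * (delta t * 1).
        by rewrite mul1r mulr1 mulrAC -expr2 delta2 mul1r.
      apply: cov_scale; last by apply: cov_turn; exact: cov_pos.
      by apply: semi_mulp => //; exact: semi_planar_lap.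
    exists c; move: (ec i1); rewrite /turn vec3E -/x P1 => h.
    by apply: (mulIf x0); rewrite h; ring.
  have [|t|c1 e1] := key (z * z).
  - by apply: (@dhomogM _ _ _ 1 _ 1); exact: homogen_pos.
  - by rewrite -(e2 t) expr2; apply: semi_mulp; exact: semi_z.
  have [|t|c2 e2'] := key q; [exact: homogen_planar_norm|exact: semi_planar_norm|].
  have [|_ c10] := @incomparable_squares R c2 c1 (planar_lap s) _ l0.
    by rewrite e1 e2'; ring.
  by move/eqP: e1; rewrite c10 mpolyC0 mul0r !mulf_eq0 (negPf z0) (negPf l0).
have gl : planar_lap g = 0.
  move/eqP: lap0; rewrite es /planar_lap !mderiv_zpow // -mulrDr mulf_eq0 expf_eq0 (negPf z0) andbF /=.
  by move/eqP.
have inv : x * mderiv i1 g = y * mderiv i0 g.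
  have := minimal_div0 oM mw; rewrite /divv sum3 axial_horizontal raddf0 addr0 P0 P1.
  rewrite mderivN !mderivM !derivs /= es !mderiv_zpow // => h.
  apply: (mulfI (expf_neq0 j z0)); apply/eqP; rewrite -subr_eq0; apply/eqP; rewrite -[RHS]h; ring.
have eu := planar_euler hg g2; rewrite -/x -/y in eu.
set m := (d.+1 - j)%N in hg eu.
have q0 : q * mderiv i0 g = m%:R * (x * g).
  transitivity (x * (x * mderiv i0 g) + y * (y * mderiv i0 g)).
    by rewrite /q /planar_norm -/x -/y; ring.
  by rewrite -inv; transitivity (x * (x * mderiv i0 g + y * mderiv i1 g)); [ring|rewrite eu; ring].
have q1 : q * mderiv i1 g = m%:R * (y * g).
  transitivity (x * (x * mderiv i1 g) + y * (y * mderiv i1 g)).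
    by rewrite /q /planar_norm -/x -/y; ring.
  by rewrite inv; transitivity (y * (x * mderiv i0 g + y * mderiv i1 g)); [ring|rewrite eu; ring].
have m2 : (m%:R * m%:R : mpoly 3 R) * g = 0.
  have dq (i : 'I_3) : mderiv i q = 2 * ((i == i0)%:R * x + (i == i1)%:R * y).
    by rewrite /q /planar_norm mderivD !mderivM -/x -/y !derivs; ring.
  set a := mderiv i0 (mderiv i0 g) in gl; set b := mderiv i1 (mderiv i1 g) in gl.
  have h0 : 2 * x * mderiv i0 g + q * a = m%:R * (g + x * mderiv i0 g).
    transitivity (mderiv i0 (q * mderiv i0 g)); first by rewrite mderivM dq -/a /=; ring.
    by rewrite q0 -(mpolyC_natE R m) mderiv_mulC mderivM derivs /=; ring.
  have h1 : 2 * y * mderiv i1 g + q * b = m%:R * (g + y * mderiv i1 g).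
    transitivity (mderiv i1 (q * mderiv i1 g)); first by rewrite mderivM dq -/b /=; ring.
    by rewrite q1 -(mpolyC_natE R m) mderiv_mulC mderivM derivs /=; ring.
  transitivity (m%:R * (x * mderiv i0 g + y * mderiv i1 g)); first by rewrite eu mulrA.
  transitivity (m%:R * (g + x * mderiv i0 g) + m%:R * (g + y * mderiv i1 g) - 2 * (m%:R * g)); first by ring.
  rewrite -h0 -h1; transitivity (q * (a + b) + 2 * (x * mderiv i0 g + y * mderiv i1 g) - 2 * (m%:R * g)); first by ring.
  by rewrite eu (_ : a + b = 0) //; ring.
have m0 : m = 0%N.
  move/eqP: m2; rewrite mulf_eq0 (negPf g0) orbF mulf_eq0 orbb -mpolyC_natE mpolyC_eq0 pnatr_eq0.
  by move/eqP.
rewrite m0 in hg; have [c ec] := homogen0_const hg.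
have ej : j = d.+1 by apply/eqP; rewrite eqn_leq jd -subn_eq0 -/m m0.
exists c; first by apply: contraNneq g0 => c0; rewrite ec c0 mpolyC0.
by split; rewrite ?P0 ?P1 es ec ej (mulrC (z ^+ _)).
Qed.

Lemma semi_unique (L : 'M[R]_3) a b (p : mpoly 3 R) : p != 0 -> semi L a p -> semi L b p -> a = b.
Proof.
move=> p0 sa sb; have : mpolyC 3 a * p = mpolyC 3 b * p by rewrite -sa -sb.
by move/(mulIf p0)/eqP; rewrite mpolyC_eq => /eqP.
Qed.

(** The power of [z] fixes the character: [chi = delta * e^(d+1)]. If [d > 0], competitors built
    from the derivatives of [D] have lower degree and force every derivative of [D] to vanish. For
    the [z] derivative, the competitor is [z^d (-y, x, 0)] with [mderiv i2 D] as its denominator. *)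
Lemma rotational_degree0 : d = 0%N.
Proof.
have [c c0 [P0 P1]] := rotational_power.
have z0 : z != 0 := pos_neq0 R i2.
have C0 : mpolyC 3 c != 0 :> mpoly 3 R by rewrite mpolyC_eq0.
have ce t : delta t * chi t = e t ^+ d.+1.
  apply: (semi_unique _ (rotational_semi P0 P1 t)); first by rewrite mulf_neq0 ?expf_neq0.
  by rewrite -[e t ^+ _]mul1r; apply: semi_mulp; [exact: semi_const|apply: semi_expp; exact: semi_z].
have chiE t : chi t = delta t * e t ^+ d.+1 by rewrite -ce mulrA -expr2 delta2 mul1r.
have ht : forall i, homogen 1%N (turn (@pos R 3) i).
  by apply: forall3; rewrite /turn vec3E ?rpredN; [exact: homogen_pos|exact: homogen_pos|exact: dhomog0].
apply/eqP; apply: contraT; rewrite -lt0n => dpos.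
have dzD : mderiv i2 D = 0.
  apply/eqP; apply: contraT => D2.
  have h : forall i, z ^+ d * turn (@pos R 3) i = 0.
    apply: (@minimal_lower _ _ _ _ _ _ _ _ mw d.-1 _ (mderiv i2 D) (fun t => chi t * e t)) => //.
    - by rewrite prednK.
    - exact: homogen_mderiv.
    - move=> i; have -> : (d.-1 + 2 = 1 * d + 1)%N by rewrite mul1n; case: (d) dpos => // k _; rewrite addn2 addn1.
      by apply: dhomogM => //; exact/homogen_exp/homogen_pos.
    - by move=> t; rewrite exprMn chi2 e2 mulr1.
    - by move=> t; exact: semi_dz.
    - move=> t; have -> : chi t * e t = e t ^+ d * (delta t * 1).
        rewrite chiE exprS; transitivity ((e t ^+ 2) * (e t ^+ d * delta t)); first by rewrite expr2; ring.
        by rewrite e2; ring.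
      apply: cov_scale; last by apply: cov_turn; exact: cov_pos.
      by apply: semi_expp; exact: semi_z.
  move/eqP: (h i1); rewrite /turn vec3E mulf_eq0 expf_eq0 (negPf z0) andbF /=.
  by rewrite (negPf (pos_neq0 _ _)).
pose V := turn (grad D).
have cV t : covv (M t) (e t ^+ d.+1) V by rewrite -ce; apply: cov_turn; exact: semi_grad.
have hV : forall i, homogen d.-1 (V i).
  by apply: forall3; rewrite /V /turn vec3E ?rpredN; [exact: homogen_mderiv|exact: homogen_mderiv|exact: dhomog0].
have even_e t k : e t ^+ (2 * k) = 1 by rewrite exprM e2 expr1n.
have q0 k : q ^+ k != 0 by rewrite expf_neq0 // planar_norm_neq0.
have hq k : homogen (2 * k)%N (q ^+ k) by exact/homogen_exp/homogen_planar_norm.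
have sq t k : semi (M t) 1 (q ^+ k).
  by rewrite -[1](expr1n _ k); apply: semi_expp; exact: semi_planar_norm.
have one2 (t : T) : (1 : R) ^+ 2 = 1 by rewrite expr1n.
(* [V] has degree [d - 1] and character [e^(d+1)]. For odd [d] it is a numerator as it stands, or
   after multiplication by [q] when [d = 1]; for even [d] a factor [z] repairs both degree and
   character. *)
have V0 : forall i, V i = 0.
  have dk := odd_double_half d; case: (odd d) dk => dk.
    case: (d./2) dk => [|k] dk.
      have h i : q ^+ 1 * V i = 0.
        move: i; apply: (@minimal_lower _ _ _ _ _ _ _ _ mw 0 _ (q ^+ 0) (fun=> 1)) => //.
        + by move=> i; rewrite -[(0 + 2)%N]addn0; apply: dhomogM; rewrite ?(hq 1%N) //; have := hV i; rewrite -dk.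
        + move=> t; rewrite -[1]mulr1; apply: cov_scale => //.
          by have := cV t; rewrite -dk (even_e t 1%N).
      by move=> i; move/eqP: (h i); rewrite mulf_eq0 (negPf (q0 _)) => /eqP.
    apply: (@minimal_lower _ _ _ _ _ _ _ _ mw (2 * k)%N _ (q ^+ k) (fun=> 1)) => //.
    + by rewrite -dk; lia.
    + by move=> i; have := hV i; rewrite -dk (_ : (true + k.+1.*2).-1 = 2 * k + 2)%N //; lia.
    + by move=> t; have := cV t; rewrite -dk (_ : (true + k.+1.*2).+1 = 2 * k.+2)%N ?even_e //; lia.
  case: (d./2) dk => [|k] dk; first by move: dpos; rewrite -dk.
  have h i : z * V i = 0.
    move: i; apply: (@minimal_lower _ _ _ _ _ _ _ _ mw (2 * k)%N _ (q ^+ k) (fun=> 1)) => //.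
    + by rewrite -dk; lia.
    + move=> i; have -> : (2 * k + 2 = 1 + d.-1)%N by rewrite -dk; lia.
      by apply: dhomogM => //; exact: homogen_pos.
    + move=> t; have -> : 1 = e t * e t ^+ d.+1.
        by rewrite -exprS -dk (_ : (false + k.+1.*2).+2 = 2 * k.+2)%N ?even_e //; lia.
      by apply: cov_scale => //; exact: semi_z.
  by move=> i; move/eqP: (h i); rewrite mulf_eq0 (negPf z0) => /eqP.
have D1 : mderiv i1 D = 0 by apply: oppr_inj; rewrite oppr0; exact: (V0 i0).
have D00 : mderiv i0 D = 0 := V0 i1.
have hD' : homogen d.-1.+1 D by rewrite prednK.
have /eqP := homogen_mderiv_eq0 hD' (forall3 (Q := fun i => mderiv i D = 0) D00 D1 dzD).
by rewrite (negPf D0).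
Qed.

Lemma rotational : rotational_form.
Proof.
have d0 := rotational_degree0; have [c c0 [P0 P1]] := rotational_power.
have [b eb] : exists b : R, D = mpolyC 3 b by apply: homogen0_const; have := hD; rewrite d0.
rewrite d0 expr1 in P0 P1.
exists c, b; split=> //.
- by apply: contraNneq D0 => b0; rewrite eb b0 mpolyC0.
- apply: forall3; rewrite ?vec3E ?axial_horizontal // ?P0 ?P1; ring.
Qed.

End Rotational.
End Axial.

(** * Gradient fields around an axis *)

Section Harmonic.
Variables (R : realType) (T : Type) (M : T -> 'M[R]_3) (e : T -> R).
Variables (d : nat) (P : 'I_3 -> mpoly 3 R) (D : mpoly 3 R) (chi : T -> R).
Hypothesis oM : forall t, orthogonal (M t).
Hypothesis eM : forall t, M t *m axis_z R = e t *: axis_z R.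
Hypothesis e2 : forall t, e t ^+ 2 = 1.
Hypothesis mw : minimal_with M d P D chi.

Let x : mpoly 3 R := pos R i0.
Let y : mpoly 3 R := pos R i1.
Let z : mpoly 3 R := pos R i2.
Let q := planar_norm R.
Let delta t := \det (M t) * e t.

Let delta2 t : delta t ^+ 2 = 1.
Proof. by rewrite exprMn det_orthogonal_sqr // e2 mulr1. Qed.

Let chi2 := mw_sqr mw.
Let hP := mw_field_homog mw.
Let hD := mw_denom_homog mw.
Let D0 := mw_denom0 mw.
Let cP := mw_field mw.
Let sD := mw_denom mw.
Let z0 : z != 0 := pos_neq0 R i2.

Let turn V : 'I_3 -> mpoly 3 R := vec3 (- V i1) (V i0) 0.

Let cov_turn t a V : covv (M t) a V -> covv (M t) (delta t * a) (turn V).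
Proof. exact: cov_quarter_turn. Qed.

Let one2 (t : T) : (1 : R) ^+ 2 = 1.
Proof. by rewrite expr1n. Qed.

Let P2 : P i2 = 0.
Proof. exact: (axial_horizontal oM eM e2 mw). Qed.

Section GradientCase.
Variable c : R.
Hypothesis c0 : c != 0.
Hypothesis gradP : forall i, grad (dotv P (@pos R 3)) i = mpolyC 3 c * P i.

(** With [c] nonzero, [P] is a gradient, so its Jacobian is symmetric; being horizontal it does not
    depend on [z], and zero divergence completes the Cauchy-Riemann equations. *)
Lemma harmonic_field : exists a b, [/\ (a != 0) || (b != 0),
  P i0 = mpolyC 3 a * (cpow R d.+2).1 - mpolyC 3 b * (cpow R d.+2).2 &
  P i1 = - (mpolyC 3 b * (cpow R d.+2).1 + mpolyC 3 a * (cpow R d.+2).2)].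
Proof.
have C0 : mpolyC 3 c != 0 :> mpoly 3 R by rewrite mpolyC_eq0.
have sym i j : mderiv i (P j) = mderiv j (P i).
  by apply: (mulfI C0); rewrite -!mderiv_mulC -!gradP /grad mderiv_comm.
have dv : mderiv i0 (P i0) = - mderiv i1 (P i1).
  have := minimal_div0 oM mw; rewrite /divv sum3 P2 raddf0 addr0 => /eqP.
  by rewrite addr_eq0 => /eqP.
have hP0 := hP i0; have hP1 := hP i1; rewrite addn2 in hP0 hP1.
have [||//||a [b [ea eb]]] := cauchy_riemann_homogen hP0 hP1.
- by rewrite sym P2 raddf0.
- by rewrite sym P2 raddf0.
- exact: sym.
exists a, b; split=> //; apply: contraT; rewrite negb_or !negbK => /andP[/eqP a0 /eqP b0].
have [i Pi] := mw_field0 mw; move: i Pi.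
by apply: forall3; rewrite ?ea ?eb ?P2 ?a0 ?b0 ?mpolyC0 ?mul0r ?subr0 ?addr0 ?oppr0 eqxx.
Qed.

(** The planar Laplacian and the second [z] derivative of [D] have degree [d - 2] and character
    [chi], hence vanish by [incomparable_squares]: [D] is affine in [z] and its planar factor is
    harmonic. *)
Lemma harmonic_denom : exists k g, [/\ (k <= 1)%N, (k <= d)%N, D = z ^+ k * g,
  mderiv i2 g = 0 & homogen (d - k)%N g /\ planar_lap g = 0].
Proof.
have key r (f : mpoly 3 R) : (1 < d)%N -> homogen 2%N r -> (forall t, semi (M t) 1 r) ->
    homogen d.-2 f -> (forall t, semi (M t) (chi t) f) -> exists b : R, r * f = mpolyC 3 b * D.
  move=> d2 hr sr hf sf; apply: (minimal_denom mw) => [|t].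
    have -> : d = (2 + d.-2)%N by move: d2; lia.
    exact: dhomogM.
  by rewrite -[chi t]mul1r; apply: semi_mulp.
have van (f : mpoly 3 R) : (1 < d)%N -> homogen d.-2 f -> (forall t, semi (M t) (chi t) f) -> f = 0.
  move=> d2 hf sf; apply/eqP; apply: contraT => f0.
  have [|t|b1 e1] := key (z * z) f d2 _ _ hf sf.
  - by apply: (@dhomogM _ _ _ 1 _ 1); exact: homogen_pos.
  - by rewrite -(e2 t) expr2; apply: semi_mulp; exact: semi_z.
  have [|t|b2 e2'] := key q f d2 _ _ hf sf; [exact: homogen_planar_norm|exact: semi_planar_norm|].
  have [|_ b10] := @incomparable_squares R b2 b1 f _ f0; first by rewrite e1 e2'; ring.
  by move/eqP: e1; rewrite b10 mpolyC0 mul0r !mulf_eq0 (negPf z0) (negPf f0).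
have small i : (d <= 1)%N -> mderiv i (mderiv i D) = 0.
  move=> d1; have h : homogen 0%N (mderiv i D).
    by have := homogen_mderiv i hD; case: (d) d1 => [|[|]].
  by have [b ->] := homogen0_const h; rewrite mderivC.
have lapD : planar_lap D = 0.
  have [d1|d2] := leqP d 1; first by rewrite /planar_lap !small // addr0.
  apply: van => //; first exact: homogen_planar_lap.
  by move=> t; exact: semi_planar_lap.
have D22 : mderiv i2 (mderiv i2 D) = 0.
  have [d1|d2] := leqP d 1; first exact: small.
  apply: van => //; first by do 2!apply: homogen_mderiv.
  move=> t; have -> : chi t = chi t * e t * e t by rewrite -mulrA -expr2 e2 mulr1.
  by do 2!apply: semi_dz => //.
have [b eb] : exists b : R, z * mderiv i2 D = mpolyC 3 b * D.
  apply: (minimal_denom mw) => [|t].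
    have [d0|dpos] := posnP d.
      have [b ->] : exists b : R, D = mpolyC 3 b by apply: homogen0_const; have := hD; rewrite d0.
      by rewrite mderivC mulr0; exact: dhomog0.
    have {1}-> : d = (1 + d.-1)%N by rewrite add1n prednK.
    by apply: dhomogM; [exact: homogen_pos|exact: homogen_mderiv].
  have -> : chi t = e t * (chi t * e t) by rewrite mulrCA -expr2 e2 mulr1.
  by apply: semi_mulp; [exact: semi_z|exact: semi_dz].
have [k [g [kd ek eD g2 hg]]] := z_eigen D0 hD eb.
exists k, g; split=> //.
(* Applying [z d/dz] twice to [D] loses the second-order term, so the exponent satisfies
   [b^2 = b]. *)
- have : mpolyC 3 (b * b) * D = mpolyC 3 b * D.
    rewrite mpolyCM -mulrA -eb; transitivity (z * mderiv i2 (z * mderiv i2 D)); first by rewrite [in RHS]eb mderiv_mulC; ring.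
    by rewrite mderivM D22 mderiv_pos eqxx mulr0 addr0 mul1r.
  move/(mulIf D0)/eqP; rewrite mpolyC_eq ek -natrM eqr_nat.
  by case: (k) => [|[|k']] //; lia.
- split=> //; move/eqP: lapD; rewrite eD /planar_lap !mderiv_zpow // -mulrDr mulf_eq0.
  by rewrite expf_eq0 (negPf z0) andbF /= => /eqP.
Qed.

(** If the planar factor of [D] had degree [N > 0], it would be proportional to the real part of
    some [beta w^N]. Multiplying [P], the conjugate of [alpha w^(d+2)], by [beta w^N] gives
    [|w|^(2N)] times the conjugate of a multiple of [w^(k+2)]; that field over [z^k] is a competitor
    of degree [k < d]. *)
Lemma harmonic : harmonic_form P D.
Proof.
have [a [b [ab0 eP0 eP1]]] := harmonic_field.
have [k [g [k1 kd eD g2 [hg lapg]]]] := harmonic_denom.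
have g0 : g != 0 by apply: contraNneq D0 => g0; rewrite eD g0 mulr0.
move eN : (d - k)%N hg => N hg; case: N eN hg => [|N] eN hg.
  have ed : d = k by apply/eqP; rewrite eqn_leq kd andbT -subn_eq0 eN.
  have [b' eg] := homogen0_const hg; exists k, a, b, b'; split=> //.
  - by apply: contraNneq g0 => b0; rewrite eg b0 mpolyC0.
  - by rewrite -ed; apply: forall3; rewrite vec3E.
  - by rewrite eD eg mulrC.
have [||||||u [v [eu ev]]] := @cauchy_riemann_homogen R N (mderiv i0 g) (mderiv i1 g).
- exact: (@homogen_mderiv _ _ N.+1).
- exact: (@homogen_mderiv _ _ N.+1).
- by rewrite mderiv_comm g2 raddf0.
- by rewrite mderiv_comm g2 raddf0.
- by apply/eqP; rewrite -addr_eq0; apply/eqP.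
- exact: mderiv_comm.
have eg : N.+1%:R * g = mpolyC 3 u * (cpow R N.+1).1 - mpolyC 3 v * (cpow R N.+1).2.
  by rewrite -(planar_euler hg g2) eu ev /=; ring.
pose h := y * mderiv i0 g - x * mderiv i1 g.
have eh : h = mpolyC 3 v * (cpow R N.+1).1 + mpolyC 3 u * (cpow R N.+1).2.
  by rewrite /h eu ev /= -/x -/y; ring.
have uv0 : (u != 0) || (v != 0).
  apply: contraT; rewrite negb_or !negbK => /andP[/eqP u0 /eqP v0].
  move/eqP: eg; rewrite u0 v0 mpolyC0 !mul0r subr0 mulf_eq0 (negPf g0) orbF.
  by rewrite -mpolyC_natE mpolyC_eq0 pnatr_eq0.
have ed : d.+2 = (N.+1 + k.+2)%N by rewrite -(subnK kd) eN !addnS.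
(* [s + ir] is [a + ib] times the conjugate of [u + iv]. *)
pose s := u * a + v * b; pose r := u * b - v * a.
pose W : 'I_3 -> mpoly 3 R := vec3 (mpolyC 3 s * (cpow R k.+2).1 - mpolyC 3 r * (cpow R k.+2).2)
  (- (mpolyC 3 r * (cpow R k.+2).1 + mpolyC 3 s * (cpow R k.+2).2)) 0.
have sr0 : (s != 0) || (r != 0).
  apply: contraT; rewrite negb_or !negbK => /andP[/eqP s0 /eqP r0].
  have : (u ^+ 2 + v ^+ 2) * (a ^+ 2 + b ^+ 2) = 0.
    transitivity (s ^+ 2 + r ^+ 2); first by rewrite /s /r; ring.
    by rewrite s0 r0 expr0n addr0.
  move/eqP; rewrite mulf_eq0 !paddr_eq0 ?sqr_ge0 // !sqrf_eq0.
  by move: ab0 uv0; case: (a == 0); case: (b == 0); case: (u == 0); case: (v == 0).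
have [cj1 cj2] := @cpow_conj R N.+1 k.+2.
rewrite -ed in cj1 cj2.
have eW i : q ^+ N.+1 * W i = (N.+1%:R * g) * P i + h * turn P i.
  move: i; apply: forall3; rewrite /W /turn !vec3E.
  - transitivity (mpolyC 3 s * (q ^+ N.+1 * (cpow R k.+2).1) - mpolyC 3 r * (q ^+ N.+1 * (cpow R k.+2).2)); first by ring.
    rewrite -cj1 -cj2 eg eh eP0 eP1 /s /r; ring.
  - transitivity (- (mpolyC 3 r * (q ^+ N.+1 * (cpow R k.+2).1) + mpolyC 3 s * (q ^+ N.+1 * (cpow R k.+2).2))); first by ring.
    rewrite -cj1 -cj2 eg eh eP0 eP1 /s /r; ring.
  - by rewrite P2; ring.
have W0 : forall i, W i = 0.
  apply: (@minimal_lower _ _ _ _ _ _ _ _ mw k _ (z ^+ k) (fun t => e t ^+ k)) => //.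
  - by rewrite -subn_gt0 eN.
  - by rewrite expf_neq0.
  - by have := @homogen_exp R 1 z k (@homogen_pos R 3 i2); rewrite mul1n.
  - have [h1 h2] := homogen_cpow R k.+2; rewrite addn2.
    by apply: forall3; rewrite /W vec3E ?rpredN ?rpredB ?rpredD ?homogen_mulC //; exact: dhomog0.
  - by move=> t; rewrite exprAC e2 expr1n.
  - by move=> t; apply: semi_expp; exact: semi_z.
  - move=> t; have sg : semi (M t) (chi t * e t ^+ k) g.
      apply: (@semi_cancel _ _ _ _ _ _ (z ^+ k)); rewrite ?expf_neq0 //.
      + by rewrite exprAC e2 expr1n.
      + by apply: semi_expp; exact: semi_z.
      + by rewrite -eD.
    have sh : semi (M t) (delta t * (chi t * e t ^+ k)) h.
      have -> : h = dotv (turn (grad g)) (@pos R 3).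
        by rewrite /dotv sum3 /turn !vec3E /grad /h -/x -/y; ring.
      rewrite -[delta t * _]mulr1; apply: cov_dot => //; last exact: cov_pos.
      by apply: cov_turn; exact: semi_grad.
    rewrite -[e t ^+ k]mulr1; apply: (@covv_cancel _ _ _ _ _ (q ^+ N.+1)).
    + by rewrite expf_neq0 // planar_norm_neq0.
    + by rewrite expr1n.
    + by rewrite -[1](expr1n _ N.+1); apply: semi_expp; exact: semi_planar_norm.
    apply: (covv_ext (fsym eW)); apply: cov_add.
    + have -> : e t ^+ k = (1 * (chi t * e t ^+ k)) * chi t.
        by rewrite mul1r mulrAC -expr2 chi2 mul1r.
      apply: cov_scale => //; apply: semi_mulp => //.
      by rewrite -mpolyC_natE; exact: semi_const.
    + have -> : e t ^+ k = delta t * (chi t * e t ^+ k) * (delta t * chi t).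
        transitivity (delta t ^+ 2 * chi t ^+ 2 * e t ^+ k); last by rewrite !expr2; ring.
        by rewrite delta2 chi2 !mul1r.
      by apply: cov_scale => //; exact: cov_turn.
have := @cpow_combination_neq0 R k.+2 s r sr0.
have h0 := W0 i0; have h1 := W0 i1; rewrite /W !vec3E in h0 h1.
by move/oppr_inj: (etrans h1 (esym (oppr0 _))) => ->; rewrite h0 eqxx.
Qed.

End GradientCase.

(** The constant in [grad (P . x) = c P] decides: if it is nonzero, [P] is a gradient; if it is
    zero, [P . x] vanishes, having positive degree, and [P] is tangent to circles. *)
Lemma axial_classification : rotational_form P D \/ harmonic_form P D.
Proof.
have [c ec] := minimal_grad_dot oM mw; have [c0|c0] := eqVneq c 0; last first.
  by right; exact: harmonic ec.
left; apply: (rotational oM eM e2 mw); have hg := homogen_dot hP (@homogen_pos R 3).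
rewrite addn1 in hg; have z1 : dotv P (@pos R 3) = 0.
  by apply: homogen_mderiv_eq0 hg _ => i; rewrite [LHS]ec c0 mpolyC0 mul0r.
by rewrite -[RHS]z1 /dotv sum3 P2 mul0r addr0 !(mulrC (P _)).
Qed.

Lemma axial_divergence : divergence (fracv P D) = 0.
Proof.
apply/(divergence_fracv _ D0); rewrite (minimal_div0 oM mw) mulr0 /dotv sum3 P2 mulr0 addr0.
case: axial_classification => [[a [c [_ _ _ ->]]]|[k [a [b [c [_ _ _ _ ->]]]]]].
  by rewrite /grad !mderivC !mul0r addr0.
have zk (i : 'I_3) : i != i2 -> mderiv i (pos R i2 ^+ k) = 0.
  by move=> ne; rewrite -[_ ^+ k]mulr1 mderiv_zpow // -mpolyC1 mderivC mulr0.
by rewrite /grad !mderiv_mulC !zk // mulr0 !mul0r addr0.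
Qed.

End Harmonic.

(** * Normal forms of the axial fields *)

Section ReducibleModels.
Variable R : realType.
Implicit Types (P F : 'I_3 -> mpoly 3 R) (D : mpoly 3 R) (L : 'M[R]_3) (a b c r s : R).

Let x : mpoly 3 R := pos R i0.
Let y : mpoly 3 R := pos R i1.
Let z : mpoly 3 R := pos R i2.

(** The equation is [(r + is)^3 = a + ib]; the exponents 3 here and 4 below are the [k + 3] of
    [harmonic_model]. *)
Lemma complex_cube_root a b : exists r s,
  r * (r * r - s * s) - s * (r * s + s * r) = a /\ r * (r * s + s * r) + s * (r * r - s * s) = b.
Proof.
have := rootCK (isT : (0 < 3)%N) (Complex a b).
by case: (_.-root _) => r s [<- <-]; exists r, s; split; rewrite /=; ring.
Qed.

Lemma complex_fourth_root a b : exists r s, let u := r * (r * r - s * s) - s * (r * s + s * r) in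
  let v := r * (r * s + s * r) + s * (r * r - s * s) in r * u - s * v = a /\ r * v + s * u = b.
Proof.
have := rootCK (isT : (0 < 4)%N) (Complex a b).
by case: (_.-root _) => r s [<- <-]; exists r, s; split; rewrite /=; ring.
Qed.

Lemma lin_conj_eq L F E P D : L \in unitmx -> E != 0 -> D != 0 ->
  (forall i, poly_comp L (F i) * D = mulv L P i * poly_comp L E) ->
  lin_conj L (fracv F E) = fracv P D.
Proof.
move=> uL E0 D0 h; have LE0 : poly_comp L E != 0 by rewrite poly_comp_eq0.
rewrite lin_conj_fracv //; apply/(eq_fracv _ _ LE0 D0) => i.
rewrite [LHS]mulrC -mulvZp.
rewrite (@mulv_ext _ _ _ _ (fun j => mulv L (fun k => poly_comp L E * P k) j)); last first.
  by move=> j; rewrite mulrC h mulvZp mulrC.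
by rewrite mulv_mul mulVmx // mulv1 mulrC.
Qed.

Lemma homogen_scaling c d (p : mpoly 3 R) : homogen d p ->
  poly_comp c%:M p = mpolyC 3 (c ^+ d) * p.
Proof.
move/dhomogP => hp; apply/mpolyP => m; rewrite mcoeff_poly_comp_scalar mcoeffCM.
by case: (boolP (m \in msupp p)) => [/hp->//|/memN_msupp_eq0->]; rewrite !mulr0.
Qed.

Lemma scalar_unit c : c != 0 -> (c%:M : 'M[R]_3) \in unitmx.
Proof. by move=> c0; rewrite unitmxE det_scalar unitfE expf_neq0. Qed.

(** In degree 2 conjugation by a scalar is multiplication by it, so nonzero multiples of a field are
    linearly conjugate. *)
Lemma lin_conj_scalar c d P D : c != 0 -> D != 0 -> homogen d D ->
  (forall i, homogen (d + 2)%N (P i)) ->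
  lin_conj c%:M (fracv P D) = fracv (fun i => mpolyC 3 c * P i) D.
Proof.
move=> c0 D0 hD hP; apply: lin_conj_eq; rewrite ?scalar_unit // => i.
rewrite (homogen_scaling _ hD) (homogen_scaling _ (hP i)) mulv_scalar exprD expr2 !mpolyCM; ring.
Qed.

(** Multiplication by [r + is] in the plane, the identity on the axis. *)
Definition planar_mx r s : 'M[R]_3 :=
  \matrix_(i, j) vec3 (vec3 r (- s) 0 j) (vec3 s r 0 j) (vec3 0 0 1 j) i.

Lemma planar_mxE r s i : (planar_mx r s i i0 = vec3 r s 0 i) *
  (planar_mx r s i i1 = vec3 (- s) r 0 i) * (planar_mx r s i i2 = vec3 0 0 1 i).
Proof. by rewrite !mxE; do !split; move: i; apply: forall3. Qed.

Lemma planar_mx_unit r s : (r != 0) || (s != 0) -> planar_mx r s \in unitmx.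
Proof.
move=> rs; rewrite unitmxE unitfE det3 !planar_mxE /vec3 /=.
have -> : r * (r * 1 - 0 * 0) - - s * (s * 1 - 0 * 0) + 0 * (s * 0 - r * 0) = r ^+ 2 + s ^+ 2 by ring.
by rewrite paddr_eq0 ?sqr_ge0 // !sqrf_eq0 negb_and.
Qed.

Definition model_field (i : 'I_3) : 'I_3 -> mpoly 3 R := vec3
  (vec3 (- (z * y)) (z * x) 0)
  (vec3 (cpow R 2).1 (- (cpow R 2).2) 0)
  (vec3 (cpow R 3).1 (- (cpow R 3).2) 0) i.

Definition model_denom (i : 'I_3) : mpoly 3 R := vec3 1 1 z i.

Definition model i := fracv (model_field i) (model_denom i).

Lemma model_denom_neq0 i : model_denom i != 0.
Proof. by move: i; apply: forall3; rewrite /model_denom vec3E ?oner_neq0 ?pos_neq0. Qed.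

(** Put [lambda = r + is]. Substituting [lambda w] into the conjugate of [w^(k+2)] and dividing by
    [lambda] multiplies it by the conjugate of [lambda^(k+3)] over [|lambda|^2]; hence the cube or
    fourth power and the denominator [r * r + s * s]. *)
Lemma harmonic_model k r s : (k <= 1)%N -> (r != 0) || (s != 0) ->
  let u := r * (r * r - s * s) - s * (r * s + s * r) in
  let v := r * (r * s + s * r) + s * (r * r - s * s) in
  let a := if k == 0%N then u else r * u - s * v in
  let b := if k == 0%N then v else r * v + s * u in
  lin_conj (planar_mx r s) (model (if k == 0%N then i1 else i2)) =
  fracv (vec3 (mpolyC 3 a * (cpow R k.+2).1 - mpolyC 3 b * (cpow R k.+2).2)
    (- (mpolyC 3 b * (cpow R k.+2).1 + mpolyC 3 a * (cpow R k.+2).2)) 0)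
   (mpolyC 3 (r * r + s * s) * z ^+ k).
Proof.
move=> k1 rs; have uL := planar_mx_unit rs.
have rs0 : mpolyC 3 (r * r + s * s) != 0 :> mpoly 3 R.
  by rewrite mpolyC_eq0 -!expr2 paddr_eq0 ?sqr_ge0 // !sqrf_eq0 negb_and.
have cx : poly_comp (planar_mx r s) x = mpolyC 3 r * x - mpolyC 3 s * y.
  by rewrite /x /y /pos poly_compX sum3 !planar_mxE /vec3 /= mpolyC0 mpolyCN; ring.
have cy : poly_comp (planar_mx r s) y = mpolyC 3 s * x + mpolyC 3 r * y.
  by rewrite /x /y /pos poly_compX sum3 !planar_mxE /vec3 /= mpolyC0; ring.
have cz : poly_comp (planar_mx r s) z = z.
  by rewrite /z /pos poly_compX sum3 !planar_mxE /vec3 /= mpolyC0 mpolyC1; ring.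
have z0 : z != 0 := pos_neq0 R i2.
case: k k1 => [|[|//]] _ /=.
  apply: lin_conj_eq uL (model_denom_neq0 i1) _ _; first by rewrite mulf_neq0 // expr0 oner_neq0.
  apply: forall3; rewrite /model_denom /model_field !vec3E /mulv !sum3 !planar_mxE /vec3 /= ?rmorphN ?rmorph0 ?rmorph1 -/x -/y;
  rewrite ?(rmorphB, rmorphD, rmorphM, rmorphN, rmorph1, rmorph0) /= ?cx ?cy ?cz expr0; ring.
apply: lin_conj_eq uL (model_denom_neq0 i2) _ _; first by rewrite mulf_neq0 // expr1.
apply: forall3; rewrite /model_denom /model_field !vec3E /mulv !sum3 !planar_mxE /vec3 /= -/x -/y;
rewrite ?(rmorphB, rmorphD, rmorphM, rmorphN, rmorph1, rmorph0) /= ?cx ?cy ?cz expr1; ring.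
Qed.

End ReducibleModels.

Section AxialModel.
Variable R : realType.
Implicit Types (P : 'I_3 -> mpoly 3 R) (D : mpoly 3 R) (a b c r s : R).

Let x : mpoly 3 R := pos R i0.
Let y : mpoly 3 R := pos R i1.
Let z : mpoly 3 R := pos R i2.

Lemma axial_model P D : rotational_form P D \/ harmonic_form P D ->
  exists i L, L \in unitmx /\ fracv P D = lin_conj L (model R i).
Proof.
have z0 : z != 0 := pos_neq0 R i2.
have hx (i : 'I_3) : homogen 1%N (pos R i) := @homogen_pos R 3 i.
case=> [[a [c [a0 c0 eP ->]]]|[k [a [b [c [k1 ab0 c0 eP ->]]]]]].
  exists i0, (a / c)%:M; have u0 : a / c != 0 by rewrite mulf_neq0 ?invr_eq0.
  split; first exact: scalar_unit.
  rewrite /model (@lin_conj_scalar _ _ 0%N) ?model_denom_neq0 //.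
  - apply/eq_fracv; rewrite ?model_denom_neq0 ?mpolyC_eq0 // => i.
    rewrite eP; move: i; apply: forall3; rewrite /model_denom /model_field !vec3E -/x -/y -/z ?mulr0 ?mul0r // mulr1;
    by rewrite -[in LHS](divfK c0 a) mpolyCM; ring.
  - by rewrite /model_denom vec3E -mpolyC1; exact: homogenC.
  - apply: forall3; rewrite /model_field !vec3E ?rpredN; [| |exact: dhomog0].
      by apply: (@dhomogM _ _ _ 1 _ 1); exact: hx.
    by apply: (@dhomogM _ _ _ 1 _ 1); exact: hx.
have [r [s rse]] : exists r s, let u := r * (r * r - s * s) - s * (r * s + s * r) in
  let v := r * (r * s + s * r) + s * (r * r - s * s) in
  (if k == 0%N then u else r * u - s * v) = a /\ (if k == 0%N then v else r * v + s * u) = b.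
  by case: k k1 {eP} => [|k] _ /=; [exact: complex_cube_root|exact: complex_fourth_root].
have rs : (r != 0) || (s != 0).
  apply: contraT; rewrite negb_or !negbK => /andP[/eqP r0 /eqP s0].
  by move: ab0 rse; rewrite r0 s0 /= !mul0r !subr0 !addr0 !if_same => h [a0 b0]; rewrite -a0 -b0 eqxx in h.
have := harmonic_model k1 rs; move: rse => /= [-> ->] hm.
pose rho := r * r + s * s.
have rho0 : rho != 0 by rewrite /rho -!expr2 paddr_eq0 ?sqr_ge0 // !sqrf_eq0 negb_and.
have u0 : rho / c != 0 by rewrite mulf_neq0 ?invr_eq0.
have hk : homogen k (z ^+ k) by have := @homogen_exp R 1 z k (hx i2); rewrite mul1n.
have zk0 (b' : R) : b' != 0 -> mpolyC 3 b' * z ^+ k != 0 by move=> b0; rewrite mulf_neq0 ?mpolyC_eq0 ?expf_neq0.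
have [h1 h2] := homogen_cpow R k.+2.
(* The scalar [rho / c] replaces the factor [rho = |lambda|^2] of the denominator by the prescribed
   [c]. *)
exists (if k == 0%N then i1 else i2), (planar_mx r s *m (rho / c)%:M).
split; first by rewrite unitmx_mul planar_mx_unit ?scalar_unit.
rewrite -lin_conj_mul ?planar_mx_unit ?scalar_unit // hm (@lin_conj_scalar _ _ k) ?zk0 //.
- apply/eq_fracv; rewrite ?zk0 // => i; rewrite eP -/rho.
  have -> : mpolyC 3 rho = mpolyC 3 (rho / c) * mpolyC 3 c :> mpoly 3 R by rewrite -mpolyCM divfK.
  by ring.
- exact: homogen_mulC.
- rewrite addn2; apply: forall3; rewrite vec3E ?rpredN ?rpredB ?rpredD ?homogen_mulC //; exact: dhomog0.
Qed.

End AxialModel.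

(** Reflection in the hyperplane orthogonal to [u - v]. *)
Lemma householder (R : realType) n (u v : 'cV[R]_n) : u^T *m u = 1%:M -> v^T *m v = 1%:M ->
  exists2 H : 'M[R]_n, orthogonal H & H *m u = v.
Proof.
move=> uu vv; have [<-|uv] := eqVneq u v.
  by exists 1%:M; rewrite ?mul1mx // /orthogonal trmx1 mul1mx.
pose w := u - v; pose c := (v^T *m u) 0 0.
have evu : v^T *m u = c%:M by rewrite [LHS]mx11_scalar.
have euv : u^T *m v = c%:M by rewrite -[LHS]trmxK trmx_mul trmxK evu tr_scalar_mx.
have wu : w^T *m u = (1 - c)%:M.
  by rewrite /w linearB /= mulmxBl uu evu -raddfB.
have ww : w^T *m w = (2 * (1 - c))%:M.
  rewrite {2}/w mulmxBr wu /w linearB /= mulmxBl euv vv -!raddfB /=.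
  by congr (_%:M); ring.
have c1 : 1 - c != 0.
  apply: contraNneq uv => c1; move: ww; rewrite c1 mulr0 => /matrixP/(_ 0 0).
  rewrite !mxE mul0rn => /eqP; rewrite psumr_eq0 => [/allP h|i _]; last first.
    by rewrite mxE -expr2 sqr_ge0.
  rewrite -subr_eq0; apply/eqP/matrixP => i j; rewrite ord1 [RHS]mxE; apply/eqP.
  by have := h i (mem_index_enum i); rewrite mxE mulf_eq0 orbb.
pose k := (1 - c)^-1; pose H := 1%:M - k *: (w *m w^T).
have HT : H^T = H by apply/matrixP => i j; rewrite !mxE (eq_sym j); congr (_ - k * _); apply: eq_bigr => l _; rewrite !mxE mulrC.
exists H.
  have HW : (k *: (w *m w^T)) *m (k *: (w *m w^T)) = k *: (w *m w^T) + k *: (w *m w^T).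
    rewrite -scalemxAl -scalemxAr -mulmxA (mulmxA w^T) ww mul_scalar_mx -scalemxAr !scalerA -scalerDl.
    by congr (_ *: _); rewrite /k; field.
  by rewrite /orthogonal HT /H mulmxBl mul1mx mulmxBr mulmx1 HW opprB addrK subrK.
rewrite /H mulmxBl mul1mx -scalemxAl -mulmxA wu mul_mx_scalar scalerA mulVf // scale1r.
by rewrite /w opprB addrC subrK.
Qed.

Lemma lin_conjK (R : realType) n (B : 'M[R]_n) (Q : vfield R n) : B \in unitmx ->
  lin_conj B (lin_conj (invmx B) Q) = Q.
Proof. by move=> uB; rewrite lin_conj_mul ?unitmx_inv // mulVmx // lin_conj1. Qed.

Lemma conj_orthogonal (R : realType) n (H O : 'M[R]_n) : orthogonal H -> orthogonal O ->
  orthogonal (H *m O *m invmx H).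
Proof.
move=> oH oO; rewrite (orthogonal_inv oH) /orthogonal !trmx_mul trmxK.
rewrite !mulmxA -(mulmxA _ H^T H) oH mulmx1 -(mulmxA _ O^T O) oO mulmx1.
exact: orthogonalC.
Qed.

(** An orthogonal change of coordinates moves the common eigenvector to the z axis and keeps the
    family orthogonal; the eigenvalues are then signs. *)
Lemma reducible_classification (R : realType) (T : Type) (M : T -> 'M[R]_3) d P D (v : 'cV[R]_3) :
  min_pair M d P D -> (forall t, orthogonal (M t)) -> v != 0 ->
  (forall t, exists a : R, M t *m v = a *: v) ->
  (exists i L, L \in unitmx /\ fracv P D = lin_conj L (model R i)) /\
  divergence (fracv P D) = 0.
Proof.
move=> mp oM v0 /choice[a ea].
have sq : (v^T *m v) 0 0 = \sum_i v i 0 ^+ 2.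
  by rewrite mxE; apply: eq_bigr => i _; rewrite !mxE.
have s0 : 0 < (v^T *m v) 0 0.
  rewrite sq lt_def sumr_ge0 ?andbT => [|i _]; last exact: sqr_ge0.
  apply: contraNneq v0 => /eqP; rewrite psumr_eq0 => [/allP h|i _]; last exact: sqr_ge0.
  apply/eqP/matrixP => i j; rewrite ord1 mxE; apply/eqP.
  by have := h i (mem_index_enum i); rewrite sqrf_eq0.
set s := (v^T *m v) 0 0 in s0; have es : v^T *m v = s%:M by rewrite [LHS]mx11_scalar.
pose u := (Num.sqrt s)^-1 *: v.
have r0 : Num.sqrt s != 0 by rewrite gt_eqF // sqrtr_gt0.
have uu : u^T *m u = 1%:M.
  have -> : u^T = (Num.sqrt s)^-1 *: v^T by apply/matrixP => i j; rewrite !mxE.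
  rewrite /u -scalemxAl -scalemxAr es scalerA -invfM -expr2 sqr_sqrtr ?ltW //.
  by rewrite scale_scalar_mx mulVf // gt_eqF.
have eu t : M t *m u = a t *: u by rewrite /u -scalemxAr ea !scalerA mulrC.
have a2 t : a t ^+ 2 = 1.
  have : (M t *m u)^T *m (M t *m u) = 1%:M by rewrite trmx_mul -mulmxA (mulmxA (M t)^T) oM mul1mx.
  rewrite eu; have -> : (a t *: u)^T = a t *: u^T by apply/matrixP => i j; rewrite !mxE.
  rewrite -scalemxAl -scalemxAr uu scalerA => /matrixP/(_ 0 0).
  by rewrite !mxE eqxx mulr1.
have zz : (axis_z R)^T *m axis_z R = 1%:M.
  apply/matrixP => i j; rewrite !ord1 mxE sum3 !mxE /=; ring.
have [H oH Hu] := householder uu zz; have uH := orthogonal_unit oH.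
have mp' := min_pair_conj uH mp; have [chi mw] := min_pair_character mp'.
have oM' t : orthogonal (H *m M t *m invmx H) by exact: conj_orthogonal.
have eM' t : H *m M t *m invmx H *m axis_z R = a t *: axis_z R.
  by rewrite -Hu -!mulmxA (mulmxA (invmx H)) mulVmx // mul1mx eu -scalemxAr.
have D0 : D != 0 by case: mp => -[].
have eQ : fracv P D = lin_conj H (fracv (pushv H P) (poly_comp (invmx H) D)).
  by rewrite fracv_push // lin_conjK.
split; last by rewrite eQ; apply: divergence_lin_conj => //; exact: axial_divergence mw.
have [i [L [uL eL]]] := axial_model (axial_classification oM' eM' a2 mw).
exists i, (L *m H); split; first by rewrite unitmx_mul uL.
by rewrite eQ eL lin_conj_mul.
Qed.

(** * Counting rotation axes *)

Definition axis_term N (p : nat * nat) := (N %/ (p.1 * p.2) * p.2.-1)%N.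

(** A pair records a conjugacy class of axis stabilisers: [p.2] is their order, [p.1] their index in
    the normaliser. The class has [N / (p.1 p.2)] members with [p.2 - 1] nontrivial elements each,
    which is [axis_term]. *)
Definition axis_type N (p : nat * nat) :=
  [&& (0 < p.1)%N, (p.1 <= 2)%N, (1 < p.2)%N & (p.1 * p.2 %| N)%N].

Lemma axis_termP N p : axis_type N p -> (0 < N)%N -> exists k, [/\ (0 < k)%N, N = (k * (p.1 * p.2))%N,
  axis_term N p = (k * p.2.-1)%N & p.1 = 1%N \/ p.1 = 2].
Proof.
move=> /and4P[a0 a2 n1 /dvdnP[k eN]] N0; exists k; split=> //.
- by move: N0; rewrite eN; case: (k).
- by rewrite /axis_term eN mulnK // muln_gt0 a0 (ltn_trans _ n1).
- by move: a0 a2; case: p.1 => [|[|[|]]] //; [left|right].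
Qed.

(** Each class accounts for at least a quarter of [N], so at most three classes fit into the [N - 1]
    nontrivial elements. *)
Lemma axis_term_ge N p : axis_type N p -> (0 < N)%N -> (N <= 4 * axis_term N p)%N.
Proof.
move=> tp N0; have /and4P[_ _ n1 _] := tp; have [k [k0 eN -> a12]] := axis_termP tp N0.
case: p n1 eN a12 {tp} => a n /= n1 eN a12; rewrite {1}eN.
by case: a12 => ->; nia.
Qed.

(* The finite rotation groups: cyclic and dihedral groups fix a line, the tetrahedral and
   octahedral groups have a triple of lines, the remaining solution is icosahedral. *)
Lemma orbit_numerics N (ps : seq (nat * nat)) : (1 < N)%N -> all (axis_type N) ps ->
  (\sum_(p <- ps) axis_term N p = N.-1)%N ->
  [\/ exists2 p, p \in ps & N = (p.1 * p.2)%N,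
      (N <= 24)%N /\ (exists2 p, p \in ps & N = (3 * (p.1 * p.2))%N) |
      N = 60 /\ perm_eq ps [:: (2, 2); (2, 3); (2, 5)]].
Proof.
move=> N1; have N0 : (0 < N)%N by exact: ltn_trans N1.
(* Sorting by the order of the stabilisers avoids permuted copies of the same case. *)
pose r (p p' : nat * nat) := (p.2 <= p'.2)%N.
have pe : perm_eq (sort r ps) ps by exact/permPl/perm_sort.
rewrite -(perm_all _ pe) -(perm_big _ pe) /= => tps eS.
have srt : sorted r (sort r ps) by apply: sort_sorted => p p'; exact: leq_total.
suff : [\/ exists2 p, p \in sort r ps & N = (p.1 * p.2)%N,
      (N <= 24)%N /\ (exists2 p, p \in sort r ps & N = (3 * (p.1 * p.2))%N) |
      N = 60 /\ sort r ps = [:: (2, 2); (2, 3); (2, 5)]].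
  case=> [[p hp e]|[le [p hp e]]|[e1 e2]].
  - by apply: Or31; exists p; rewrite // -(perm_mem pe).
  - by apply: Or32; split=> //; exists p; rewrite // -(perm_mem pe).
  - by apply: Or33; split=> //; rewrite -e2 perm_sym.
move: (sort r ps) tps eS srt => {pe} s tps eS srt.
case: s tps eS srt => [|p1 s]; first by rewrite big_nil; lia.
rewrite /= big_cons => /andP[t1]; have [k1 [k10 e1 -> a1]] := axis_termP t1 N0.
have /and4P[_ _ n1 _] := t1; have g1 := axis_term_ge t1 N0.
have mulp k n : (1 < n)%N -> (k * n.-1)%N = (k * n - k)%N by case: n => // n _; rewrite mulnS addKn.
(* The products [k * n] are nonlinear; the cases [n = 2], [n = 3] and [n > 3] replace them by linear
   values or bounds. *)
have low k n : (1 < n)%N -> [\/ n = 2 /\ (k * n = 2 * k)%N, n = 3 /\ (k * n = 3 * k)%N |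
    (3 < n)%N /\ (4 * k <= k * n)%N].
  case: n => [|[|[|[|n]]]] // _; [apply: Or31|apply: Or32|apply: Or33]; split=> //; try exact: mulnC.
  by rewrite mulnC leq_mul2l orbT.
case: p1 a1 n1 e1 t1 g1 => a1 n1 /= ha1 hn1 e1 t1 g1.
have l1 := low k1 n1 hn1; rewrite (mulp k1 n1 hn1); rewrite mulnCA in e1.
case: s => [|p2 s].
  rewrite big_nil addn0 => _ eS _; apply: Or31; exists (a1, n1) => /=; first exact: mem_head.
  rewrite e1; congr (_ * _)%N; move: e1 l1 eS {t1 g1}; set X := (k1 * n1)%N => e1 l1 eS.
  suff k1E : k1 = 1%N by rewrite /X k1E mul1n.
  by case: ha1 e1 => -> e1; case: l1 => [[_ h]|[_ h]|[_ h]]; lia.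
rewrite /= big_cons => /andP[t2]; have [k2 [k20 e2 -> ha2]] := axis_termP t2 N0.
have /and4P[_ _ hn2 _] := t2; have g2 := axis_term_ge t2 N0.
case: p2 ha2 hn2 e2 t2 g2 => a2 n2 /= ha2 hn2 e2 t2 g2.
have l2 := low k2 n2 hn2; rewrite (mulp k2 n2 hn2); rewrite mulnCA in e2.
case: s => [|p3 s].
  rewrite big_nil addn0 => _ eS /andP[le12 _]; rewrite /r /= in le12.
  case: ha1 e1 g1 t1 => -> e1 _ _; case: ha2 e2 g2 t2 => -> e2 _ _.
  - by case: l1 => [[_ h]|[_ h]|[_ h]]; case: l2 => [[_ h']|[_ h']|[_ h']]; lia.
  - case: l1 => [[en h]|[en h]|[en h]].
    + have k2E : k2 = 1%N by lia.
      by apply: Or31; exists (2, n2); rewrite ?inE ?eqxx ?orbT //= e2 k2E mul1n.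
    + by case: l2 => [[en' h']|[_ h']|[_ h']]; lia.
    + by case: l2 => [[en' h']|[_ h']|[_ h']]; lia.
  - case: l2 => [[en h]|[en h]|[en h]].
    + have k1E : k1 = 1%N by lia.
      by apply: Or31; exists (2, n1); rewrite ?mem_head //= e1 k1E mul1n.
    (* The tetrahedral group, [N = 12]: three reversible half-turn axes and four threefold axes that
       are not reversible. *)
    + case: l1 => [[en' h']|[_ h']|[_ h']]; [|lia|lia].
      by apply: Or32; split; [lia|exists (2, n1); rewrite ?mem_head //= en'; lia].
    + by case: l1 => [[_ h']|[_ h']|[_ h']]; lia.
  - by case: l1 => [[_ h]|[_ h]|[_ h]]; case: l2 => [[_ h']|[_ h']|[_ h']]; lia.
rewrite /= big_cons => /andP[t3]; have [k3 [k30 e3 e3' ha3]] := axis_termP t3 N0.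
have /and4P[_ _ hn3 _] := t3; have g3 := axis_term_ge t3 N0.
case: p3 ha3 hn3 e3 e3' t3 g3 => a3 n3 /= ha3 hn3 e3 e3' t3 g3.
have l3 := low k3 n3 hn3; rewrite e3' (mulp k3 n3 hn3); rewrite mulnCA in e3.
have g1' : (N <= 4 * (k1 * n1 - k1))%N.
  by case: ha1 e1 => -> e1; case: l1 => [[_ h]|[_ h]|[_ h]]; lia.
have g2' : (N <= 4 * (k2 * n2 - k2))%N.
  by case: ha2 e2 => -> e2; case: l2 => [[_ h]|[_ h]|[_ h]]; lia.
have g3' : (N <= 4 * (k3 * n3 - k3))%N.
  by case: ha3 e3 => -> e3; case: l3 => [[_ h]|[_ h]|[_ h]]; lia.
case: s => [|p4 s]; last first.
  (* A fourth class would bring the total to at least [N]. *)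
  rewrite /= big_cons => /andP[t4 _] eS; have g4 := axis_term_ge t4 N0.
  by move: (axis_term N p4) (\sum_(j <- s) axis_term N j)%N g4 eS => u v g4 eS; lia.
rewrite big_nil addn0 => _ eS /and3P[le12 le23 _]; rewrite /r /= in le12 le23.
have ha1' : a1 = 2.
  by case: ha1 e1 => // ea e1; rewrite ea in e1; case: l1 => [[_ h]|[_ h]|[_ h]]; lia.
have ha2' : a2 = 2.
  by case: ha2 e2 => // ea e2; rewrite ea in e2; case: l2 => [[_ h]|[_ h]|[_ h]]; lia.
have ha3' : a3 = 2.
  by case: ha3 e3 => // ea e3; rewrite ea in e3; case: l3 => [[_ h]|[_ h]|[_ h]]; lia.
clear t1 t2 t3 g1 g2 g3 g1' g2' g3' ha1 ha2 ha3.
rewrite ha1' in e1 *; rewrite ha2' in e2 *; rewrite ha3' in e3 *.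
case: l1 => [[en1 h1]|[en1 h1]|[en1 h1]]; last 2 first.
- by case: l2 => [[en2 h2]|[en2 h2]|[en2 h2]]; case: l3 => [[en3 h3]|[en3 h3]|[en3 h3]]; lia.
- by case: l2 => [[en2 h2]|[en2 h2]|[en2 h2]]; case: l3 => [[en3 h3]|[en3 h3]|[en3 h3]]; lia.
case: l2 => [[en2 h2]|[en2 h2]|[en2 h2]]; last first.
- by case: l3 => [[en3 h3]|[en3 h3]|[en3 h3]]; lia.
(* Orders [2, 3, n3], all of index 2: the count reads [N / 12 = k3 - 1] while [N / 2 = k3 * n3], so
   [n3 < 6], and the values 3, 4, 5 give [N = 12, 24, 60]. *)
- have k3E : (6 * (k3 - 1) = k3 * n3)%N by lia.
  have n35 : (n3 <= 5)%N by nia.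
  have [n33|[n34|n35']] : n3 = 3 \/ n3 = 4 \/ n3 = 5 by lia.
  + by apply: Or32; split; [lia|exists (2, n1); rewrite ?mem_head //= en1; lia].
  + by apply: Or32; split; [lia|exists (2, n3); rewrite ?inE ?eqxx ?orbT //= n34; lia].
  + by apply: Or33; split; [lia|rewrite en1 en2 n35'].
have k3E : k3 = 1%N by lia.
by apply: Or31; exists (2, n3); rewrite ?inE ?eqxx ?orbT //= e3 k3E mul1n.
Qed.

(** * Groups partitioned by axis subgroups *)

Section AxisCount.
Import GroupScope.
Variables (gT : finGroupType) (S : {set {group gT}}).
Hypothesis S_nontrivial : forall A, A \in S -> (1 < #|A|)%N.
Hypothesis S_cover : forall g : gT, g != 1 -> exists2 A, A \in S & g \in A.
Hypothesis S_disjoint : forall A B (g : gT), A \in S -> B \in S -> g != 1 -> g \in A -> g \in B -> A = B.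
Hypothesis S_conj : forall A (x : gT), A \in S -> (A :^ x)%G \in S.
Hypothesis S_norm : forall A : {group gT}, A \in S -> #|'N(A)| = #|A| \/ #|'N(A)| = (2 * #|A|)%N.

Let G := [set: gT].
Let orb (A : {group gT}) := orbit 'JG G A.
Let rep (W : {set {group gT}}) : {group gT} := odflt 1%G [pick A in W].
Let ty (W : {set {group gT}}) : nat * nat := (#|'N(rep W)| %/ #|rep W|, #|rep W|)%N.

Lemma orbit_repE A : A \in S -> exists x, rep (orb A) = (A :^ x)%G.
Proof.
move=> AS; rewrite /rep; case: pickP => [B|/(_ A)]; last by rewrite orbit_refl.
by case/orbitP => x _ <-; exists x.
Qed.

Lemma orbit_tyE A : A \in S -> ty (orb A) = (#|'N(A)| %/ #|A|, #|A|)%N.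
Proof.
by move=> AS; rewrite /ty; have [x ->] := orbit_repE AS; rewrite /= normJ !cardJg.
Qed.

Lemma orbit_card A : (#|orb A| * #|'N(A)|)%N = #|gT|.
Proof.
rewrite /orb -[RHS]cardsT card_orbit astab1JG setTI mulnC Lagrange //; exact: subsetT.
Qed.

Lemma orbit_sub A : A \in S -> orb A \subset S.
Proof.
by move=> AS; apply/subsetP => B /orbitP[x _ <-]; exact: S_conj.
Qed.

Lemma axis_sum : (\sum_(A in S) #|A|.-1 = #|gT|.-1)%N.
Proof.
have c1 : (\sum_(g : gT | g != 1%g) 1 = #|gT|.-1)%N.
  rewrite sum1_card -cardsT (cardsD1 1%g [set: gT]) in_setT /=.
  by apply: eq_card => g; rewrite !inE andbT.
rewrite -c1 (eq_bigr (fun A : {group gT} => \sum_(g | (g != 1%g) && (g \in A)) 1)%N); last first.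
  move=> A _; rewrite sum1_card (cardsD1 1%g A) group1 /=.
  by apply: eq_card => g; rewrite !inE.
rewrite (exchange_big_dep (fun g => g != 1%g)) /=; last by move=> A g _ h; case/andP: h.
apply: eq_bigr => g g1; have [A AS gA] := S_cover g1.
rewrite (bigD1 A) /= ?AS ?g1 //= big1 ?addn0 // => B /andP[/andP[BS gB] BA].
by case/eqP: BA; exact: S_disjoint gB gA.
Qed.

Let ps := [seq ty W | W <- enum [set orb A | A in S]].

Lemma axis_types : all (axis_type #|gT|) ps.
Proof.
apply/allP => p /mapP[W]; rewrite mem_enum => /imsetP[A AS ->] ->; rewrite orbit_tyE //.
have A0 := cardG_gt0 A; have eN := orbit_card A.
rewrite /axis_type /= S_nontrivial //=.
case: (S_norm AS) => e; rewrite e ?divnn ?mulnK ?A0 //= -eN e.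
  by rewrite mul1n dvdn_mull.
by rewrite dvdn_mull.
Qed.

Lemma axis_term_sum : (\sum_(p <- ps) axis_term #|gT| p = #|gT|.-1)%N.
Proof.
rewrite -axis_sum big_map big_enum /= [RHS](partition_big orb (fun W => W \in [set orb A | A in S])) /=; last first.
  by move=> A AS; exact: imset_f.
apply: eq_bigr => W /imsetP[A AS ->]; rewrite orbit_tyE // /axis_term /=.
have A0 := cardG_gt0 A; have eN := orbit_card A.
have N0 : (0 < #|'N(A)|)%N by exact: cardG_gt0.
have -> : (#|'N(A)| %/ #|A| * #|A|)%N = #|'N(A)| by rewrite divnK // cardSg // normG.
rewrite -eN mulnK // -sum_nat_const; apply: eq_big => B.
  apply/idP/andP => [BA|[BS /eqP <-]]; last exact: orbit_refl.
  split; first exact: (subsetP (orbit_sub AS)).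
  by rewrite eq_sym; apply/eqP/orbit_eqP; rewrite orbit_sym.
by case/orbitP => x _ <-; rewrite /= cardJg.
Qed.

(** In the last case a nontrivial sign would be negative on 30 elements. Each of them lies in an
    axis group of even order, hence of order 2, and there are 15 such groups with one nontrivial
    element each. This avoids identifying the group of order 60. *)
Lemma axis_count : (1 < #|gT|)%N ->
  [\/ exists2 A, A \in S & 'N(A) = [set: gT],
      (#|gT| <= 24)%N /\ (exists2 A, A \in S & #|orb A| = 3) |
      #|gT| = 60 /\ [/\ exists2 A, A \in S & #|A| = 5 /\ #|orb A| = 6,
        exists2 A, A \in S & #|A| = 2 /\ #|orb A| = 15 &
        forall psi : gT -> bool, (forall x y, psi (x * y) = psi x (+) psi y) -> forall x, psi x = false]].
Proof.
move=> N1; have psA p : p \in ps -> exists2 A, A \in S & p.2 = #|A| /\ (p.1 * p.2)%N = #|'N(A)|.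
  case/mapP => W; rewrite mem_enum => /imsetP[A AS ->] ->; exists A => //.
  by rewrite orbit_tyE //=; split=> //; apply: divnK; apply: cardSg; exact: normG.
case: (orbit_numerics N1 axis_types axis_term_sum) => [[p /psA[A AS [_ e]] eN]|[le [p /psA[A AS [_ e]] eN]]|[eN pe]].
- apply: Or31; exists A => //; apply/eqP; rewrite eqEcard subsetT cardsT eN e leqnn.
  by [].
- apply: Or32; split=> //; exists A => //; apply/eqP.
  by rewrite -(eqn_pmul2r (cardG_gt0 'N(A))) orbit_card eN e.
apply: Or33; split=> //.
have get n : (2, n) \in ps -> exists2 A, A \in S & #|A| = n /\ (#|orb A| * (2 * n))%N = 60.
  by case/psA => A AS [/= e1 e2]; exists A => //; rewrite e2 orbit_card.
have m n : ((2, n) \in ps) = (n \in [:: 2; 3; 5]).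
  by rewrite (perm_mem pe) !inE !xpair_eqE !eqxx.
split.
- have [|A AS [e1 e2]] := get 5; first by rewrite m.
  by exists A => //; split=> //; lia.
- have [|A AS [e1 e2]] := get 2; first by rewrite m.
  by exists A => //; split=> //; lia.
move=> psi psiM; have psi1 : psi 1 = false.
  by have := psiM 1 1; rewrite mulg1; case: (psi 1).
have psiX x k : psi (x ^+ k) = (odd k && psi x).
  by elim: k => [|k IH]; rewrite ?expg0 // expgS psiM IH /=; case: (psi x); case: (odd k).
have [|A AS [A2 oA]] := get 2; first by rewrite m.
have {}oA : #|orb A| = 15 by lia.
have cardA B : B \in S -> [|| #|B| == 2, #|B| == 3 | #|B| == 5]%N.
  move=> BS; have : ty (orb B) \in ps by apply: map_f; rewrite mem_enum; exact: imset_f.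
  rewrite orbit_tyE // (perm_mem pe) !inE !xpair_eqE.
  by do ?case/orP; case/andP => _ ->; rewrite ?orbT.
have same B : B \in S -> #|B| = 2 -> B \in orb A.
  (* The list of types has a single entry of order 2, so all axis groups of order 2 are
     conjugate. *)
  move=> BS B2; pose X := [set W in [set orb A | A in S] | (ty W).2 == 2%N].
  have X1 : #|X| = 1%N.
    rewrite -sum1_card (eq_bigl (fun W => (W \in [set orb A | A in S]) && ((ty W).2 == 2%N))); last by move=> W; rewrite inE.
    rewrite -big_enum_cond -(big_map ty (fun p => p.2 == 2%N) (fun=> 1%N)) /= -/ps (perm_big _ pe).
    by rewrite !big_cons big_nil.
  have inX C : C \in S -> #|C| = 2 -> orb C \in X.
    by move=> CS C2; rewrite inE imset_f // orbit_tyE //= C2.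
  have /cards1P[W eX] : #|X| == 1%N by rewrite X1.
  have := inX _ AS A2; have := inX _ BS B2; rewrite eX !inE => /eqP eB /eqP eA.
  by rewrite eA -eB; exact: orbit_refl.
move=> x; apply/negbTE/negP => px.
pose X := [set g | psi g].
have X30 : (#|X| + #|X| = 60)%N.
  transitivity #|gT|; last exact: eN.
  rewrite -cardsT -(cardsID X [set: gT]) setTI; congr (_ + _)%N.
  rewrite -(card_imset X (mulgI x)); apply: eq_card => g; rewrite !inE andbT.
  apply/imsetP/idP => [[h]|pg]; first by rewrite inE => ph ->; rewrite psiM px ph.
  exists (x^-1 * g); last by rewrite mulKVg.
  have : psi (x * (x^-1 * g)) = psi x (+) psi (x^-1 * g) by exact: psiM.
  by rewrite inE mulKVg px (negbTE pg) /=; case: (psi (_ * _)).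
have : (#|X| <= #|orb A|)%N.
  pose f (g : gT) : {group gT} := odflt 1%G [pick B in S | g \in B].
  have fP g : g \in X -> [/\ f g \in S, g \in f g & g != 1].
    rewrite inE => pg; have g1 : g != 1 by apply: contraTneq pg => ->; rewrite psi1.
    rewrite /f; case: pickP => [B /andP[]//|no]; have [B BS gB] := S_cover g1.
    by have := no B; rewrite BS gB.
  have f2 g : g \in X -> #|f g| = 2.
    move=> gX; have [fS gf g1] := fP g gX; move: gX; rewrite inE => pg.
    have odd_no : odd #|f g| -> False.
      move=> od; have e1 : g ^+ #|f g| = 1.
        have /dvdnP[k ->] : (#[g] %| #|f g|)%N by apply: cardSg; rewrite cycle_subG.
        by rewrite mulnC expgM expg_order expg1n.
      by have := psiX g #|f g|; rewrite e1 psi1 od pg.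
    by case/or3P: (cardA _ fS) => /eqP e //; case: odd_no; rewrite e.
  have finj : {in X &, injective f}.
    move=> g h gX hX e; have [fS gf g1] := fP g gX; have [_ hf h1] := fP h hX.
    have eg : #|f g| = 2 := f2 g gX.
    have sub : [set 1; g] = f g :> {set gT}.
      apply/eqP; rewrite eqEcard cards2 eq_sym g1 eg leqnn andbT.
      by apply/subsetP => k; rewrite !inE => /orP[]/eqP->; rewrite ?group1.
    by move: hf; rewrite -e -[_ \in f g]/(_ \in (f g : {set gT})) -sub !inE (negbTE h1) => /eqP.
  rewrite -(card_in_imset finj); apply: subset_leq_card; apply/subsetP => B /imsetP[g gX ->].
  by have [fS _ _] := fP g gX; apply: same => //; exact: f2.
by rewrite oA; lia.
Qed.

End AxisCount.

(** * Rotations, their axes and stabilisers *)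

Section RotationAxes.
Variable R : realType.
Implicit Types (A : 'M[R]_3) (u v w : 'cV[R]_3).

Definition unit_vec v := v^T *m v = 1%:M.

Definition col3 (f : 'I_3 -> R) : 'cV[R]_3 := \col_i f i.

Lemma unit_vecE v : unit_vec v <-> v i0 0 * v i0 0 + v i1 0 * v i1 0 + v i2 0 * v i2 0 = 1.
Proof.
have e : (v^T *m v) 0 0 = v i0 0 * v i0 0 + v i1 0 * v i1 0 + v i2 0 * v i2 0.
  by rewrite mxE sum3 !mxE.
rewrite -e /unit_vec; split=> [->|h]; first by rewrite mxE eqxx.
by rewrite [LHS]mx11_scalar h.
Qed.

Lemma unit_vec_neq0 v : unit_vec v -> v != 0.
Proof.
move/unit_vecE; apply: contra_eq_neq => ->; rewrite !mxE mulr0 !addr0 eq_sym.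
exact: oner_neq0.
Qed.

Lemma orthogonal_unit_vec A v : orthogonal A -> unit_vec v -> unit_vec (A *m v).
Proof. by move=> oA uv; rewrite /unit_vec trmx_mul -mulmxA (mulmxA A^T) oA mul1mx. Qed.

Lemma normalize v : v != 0 -> exists2 a : R, a != 0 & unit_vec (a *: v).
Proof.
move=> v0; pose s := v i0 0 ^+ 2 + v i1 0 ^+ 2 + v i2 0 ^+ 2.
have s0 : 0 < s.
  rewrite lt_def !addr_ge0 ?sqr_ge0 // andbT; apply: contraNneq v0 => /eqP.
  rewrite !paddr_eq0 ?addr_ge0 ?sqr_ge0 // !sqrf_eq0 => /andP[/andP[/eqP h0 /eqP h1] /eqP h2].
  by apply/eqP/matrixP => i j; rewrite ord1 [RHS]mxE; move: i; apply: forall3.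
have r0 : Num.sqrt s != 0 by rewrite gt_eqF // sqrtr_gt0.
exists (Num.sqrt s)^-1; first by rewrite invr_eq0.
apply/unit_vecE; rewrite !mxE; transitivity ((Num.sqrt s)^-1 ^+ 2 * s); first by rewrite /s; ring.
by rewrite exprVn sqr_sqrtr ?ltW // mulVf // gt_eqF.
Qed.

(** Since [A - 1 = - A (A - 1)^T], in odd dimension the determinant of [A - 1] equals its own
    opposite. *)
Lemma rotation_axis A : orthogonal A -> \det A = 1 -> exists2 v, unit_vec v & A *m v = v.
Proof.
move=> oA dA; have d0 : \det (A - 1%:M) = 0.
  have e : A - 1%:M = - (A *m (A - 1%:M)^T).
    by rewrite linearB /= trmx1 mulmxBr mulmx1 orthogonalC // opprB.
  have : \det (A - 1%:M) = - \det (A - 1%:M).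
    by rewrite {1}e -scaleN1r detZ det_mulmx dA det_tr mul1r !exprS expr0; ring.
  by move/eqP; rewrite -addr_eq0 -mulr2n mulrn_eq0 /= => /eqP.
have /det0P[r r0 er] : \det (A - 1%:M)^T == 0 by rewrite det_tr d0.
have rt0 : r^T != 0 by rewrite trmx_eq0.
have [a a0 ua] := normalize rt0; exists (a *: r^T) => //.
have : (r *m (A - 1%:M)^T)^T = 0 by rewrite er trmx0.
rewrite trmx_mul trmxK mulmxBl mul1mx => /eqP; rewrite subr_eq0 => /eqP h.
by rewrite -scalemxAr h.
Qed.

Lemma cross_mulmx A v w i : orthogonal A ->
  cross (fun i => (A *m v) i 0) (fun i => (A *m w) i 0) i =
  \det A * (A *m col3 (cross (fun i => v i 0) (fun i => w i 0))) i 0.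
Proof.
move=> oA; pose c := cross (fun i => v i 0) (fun i => w i 0).
transitivity (\sum_j cofactor A i j * c j).
  by move: i; apply: forall3; rewrite sum3 !cofactor3 /c /cross /vec3 /= !mxE !sum3; ring.
rewrite mxE mulr_sumr; apply: eq_bigr => j _.
by rewrite cofactor_orthogonal // mulrA mxE.
Qed.

(** Two independent fixed vectors and their cross product, fixed as well, would form a basis. So the
    cross product has norm zero and the inner product of the unit vectors is 1 or -1. *)
Lemma axis_unique A v w : orthogonal A -> \det A = 1 -> A != 1%:M -> unit_vec v -> unit_vec w ->
  A *m v = v -> A *m w = w -> w = v \/ w = - v.
Proof.
move=> oA dA A1 /unit_vecE uv /unit_vecE uw ev ew.
pose c := cross (fun i => v i 0) (fun i => w i 0).
have ec : A *m col3 c = col3 c.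
  apply/matrixP => i j; rewrite ord1 -[LHS]mul1r -dA -cross_mulmx // ev ew mxE.
  by [].
pose s := c i0 * c i0 + c i1 * c i1 + c i2 * c i2.
have s0 : s = 0.
  apply/eqP; apply: contraT => s0; case/eqP: A1.
  pose B := \matrix_(i, j) vec3 (v i 0) (w i 0) (c i) j.
  have AB : A *m B = B.
    apply/matrixP => i j; move: j; apply: forall3.
    - by move/matrixP/(_ i 0): ev; rewrite !mxE => <-; apply: eq_bigr => k _; rewrite !mxE vec3E.
    - by move/matrixP/(_ i 0): ew; rewrite !mxE => <-; apply: eq_bigr => k _; rewrite !mxE vec3E.
    - by move/matrixP/(_ i 0): ec; rewrite !mxE vec3E => <-; apply: eq_bigr => k _; rewrite !mxE vec3E.
  have uB : B \in unitmx.
    by rewrite unitmxE unitfE (_ : \det B = s) // det3 !mxE /s /c /cross /vec3 /=; ring.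
  by rewrite -[LHS]mulmx1 -(mulmxV uB) mulmxA AB.
pose t := v i0 0 * w i0 0 + v i1 0 * w i1 0 + v i2 0 * w i2 0.
have t2 : t ^+ 2 = 1.
  have : s = (v i0 0 * v i0 0 + v i1 0 * v i1 0 + v i2 0 * v i2 0) * (w i0 0 * w i0 0 + w i1 0 * w i1 0 + w i2 0 * w i2 0) - t ^+ 2.
    by rewrite /s /c /cross /vec3 /t /=; ring.
  by rewrite uv uw s0 mulr1 => /esym/eqP; rewrite subr_eq0 => /eqP.
have eq0 (a : R) : a = t -> w = a *: v.
  move=> ea; have h : (w i0 0 - a * v i0 0) ^+ 2 + (w i1 0 - a * v i1 0) ^+ 2 + (w i2 0 - a * v i2 0) ^+ 2 = 0.
    transitivity ((w i0 0 * w i0 0 + w i1 0 * w i1 0 + w i2 0 * w i2 0) - 2 * a * t + a ^+ 2 * (v i0 0 * v i0 0 + v i1 0 * v i1 0 + v i2 0 * v i2 0)).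
      by rewrite /t; ring.
    by rewrite uv uw ea t2 -mulrA -expr2 t2; ring.
  move/eqP: h; rewrite !paddr_eq0 ?addr_ge0 ?sqr_ge0 // !sqrf_eq0 !subr_eq0.
  case/andP => /andP[/eqP h0 /eqP h1] /eqP h2.
  by apply/matrixP => i j; rewrite ord1 [RHS]mxE; move: i; apply: forall3.
by case: (pm1 t2) => et; [left; rewrite (eq0 1) ?scale1r|right; rewrite (eq0 (-1)) ?scaleN1r].
Qed.

End RotationAxes.

Section AxisSubgroups.
Variables (R : realType) (gT : finGroupType) (sigma : gT -> 'M[R]_3).
Hypothesis sigma1 : sigma 1%g = 1%:M.
Hypothesis sigmaM : forall x y, sigma (x * y)%g = sigma x *m sigma y.
Hypothesis sigma_inj : injective sigma.
Hypothesis sigma_orth : forall x, orthogonal (sigma x).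
Hypothesis sigma_det : forall x, \det (sigma x) = 1.

Lemma sigmaV x : sigma x^-1%g *m sigma x = 1%:M.
Proof. by rewrite -sigmaM mulVg sigma1. Qed.

Lemma sigma_neq1 x : x != 1%g -> sigma x != 1%:M.
Proof. by apply: contraNneq => e; apply/eqP/sigma_inj; rewrite e sigma1. Qed.

(** The vector itself must be fixed; rotations reversing the line lie in the normaliser, which is
    where the index 2 comes from. *)
Definition line_stab (v : 'cV[R]_3) : {set gT} := [set h | sigma h *m v == v].

Lemma line_stab_group v : group_set (line_stab v).
Proof.
apply/group_setP; split=> [|x y]; first by rewrite inE sigma1 mul1mx.
by rewrite !inE sigmaM -mulmxA => /eqP ex /eqP ->; rewrite ex.
Qed.

Canonical line_stabG v := Group (line_stab_group v).

Lemma line_stabN v : line_stab (- v) = line_stab v.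
Proof. by apply/setP => x; rewrite !inE mulmxN eqr_opp. Qed.

Lemma line_stabJ v x : line_stab (sigma x^-1%g *m v) = (line_stab v :^ x)%g.
Proof.
apply/setP => h; rewrite mem_conjg !inE conjgE invgK !sigmaM -!mulmxA.
apply/eqP/eqP => [->|e]; first by rewrite mulmxA -sigmaM mulgV sigma1 mul1mx.
have := congr1 (mulmx (sigma x^-1%g)) e; rewrite !mulmxA sigmaV mul1mx -!mulmxA => h'.
by rewrite -[RHS]h'.
Qed.

(** [S] collects the stabilisers of the rotation axes, and [axv] picks one of the two unit vectors
    on each, hence the signs. As [A :^ x] is [x^-1 A x], [sigma x] sends the axis of [A] to that of
    [A :^ x^-1]. *)
Lemma axis_system : exists (S : {set {group gT}}) (axv : {group gT} -> 'cV[R]_3),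
  [/\ forall A, A \in S -> (1 < #|A|)%N,
      forall g : gT, g != 1%g -> exists2 A, A \in S & g \in A,
      forall A B (g : gT), A \in S -> B \in S -> g != 1%g -> g \in A -> g \in B -> A = B,
      forall A (x : gT), A \in S -> (A :^ x)%G \in S &
      [/\ forall A : {group gT}, A \in S -> #|'N(A)%g| = #|A| \/ #|'N(A)%g| = (2 * #|A|)%N,
      forall A, A \in S -> unit_vec (axv A) /\ forall h, (h \in A) = (sigma h *m axv A == axv A),
      forall A x, A \in S -> sigma x *m axv A = axv (A :^ x^-1%g)%G \/ sigma x *m axv A = - axv (A :^ x^-1%g)%G &
      forall A B, A \in S -> B \in S -> axv A = axv B \/ axv A = - axv B -> A = B]].
Proof.
have /choice[ax axP] : forall g, exists v, g != 1%g -> unit_vec v /\ sigma g *m v = v.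
  move=> g; have [v uv ev] := rotation_axis (sigma_orth g) (sigma_det g).
  by exists v.
pose S := [set line_stabG (ax g) | g in [set~ 1%g]].
have /choice[ge geP] : forall A, exists g, A \in S -> g != 1%g /\ A = line_stabG (ax g).
  move=> A; have [/imsetP[g]|no] := boolP (A \in S); last by exists 1%g.
  by rewrite !inE => g1 ->; exists g.
pose axv A := ax (ge A).
have inS g : g != 1%g -> line_stabG (ax g) \in S by move=> g1; apply: imset_f; rewrite !inE.
have uniq_ax g v w : g != 1%g -> unit_vec v -> unit_vec w -> sigma g *m v = v -> sigma g *m w = w ->
    w = v \/ w = - v.
  by move=> g1; apply: axis_unique => //; exact: sigma_neq1.
have eqS v w : (w = v \/ w = - v) -> line_stabG w = line_stabG v.
  by move=> h; apply/val_inj; case: h => -> //=; rewrite line_stabN.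
have unitv A : A \in S -> unit_vec (axv A) by move=> /geP[g1 _]; case: (axP _ g1).
have eA A : A \in S -> A = line_stabG (axv A) by case/geP.
have memA A h : A \in S -> (h \in A) = (sigma h *m axv A == axv A).
  by move=> AS; rewrite {1}(eA _ AS) inE.
have stabS v g : g != 1%g -> unit_vec v -> sigma g *m v = v -> line_stabG v \in S.
  by move=> g1 uv ev; have [ua ea] := axP g g1; rewrite (eqS _ _ (uniq_ax _ _ _ g1 ua uv ea ev)); exact: inS.
have conjS A x : A \in S -> (A :^ x)%G = line_stabG (sigma x^-1%g *m axv A).
  by move=> AS; apply/val_inj; rewrite /= line_stabJ {1}(eA _ AS).
have dis A B (g : gT) : A \in S -> B \in S -> g != 1%g -> g \in A -> g \in B -> A = B.
  move=> AS BS g1; rewrite !memA // => /eqP ea /eqP eb.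
  rewrite (eA _ AS) (eA _ BS); apply: eqS.
  exact: uniq_ax g1 (unitv _ BS) (unitv _ AS) eb ea.
have nontriv A : A \in S -> exists2 g, g != 1%g & g \in A.
  by move=> AS; have [g1 e] := geP _ AS; exists (ge A) => //; rewrite memA // (proj2 (axP _ g1)).
have conjIn A x : A \in S -> (A :^ x)%G \in S.
  move=> AS; have [g g1 gA] := nontriv A AS; rewrite conjS //.
  apply: (@stabS _ (g ^ x)%g).
  - by rewrite conjg_eq1.
  - exact: orthogonal_unit_vec (unitv _ AS).
  - rewrite conjgE !sigmaM -!mulmxA (mulmxA (sigma x)) -sigmaM mulgV sigma1 mul1mx.
    by move: gA; rewrite memA // => /eqP->.
have move_ax A x : A \in S -> sigma x *m axv A = axv (A :^ x^-1%g)%G \/ sigma x *m axv A = - axv (A :^ x^-1%g)%G.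
  move=> AS; have A'S := conjIn A x^-1%g AS; have [g g1 gA] := nontriv _ A'S.
  apply: (uniq_ax g) => //; first exact: unitv.
  - exact: orthogonal_unit_vec (unitv _ AS).
  - by apply/eqP; rewrite -memA.
  - by apply/eqP; move: gA; rewrite {1}conjS // invgK inE.
exists S, axv; split=> //.
- move=> A AS; have [g g1 gA] := nontriv A AS; rewrite (cardD1 1%g) group1 (cardD1 g) !inE g1 gA.
  by [].
- move=> g g1; exists (line_stabG (ax g)); first exact: inS.
  by rewrite inE (proj2 (axP _ g1)).
split=> //; last first.
- by move=> A B AS BS h; rewrite (eA _ AS) (eA _ BS); exact: eqS.
- by move=> A AS; split; [exact: unitv|move=> h; exact: memA].
move=> A AS; have nA x : x \in 'N(A)%g -> sigma x *m axv A = axv A \/ sigma x *m axv A = - axv A.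
  move=> nx; have e : (A :^ x^-1%g)%G = A by apply/val_inj/normP; rewrite groupV.
  by have := move_ax A x AS; rewrite e.
have sub : A \subset 'N(A)%g := normG A.
(* If some [y] in the normaliser reverses the axis, the elements doing so form the coset [y A];
   otherwise the normaliser is [A]. *)
have [[y yN ey]|no] := pselect (exists2 y, y \in 'N(A)%g & sigma y *m axv A = - axv A); last first.
  left; apply/eqP; rewrite eqn_leq (subset_leq_card sub) andbT; apply: subset_leq_card.
  apply/subsetP => x xN; rewrite memA //; apply/eqP.
  by case: (nA x xN) => // e; case: no; exists x.
have v0 : axv A != - axv A.
  by rewrite -addr_eq0 -mulr2n -scaler_nat scaler_eq0 pnatr_eq0 /=; exact: unit_vec_neq0 (unitv _ AS).
right; rewrite mul2n -addnn -(cardsID A 'N(A)%g) (setIidPr sub); congr (_ + _)%N.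
rewrite -(card_lcoset A y); apply: eq_card => x; rewrite mem_lcoset in_setD (memA _ x AS) (memA _ (y^-1 * x)%g AS) sigmaM -mulmxA.
have yv : sigma y^-1%g *m axv A = - axv A.
  by rewrite -[axv A in LHS]opprK -ey mulmxN mulmxA sigmaV mul1mx.
apply/andP/eqP => [[/eqP nx xN]|ex].
  by case: (nA x xN) => // ->; rewrite mulmxN yv opprK.
have xv : sigma x *m axv A = - axv A.
  have := congr1 (mulmx (sigma y)) ex.
  by rewrite mulmxA -sigmaM mulgV sigma1 mul1mx ey.
split; first by rewrite xv eq_sym.
have -> : x = (y * (y^-1 * x))%g by rewrite mulKVg.
by rewrite groupM // (subsetP sub) // memA // sigmaM -mulmxA ex.
Qed.

End AxisSubgroups.

(** * Linear forms *)

Section LinearForms.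
Variables (R : realType) (n : nat).
Implicit Types (v w : 'cV[R]_n) (L : 'M[R]_n).

Definition linform v : mpoly n R := dotv (constv v) (@pos R n).

Lemma linformE v : linform v = \sum_i mpolyC n (v i 0) * pos R i.
Proof. by []. Qed.

Lemma homogen_linform v : homogen 1%N (linform v).
Proof. by apply: (@homogen_dot _ _ 0 1) => i; [exact: homogenC|exact: homogen_pos]. Qed.

Lemma linform_comp L v : poly_comp L (linform v) = linform (L^T *m v).
Proof.
rewrite /linform /dotv rmorph_sum /=.
under eq_bigr => i _ do rewrite rmorphM /= poly_compC /pos poly_compX mulr_sumr.
rewrite exchange_big /=; apply: eq_bigr => j _; rewrite /constv mxE rmorph_sum mulr_suml.
by apply: eq_bigr => i _; rewrite !mxE mulrA -rmorphM mulrC (mulrC (v i 0)) mulrC.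
Qed.

Lemma linformN v : linform (- v) = - linform v.
Proof. by rewrite !linformE -sumrN; apply: eq_bigr => i _; rewrite mxE mpolyCN mulNr. Qed.

Lemma mderiv_linform v i : mderiv i (linform v) = mpolyC n (v i 0).
Proof.
rewrite linformE raddf_sum /= (bigD1 i) //= big1 ?addr0 => [|j ji].
  by rewrite mderiv_mulC mderiv_var eqxx mulr1.
by rewrite mderiv_mulC mderiv_var eq_sym (negPf ji) mulr0.
Qed.

Lemma linform_eq0 v : (linform v == 0) = (v == 0).
Proof.
apply/eqP/eqP => [e|->]; last first.
  by rewrite linformE big1 // => i _; rewrite mxE mpolyC0 mul0r.
apply/matrixP => i j; rewrite ord1 mxE; apply/eqP.
by rewrite -(mpolyC_eq0 n) -mderiv_linform e raddf0.
Qed.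

Lemma homogen1_linform (p : mpoly n R) : homogen 1%N p -> exists v, p = linform v.
Proof.
move=> hp; have hd i : homogen 0%N (mderiv i p) by exact: (@homogen_mderiv _ _ 1).
have /fin_all_exists[f ef] : forall i, exists c : R, mderiv i p = mpolyC n c.
  by move=> i; exact: homogen0_const.
exists (\col_i f i); have := euler_grad hp; rewrite mpolyC1 mul1r => <-.
by rewrite dotvC; apply: eq_bigr => i _; rewrite /grad ef /constv mxE.
Qed.

Lemma meval_linform v (x : 'cV[R]_n) : meval (x ^~ 0) (linform v) = \sum_i v i 0 * x i 0.
Proof.
rewrite linformE raddf_sum; apply: eq_bigr => i _.
by rewrite /= rmorphM /= mevalC /pos mevalXU.
Qed.

End LinearForms.

(** * Groups without a common eigenvector *)

Section Irreducible.
Variables (R : realType) (T : finGroupType) (M : T -> 'M[R]_3).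
Hypothesis M1 : M 1%g = 1%:M.
Hypothesis MM : forall x y, M (x * y)%g = M x *m M y.
Hypothesis M_inj : injective M.
Hypothesis oM : forall t, orthogonal (M t).
Hypothesis noeig : forall v : 'cV[R]_3, v != 0 -> ~ (forall t, exists a : R, M t *m v = a *: v).
Variables (d : nat) (P : 'I_3 -> mpoly 3 R) (D : mpoly 3 R) (chi : T -> R).
Hypothesis mw : minimal_with M d P D chi.

Let q := sqnorm R.

Definition rotation_part t : 'M[R]_3 := \det (M t) *: M t.

Lemma rep_neq_opp t : M t != - 1%:M.
Proof.
apply/negP => /eqP e; have [i Pi] := mw_field0 mw.
have eM : M t = (-1)%:M by rewrite e raddfN.
have := mw_denom mw t; have := mw_field mw t i.
rewrite eM /semi (homogen_scaling _ (mw_field_homog mw i)) (homogen_scaling _ (mw_denom_homog mw)).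
rewrite mulv_scalar mulrA -mpolyCM => /(mulIf Pi)/eqP; rewrite mpolyC_eq => /eqP e1.
move/(mulIf (mw_denom0 mw))/eqP; rewrite mpolyC_eq => /eqP e2.
move: e1; rewrite -e2 exprD sqrrN expr1n mulr1 mulrN mulr1 => /eqP.
by rewrite -addr_eq0 -mulr2n mulrn_eq0 /= expf_eq0 oppr_eq0 oner_eq0 andbF.
Qed.

Lemma det_rep_sqr t : \det (M t) ^+ 2 = 1.
Proof. exact: det_orthogonal_sqr. Qed.

Lemma rotation_part1 : rotation_part 1%g = 1%:M.
Proof. by rewrite /rotation_part M1 det1 scale1r. Qed.

Lemma rotation_partM x y : rotation_part (x * y)%g = rotation_part x *m rotation_part y.
Proof. by rewrite /rotation_part MM det_mulmx -scalemxAl -scalemxAr scalerA. Qed.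

Lemma rotation_part_orth t : orthogonal (rotation_part t).
Proof.
rewrite /orthogonal /rotation_part (_ : (_ *: M t)^T = \det (M t) *: (M t)^T); last first.
  by apply/matrixP => i j; rewrite !mxE.
by rewrite -scalemxAl -scalemxAr scalerA oM -expr2 det_rep_sqr scale1r.
Qed.

Lemma rotation_part_det t : \det (rotation_part t) = 1.
Proof. by rewrite /rotation_part detZ -exprSr (exprM _ 2 2) det_rep_sqr expr1n. Qed.

(** An element of the kernel acts as 1 or -1, and -1 is excluded by [rep_neq_opp]. *)
Lemma rotation_part_inj : injective rotation_part.
Proof.
move=> x y e; have ez : rotation_part (x * y^-1)%g = 1%:M.
  by rewrite rotation_partM e -rotation_partM mulgV rotation_part1.
have : M (x * y^-1)%g = \det (M (x * y^-1)%g) *: 1%:M.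
  by rewrite -ez /rotation_part scalerA -expr2 det_rep_sqr scale1r.
case: (pm1 (det_rep_sqr (x * y^-1)%g)) => ->; rewrite ?scale1r ?scaleN1r => h.
  by apply/eqP; rewrite eq_mulgV1; apply/eqP/M_inj; rewrite h M1.
by have := rep_neq_opp (x * y^-1)%g; rewrite h eqxx.
Qed.

Lemma rep_card_gt1 : (1 < #|T|)%N.
Proof.
rewrite ltnNge; apply/negP => le; have v0 : axis_z R != 0.
  by apply: contraTneq isT => /matrixP/(_ i2 0); rewrite !mxE /= => /eqP; rewrite oner_eq0.
apply: (noeig v0) => t; exists 1; rewrite scale1r (_ : t = 1%g) ?M1 ?mul1mx //.
by have /fintype_le1P/(_ 1%g) := le; apply.
Qed.

(** A linear denominator is the form of a vector that every group element preserves up to sign. *)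
Lemma degree_neq1 : d <> 1%N.
Proof.
move=> d1; have hD := mw_denom_homog mw; rewrite d1 in hD.
have [v eD] := homogen1_linform hD.
have v0 : v != 0 by have := mw_denom0 mw; rewrite eD linform_eq0.
apply: (noeig v0) => t; exists (chi t).
have := mw_denom mw t; rewrite eD /semi linform_comp => e.
have {}e : (M t)^T *m v = chi t *: v.
  apply/eqP; rewrite -subr_eq0 -linform_eq0; apply/eqP.
  have lin (a : R) u w : linform (u - a *: w) = linform u - mpolyC 3 a * linform w :> mpoly 3 R.
    rewrite !linformE mulr_sumr -sumrB; apply: eq_bigr => i _.
    by rewrite !mxE mpolyCB mpolyCM; ring.
  by rewrite lin e subrr.
have := congr1 (mulmx (M t)) e; rewrite mulmxA (orthogonalC (oM t)) mul1mx -scalemxAr => e'.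
by rewrite {2}e' scalerA -expr2 (mw_sqr mw) scale1r.
Qed.

Lemma divergence_degree0 : d = 0%N -> divergence (fracv P D) = 0.
Proof.
move=> d0; have [b eb] : exists b : R, D = mpolyC 3 b.
  by apply: homogen0_const; have := mw_denom_homog mw; rewrite d0.
apply/(divergence_fracv _ (mw_denom0 mw)); rewrite (minimal_div0 oM mw) mulr0.
by rewrite eb /dotv big1 // => i _; rewrite /grad mderivC mul0r.
Qed.

(* The competing field is the cross product of x and grad h, which is tangent to spheres and
   divergence-free. *)
Lemma tangential_pair k h : homogen (2 * k.+1)%N h -> (forall t, semi (M t) 1 h) ->
  (forall t, \det (M t) = 1) ->
  ~ (exists c : R, h = mpolyC 3 c * q ^+ k.+1) -> (2 * k <= d)%N ->
  d = (2 * k)%N /\ divergence (fracv P D) = 0.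
Proof.
move=> hh sh dM nr le; pose V := cross (@pos R 3) (grad h).
have q0 : q ^+ k != 0 by rewrite expf_neq0 // sqnorm_neq0.
have h0 : h != 0 by apply: contra_notN nr => /eqP->; exists 0; rewrite mpolyC0 mul0r.
(* If the cross product vanished, [h] would be invariant under infinitesimal rotations, hence
   radial. *)
have V0 : exists i, V i != 0.
  apply: contrapT => no; have z i : V i = 0 by apply: contrapT => hi; apply: no; exists i; apply/eqP.
  have inv : forall i j, pos R j * mderiv i h = pos R i * mderiv j h.
    have := z i0; have := z i1; have := z i2; rewrite /V !crossE /grad.
    move=> /eqP; rewrite subr_eq0 => /eqP e2 /eqP; rewrite subr_eq0 => /eqP e1 /eqP; rewrite subr_eq0 => /eqP e0.
    by apply: forall3; apply: forall3; rewrite ?e0 ?e1 ?e2.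
  have [hz|[c [m [eh em]]]] := radial_power hh inv; first by rewrite hz eqxx in h0.
  by apply: nr; exists c; rewrite eh; congr (_ * _ ^+ _); move: em => /eqP; rewrite eqn_pmul2l // => /eqP.
have hV i : homogen (2 * k + 2)%N (V i).
  have -> : (2 * k + 2 = 1 + (2 * k.+1).-1)%N by rewrite mulnS; lia.
  by apply: homogen_cross => j; [exact: homogen_pos|exact: homogen_mderiv].
have one2 (t : T) : (1 : R) ^+ 2 = 1 by rewrite expr1n.
have [ed [c c0 ec]] : (2 * k)%N = d /\ exists2 c : R, c != 0 & forall i, D * V i = mpolyC 3 c * q ^+ k * P i.
  apply: (minimal_other mw le q0 V0 _ hV one2).
  - exact/homogen_exp/homogen_sqnorm.
  - by move=> t; exact: semi_sqnorm_pow.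
  - move=> t; have -> : 1 = \det (M t) * (1 * 1) :> R by rewrite dM !mul1r.
    by apply: cov_cross => //; [exact: cov_pos|exact: semi_grad].
split=> //; have D0 := mw_denom0 mw.
have eQ : fracv P D = fracv (fun i => mpolyC 3 c^-1 * V i) (q ^+ k).
  apply/(eq_fracv _ _ D0 q0) => i; rewrite -mulrA (mulrC (V i)) ec !mulrA -mpolyCM mulVf // mpolyC1.
  by rewrite mul1r mulrC.
rewrite eQ; apply/(divergence_fracv _ q0); rewrite divv_scale.
have -> : dotv (grad (mpolyC 3 c^-1)) V = 0.
  by rewrite /dotv big1 // => i _; rewrite /grad mderivC mul0r.
have -> : divv V = 0.
  rewrite /divv sum3 /V !crossE !mderivB !mderivM !mderiv_pos /grad /=.
  rewrite (mderiv_comm i0 i2) (mderiv_comm i0 i1) (mderiv_comm i1 i2); ring.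
rewrite mulr0 addr0 mulr0; apply/esym; rewrite dotvC dotv_scale.
(* The gradient of a power of [q] is radial, hence orthogonal to [V]. *)
have gq m i : grad (q ^+ m) i = (m%:R * 2 * q ^+ m.-1) * pos R i.
  elim: m => [|m IH]; first by rewrite expr0 /grad -mpolyC1 mderivC; ring.
  rewrite exprS /grad mderivM mderiv_sqnorm -[mderiv i (q ^+ m)]/(grad (q ^+ m) i) IH.
  by case: m {IH} => [|m]; rewrite /= ?exprS -?natr1; ring.
rewrite /dotv sum3 !gq /V !crossE; ring.
Qed.

End Irreducible.

Section CrossVectors.
Variable R : realType.
Implicit Types (u v w y : 'cV[R]_3).

Definition dot3 v w : R := v i0 0 * w i0 0 + v i1 0 * w i1 0 + v i2 0 * w i2 0.

Definition crossc v w : 'cV[R]_3 := col3 (cross (fun i => v i 0) (fun i => w i 0)).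

Lemma crosscE v w : (crossc v w i0 0 = v i1 0 * w i2 0 - v i2 0 * w i1 0) *
  (crossc v w i1 0 = v i2 0 * w i0 0 - v i0 0 * w i2 0) *
  (crossc v w i2 0 = v i0 0 * w i1 0 - v i1 0 * w i0 0).
Proof. by rewrite !mxE. Qed.

Lemma dot3Z (a : R) v w : dot3 (a *: v) w = a * dot3 v w.
Proof. by rewrite /dot3 !mxE; ring. Qed.

Lemma dot3_eq0 v : dot3 v v = 0 -> v = 0.
Proof.
rewrite /dot3 -!expr2 => /eqP; rewrite !paddr_eq0 ?addr_ge0 ?sqr_ge0 // !sqrf_eq0.
case/andP => /andP[/eqP h0 /eqP h1] /eqP h2.
by apply/matrixP => i j; rewrite ord1 [RHS]mxE; move: i; apply: forall3.
Qed.

Lemma unit_dot3 v : unit_vec v -> dot3 v v = 1.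
Proof. by move/unit_vecE. Qed.

(** Lagrange's identity gives the inner product square 1. *)
Lemma unit_collinear v w : unit_vec v -> unit_vec w -> crossc v w = 0 -> w = v \/ w = - v.
Proof.
move=> uv uw c0; pose t := dot3 v w.
have t2 : t ^+ 2 = 1.
  transitivity (dot3 v v * dot3 w w - dot3 (crossc v w) (crossc v w)).
    by rewrite /t /dot3 !crosscE; ring.
  by rewrite (unit_dot3 uv) (unit_dot3 uw) c0 /dot3 !mxE; ring.
have eq0 (a : R) : a = t -> w = a *: v.
  move=> ea; apply/eqP; rewrite -subr_eq0; apply/eqP/dot3_eq0.
  transitivity (dot3 w w - 2 * a * t + a ^+ 2 * dot3 v v); first by rewrite /dot3 !mxE /t /dot3; ring.
  by rewrite (unit_dot3 uv) (unit_dot3 uw) ea mulr1 -mulrA -expr2 t2; ring.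
by case: (pm1 t2) => et; [left; rewrite (eq0 1) ?scale1r|right; rewrite (eq0 (-1)) ?scaleN1r].
Qed.

Lemma orthogonal_to_both v w y : crossc v w != 0 -> dot3 v y = 0 -> dot3 w y = 0 ->
  exists a : R, y = a *: crossc v w.
Proof.
set c := crossc v w => c0 vy wy; have cc : dot3 c c != 0 by apply: contraNneq c0 => /dot3_eq0 ->.
exists (dot3 c y / dot3 c c).
have h i : dot3 c c * y i 0 = dot3 c y * c i 0 + (dot3 v y * crossc w c i 0 - dot3 w y * crossc v c i 0).
  by move: i; apply: forall3; rewrite /c /dot3 !crosscE; ring.
apply/matrixP => i j; rewrite ord1 [RHS]mxE; apply: (mulfI cc); rewrite h vy wy !mul0r subrr addr0.
by rewrite [RHS]mulrA (mulrC (dot3 c c)) divfK.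
Qed.

Lemma dot3_orthogonal (A : 'M[R]_3) v w : orthogonal A -> dot3 (A *m v) (A *m w) = dot3 v w.
Proof.
have e (u u' : 'cV[R]_3) : dot3 u u' = (u^T *m u') 0 0 by rewrite mxE sum3 /dot3 !mxE.
by move=> oA; rewrite !e trmx_mul -mulmxA (mulmxA A^T) oA mul1mx.
Qed.

End CrossVectors.

(** * Three lines permuted transitively *)

Section ThreeLines.
Variables (R : realType) (T : finGroupType) (M : T -> 'M[R]_3).
Hypothesis M1 : M 1%g = 1%:M.
Hypothesis MM : forall x y, M (x * y)%g = M x *m M y.
Hypothesis oM : forall t, orthogonal (M t).
Hypothesis noeig : forall v : 'cV[R]_3, v != 0 -> ~ (forall t, exists a : R, M t *m v = a *: v).
Variables (d : nat) (P : 'I_3 -> mpoly 3 R) (D : mpoly 3 R) (chi : T -> R).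
Hypothesis mw : minimal_with M d P D chi.
Variables (v : 'I_3 -> 'cV[R]_3) (prm : T -> 'I_3 -> 'I_3) (eps : T -> 'I_3 -> R).
Hypothesis uv : forall i, unit_vec (v i).
Hypothesis v_distinct : forall i j, v i = v j \/ v i = - v j -> i = j.
Hypothesis Mv : forall t i, M t *m v i = eps t i *: v (prm t i).
Hypothesis eps2 : forall t i, eps t i ^+ 2 = 1.
Hypothesis trans : forall i j, exists t, prm t i = j.

Let q := sqnorm R.

Let MV t : M t^-1%g *m M t = 1%:M.
Proof. by rewrite -MM mulVg M1. Qed.

Let MVr t : M t *m M t^-1%g = 1%:M.
Proof. by rewrite -MM mulgV M1. Qed.

Lemma prm_inj t : injective (prm t).
Proof.
move=> i j e; apply: v_distinct.
have h k : v k = eps t k *: (M t^-1%g *m v (prm t k)).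
  by rewrite scalemxAr -Mv mulmxA MV mul1mx.
rewrite (h i) (h j) e; case: (pm1 (eps2 t i)) => ->; case: (pm1 (eps2 t j)) => ->;
  rewrite ?scale1r ?scaleN1r ?opprK; [by left|by right|by right|by left].
Qed.

Definition frame : 'M[R]_3 := \matrix_(i, j) v j i 0.

(** If the lines were coplanar, the normal of their plane would be mapped to multiples of itself by
    the whole group: a common eigenvector. *)
Lemma frame_unit : frame \in unitmx.
Proof.
rewrite unitmxE unitfE; apply/negP => /det0P[r r0 er].
have rv j : dot3 (v j) r^T = 0.
  by move/matrixP/(_ 0 j): er; rewrite !mxE sum3 /dot3 !mxE => <-; ring.
have c0 : crossc (v i0) (v i1) != 0.
  apply/eqP => c0; have := @v_distinct i0 i1; case: (unit_collinear (uv i0) (uv i1) c0) => ->.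
    by move=> h; have := h (or_introl erefl).
  by rewrite opprK => h; have := h (or_intror erefl).
have rt0 : r^T != 0 by rewrite trmx_eq0.
have [b eb] := orthogonal_to_both c0 (rv i0) (rv i1).
have b0 : b != 0 by apply: contraNneq rt0 => b0; rewrite eb b0 scale0r.
apply: (noeig rt0) => t.
have perp j : dot3 (v j) (M t *m r^T) = 0.
  have -> : v j = M t *m (M t^-1%g *m v j) by rewrite mulmxA MVr mul1mx.
  by rewrite dot3_orthogonal // Mv dot3Z rv mulr0.
have [a ea] := orthogonal_to_both c0 (perp i0) (perp i1).
by exists (a / b); rewrite ea eb scalerA divfK.
Qed.

Lemma frame_ext (A B : 'M[R]_3) : (forall i, A *m v i = B *m v i) -> A = B.
Proof.
move=> h; have : A *m frame = B *m frame.
  apply/matrixP => i j; move/matrixP/(_ i 0): (h j); rewrite !mxE => e.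
  transitivity (\sum_k A i k * v j k 0); first by apply: eq_bigr => k _; rewrite mxE.
  by rewrite e; apply: eq_bigr => k _; rewrite mxE.
move/(congr1 (mulmx^~ (invmx frame))).
by rewrite -!mulmxA mulmxV ?frame_unit // !mulmx1.
Qed.

Let not_opp t : (forall i, M t *m v i = - v i) -> False.
Proof.
move=> h; have := rep_neq_opp mw t; rewrite (@frame_ext (M t) (- 1%:M)) ?eqxx // => i.
by rewrite mulNmx mul1mx.
Qed.

(** Transitivity conjugates such an element to one for each of the three lines, and their product is
    -1, which is excluded. *)
Lemma no_reflection t i : M t *m v i = - v i -> (forall j, j != i -> M t *m v j = v j) -> False.
Proof.
move=> ti tj; have /fin_all_exists[k ek] : forall j, exists k, prm k i = j := trans i.
pose r j := (k j * t * (k j)^-1)%g.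
have kV j : M (k j)^-1%g *m v j = eps (k j) i *: v i.
  have := Mv (k j) i; rewrite ek => /(congr1 (mulmx (M (k j)^-1%g))).
  rewrite mulmxA MV mul1mx -scalemxAr => e.
  by rewrite e scalerA -expr2 eps2 scale1r.
have rj j : M (r j) *m v j = - v j.
  rewrite /r !MM -!mulmxA kV -!scalemxAr ti mulmxN scalerN -[v i]scale1r -(eps2 (k j) i) expr2 -scalerA -kV.
  by rewrite -scalemxAr scalerA -expr2 eps2 scale1r mulmxA MVr mul1mx.
have rl j l : l != j -> M (r j) *m v l = v l.
  move=> lj; rewrite /r !MM -!mulmxA Mv -!scalemxAr tj.
    by rewrite scalemxAr -Mv mulmxA MVr mul1mx.
  have e : prm (k j)^-1%g j = i.
    apply: v_distinct; have := kV j; rewrite Mv.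
    case: (pm1 (eps2 (k j)^-1%g j)) => ->; case: (pm1 (eps2 (k j) i)) => ->;
      rewrite ?scale1r ?scaleN1r => e; [by left|by right|by right; rewrite -e opprK|by left; apply: oppr_inj].
  by rewrite -[i in _ != i]e (inj_eq (@prm_inj _)).
move: r rj rl => r rj rl.
apply: (@not_opp (r i0 * r i1 * r i2)%g); apply: forall3; rewrite !MM -!mulmxA.
- by rewrite (rl i2) // (rl i1) // rj.
- by rewrite (rl i2) // rj mulmxN (rl i0).
- by rewrite rj !mulmxN (rl i1) // (rl i0).
Qed.

(** Taken at [t^-1], this is the character of the product of the three linear forms. *)
Definition sgn_prod t := eps t i0 * eps t i1 * eps t i2.

Let ord3_cases (i : 'I_3) : [\/ i = i0, i = i1 | i = i2].
Proof. by move: i; apply: forall3; [apply: Or31|apply: Or32|apply: Or33]. Qed.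

Lemma det_frame t : \det (M t) = \det (\matrix_(a, b) (eps t b *+ (a == prm t b))).
Proof.
set N := \matrix_(a, b) _; have e : M t *m frame = frame *m N.
  apply/matrixP => i j; move/matrixP/(_ i 0): (Mv t j); rewrite !mxE => e.
  transitivity (\sum_k M t i k * v j k 0); first by apply: eq_bigr => k _; rewrite mxE.
  rewrite e (bigD1 (prm t j)) //= big1 ?addr0 => [|k kj]; last by rewrite !mxE (negPf kj) mulr0n mulr0.
  by rewrite !mxE eqxx mulr1n mulrC.
have := congr1 determinant e; rewrite !det_mulmx mulrC => /mulfI; apply.
by have := frame_unit; rewrite unitmxE unitfE.
Qed.

Let prm_cases t : [\/ (forall i, prm t i = i), (forall i, prm t (prm t (prm t i)) = i /\ i != prm t i /\ i != prm t (prm t i)) |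
  \det (M t) = - sgn_prod t].
Proof.
have inj (i j : 'I_3) : i != j -> prm t i != prm t j by rewrite (inj_eq (@prm_inj t)).
have := inj i0 i1 isT; have := inj i0 i2 isT; have := inj i1 i2 isT.
case: (ord3_cases (prm t i0)) => e0; case: (ord3_cases (prm t i1)) => e1; case: (ord3_cases (prm t i2)) => e2;
  rewrite e0 e1 e2 // => _ _ _.
- by apply: Or31; apply: forall3.
- by apply: Or33; rewrite det_frame det3 !mxE e0 e1 e2 /= /sgn_prod; ring.
- by apply: Or33; rewrite det_frame det3 !mxE e0 e1 e2 /= /sgn_prod; ring.
- by apply: Or32; apply: forall3; rewrite ?(e0, e1, e2).
- by apply: Or32; apply: forall3; rewrite ?(e0, e1, e2).
- by apply: Or33; rewrite det_frame det3 !mxE e0 e1 e2 /= /sgn_prod; ring.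
Qed.

(** By type of permutation: a transposition has determinant opposite to the sign product; the cube
    of a 3-cycle acts on every line by the sign product, so it would be -1; an element preserving
    each line has one or three signs -1, and both are excluded. *)
Lemma not_both_odd t : sgn_prod t = -1 -> \det (M t) = -1 -> False.
Proof.
move=> st dt; have sE i j k : [/\ i != j, i != k & j != k] -> eps t i * eps t j * eps t k = -1.
  rewrite -st /sgn_prod; case: (ord3_cases i) => ->; case: (ord3_cases j) => ->; case: (ord3_cases k) => ->; case=> // _ _ _; ring.
case: (prm_cases t) => [pid|pc|]; last by rewrite dt st; lra.
- have Ei i : M t *m v i = eps t i *: v i by rewrite Mv pid.
  have E1 i : eps t i = 1 -> M t *m v i = v i by move=> e; rewrite Ei e scale1r.
  have EN i : eps t i = -1 -> M t *m v i = - v i by move=> e; rewrite Ei e scaleN1r.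
  move: st; rewrite /sgn_prod; case: (pm1 (eps2 t i0)) => h0; case: (pm1 (eps2 t i1)) => h1; case: (pm1 (eps2 t i2)) => h2;
    rewrite h0 h1 h2 => st; try by lra.
  + by apply: (@no_reflection t i2); [exact: EN|apply: forall3 => // _; exact: E1].
  + by apply: (@no_reflection t i1); [exact: EN|apply: forall3 => // _; exact: E1].
  + by apply: (@no_reflection t i0); [exact: EN|apply: forall3 => // _; exact: E1].
  + by apply: (@not_opp t); apply: forall3; exact: EN.
- apply: (@not_opp (t * t * t)%g) => i; have [e3 [n1 n2]] := pc i.
  rewrite !MM -!mulmxA Mv -!scalemxAr Mv -!scalemxAr Mv !scalerA e3 sE ?scaleN1r //.
  by rewrite (inj_eq (@prm_inj t)).
Qed.

Let lin i : mpoly 3 R := linform (v i).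

Let lin_comp t i : poly_comp (M t) (lin i) = mpolyC 3 (eps t^-1%g i) * lin (prm t^-1%g i).
Proof.
rewrite /lin linform_comp (_ : (M t)^T = M t^-1%g).
  rewrite Mv !linformE mulr_sumr; apply: eq_bigr => k _.
  by rewrite mxE mpolyCM mulrA.
by rewrite -[LHS]mulmx1 -(MVr t) mulmxA oM mul1mx.
Qed.

Let f0 := lin i0 * lin i1 * lin i2.

Let f0_neq0 : f0 != 0.
Proof. by rewrite !mulf_neq0 // linform_eq0 unit_vec_neq0. Qed.

Let semi_f0 t : semi (M t) (sgn_prod t^-1%g) f0.
Proof.
have -> : f0 = \prod_i lin i by rewrite prod3.
rewrite /semi rmorph_prod /=; under eq_bigr => i _ do rewrite lin_comp.
rewrite big_split /= -rmorph_prod prod3; congr (_ * _).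
by rewrite [RHS](reindex_inj (@prm_inj t^-1%g)).
Qed.

Let sgn2 t : sgn_prod t ^+ 2 = 1.
Proof. by rewrite /sgn_prod !exprMn !eps2 !mulr1. Qed.

Let det2' t : \det (M t) ^+ 2 = 1.
Proof. exact: det_orthogonal_sqr. Qed.

(** A group is not the union of two proper subgroups: elements violating the two alternatives have a
    product violating [not_both_odd]. *)
Lemma sgn_or_det : (forall t, sgn_prod t^-1%g = 1) \/ (forall t, \det (M t) = 1).
Proof.
have detV t : \det (M t^-1%g) = \det (M t).
  have := congr1 determinant (MVr t); rewrite det_mulmx det1.
  by case: (pm1 (det2' t)) => ->; lra.
have no t : sgn_prod t^-1%g = -1 -> \det (M t) = -1 -> False.
  by move=> h1; rewrite -detV => h2; exact: not_both_odd h1 h2.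
have sM x y : sgn_prod (x * y)^-1%g = sgn_prod x^-1%g * sgn_prod y^-1%g.
  apply: (semi_unique f0_neq0 (semi_f0 (x * y)%g)).
  by rewrite MM; apply: semi_mul.
apply: contrapT => /not_orP[/existsNP[a sa] /existsNP[b db]].
case: (pm1 (sgn2 a^-1%g)) => // {}sa; case: (pm1 (det2' b)) => // {}db.
have da : \det (M a) = 1 by case: (pm1 (det2' a)) => // h; case: (no a sa h).
have sb : sgn_prod b^-1%g = 1 by case: (pm1 (sgn2 b^-1%g)) => // h; case: (no b h db).
apply: (no (a * b)%g); first by rewrite sM sa sb; ring.
by rewrite MM det_mulmx da db; ring.
Qed.

Let power_sum m := \sum_i lin i ^+ (2 * m).

Let semi_power_sum m t : semi (M t) 1 (power_sum m).
Proof.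
rewrite /semi mpolyC1 mul1r /power_sum rmorph_sum [RHS](reindex_inj (@prm_inj t^-1%g)) /=.
apply: eq_bigr => i _; rewrite rmorphXn /= lin_comp exprMn -rmorphXn /=.
have -> : eps t^-1%g i ^+ (2 * m) = 1 by rewrite exprM eps2 expr1n.
by rewrite mpolyC1 mul1r.
Qed.

Let homogen_power_sum m : homogen (2 * m)%N (power_sum m).
Proof.
apply: rpred_sum => i _; have := @homogen_exp R 1 (lin i) (2 * m) (homogen_linform (v i)).
by rewrite mul1n.
Qed.

(* On the frame dual to the three lines the power sums are sums of even powers of coordinates. *)
Let not_both_radial : ~ ((exists c : R, power_sum 1 = mpolyC 3 c * q ^+ 1) /\
  (exists c : R, power_sum 2 = mpolyC 3 c * q ^+ 2)).
Proof.
case=> [[a ea] [b eb]]; have uF : frame^T \in unitmx by rewrite unitmx_tr frame_unit.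
pose pt (y : 'cV[R]_3) := invmx frame^T *m y.
have evl y i : meval ((pt y) ^~ 0) (lin i) = y i 0.
  rewrite meval_linform -[y in RHS](mulKVmx uF) mxE; apply: eq_bigr => k _.
  by rewrite !mxE.
pose Q y := meval ((pt y) ^~ 0) q.
have h1 (y : 'cV[R]_3) : y i0 0 ^+ 2 + y i1 0 ^+ 2 + y i2 0 ^+ 2 = a * Q y.
  have := congr1 (meval ((pt y) ^~ 0)) ea; rewrite /power_sum rmorph_sum sum3 /= !rmorphXn /= !evl.
  by rewrite rmorphM rmorphXn /= mevalC expr1.
have h2 (y : 'cV[R]_3) : y i0 0 ^+ 4 + y i1 0 ^+ 4 + y i2 0 ^+ 4 = b * Q y ^+ 2.
  have := congr1 (meval ((pt y) ^~ 0)) eb; rewrite /power_sum rmorph_sum sum3 /= !rmorphXn /= !evl.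
  by rewrite rmorphM rmorphXn /= mevalC.
(* In these coordinates the point [(1, 0, 0)] forces [b = a^2], and [(1, 1, 0)] then gives
   [2 = 4]. *)
have := h1 (col3 (vec3 1 0 0)); have := h2 (col3 (vec3 1 0 0)).
have := h1 (col3 (vec3 1 1 0)); have := h2 (col3 (vec3 1 1 0)).
rewrite !mxE /vec3 /= !expr1n !expr0n /= !addr0; set Q1 := Q _; set Q2 := Q _ => e1 e2 e3 e4.
have e5 : b = a ^+ 2.
  have Q20 : Q2 ^+ 2 != 0 by apply: contraTneq isT => z; move: e3; rewrite z mulr0 => /eqP; rewrite oner_eq0.
  by apply: (mulIf Q20); rewrite -e3 -exprMn -e4 expr1n.
move: e1; rewrite e5 -exprMn -e2 => /eqP.
by rewrite -subr_eq0 (_ : 1 + 1 - (1 + 1) ^+ 2 = - 2%:R :> R) ?oppr_eq0 ?pnatr_eq0 //; ring.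
Qed.

(** If the product of the three forms is invariant, its gradient over 1 is a competitor of degree 0.
    Otherwise all determinants are 1, and the tangential fields of the power sums of degrees 2 and 4
    are available, since the two sums are not both radial. *)
Lemma three_lines_divergence : divergence (fracv P D) = 0.
Proof.
case: sgn_or_det => [s1|dM].
  apply: (divergence_degree0 oM mw).
  have one2 (t : T) : (1 : R) ^+ 2 = 1 by rewrite expr1n.
  have hf : homogen 3%N f0.
    by apply: (@dhomogM _ _ _ 2 _ 1); [apply: (@dhomogM _ _ _ 1 _ 1)|]; exact: homogen_linform.
  suff [] : 0%N = d /\ exists2 c : R, c != 0 & forall i, D * grad f0 i = mpolyC 3 c * 1 * P i by [].
  apply: (@minimal_other _ _ _ _ _ _ _ _ mw 0 (grad f0) 1 (fun=> 1)) => //.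
  - exact: oner_neq0.
  - apply: contrapT => no; move/eqP: f0_neq0; apply; apply: homogen_mderiv_eq0 hf _ => i.
    by apply: contrapT => h; apply: no; exists i; apply/eqP.
  - by rewrite -mpolyC1; exact: homogenC.
  - by move=> i; exact: homogen_mderiv hf.
  - by move=> t; rewrite -mpolyC1; exact: semi_const.
  - by move=> t; apply: semi_grad => //; rewrite -(s1 t).
have [rad|nrad] := pselect (exists c : R, power_sum 1 = mpolyC 3 c * q ^+ 1); last first.
  by have [] := tangential_pair oM mw (homogen_power_sum 1) (semi_power_sum 1) dM nrad (leq0n d).
have nrad2 : ~ (exists c : R, power_sum 2 = mpolyC 3 c * q ^+ 2).
  by move=> h; apply: not_both_radial.
have [d2|d2] := leqP 2 d.
  by have [] := tangential_pair oM mw (homogen_power_sum 2) (semi_power_sum 2) dM nrad2 d2.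
apply: (divergence_degree0 oM mw).
by have := degree_neq1 oM noeig mw; case: (d) d2 => [|[|]].
Qed.

End ThreeLines.

(** * Restriction to mirror planes *)

Section Mirrors.
Variable R : realType.
Implicit Types (v w : 'cV[R]_3) (p f : mpoly 3 R).

(** For a unit vector, the orthogonal projection onto the plane perpendicular to it; substituting it
    restricts polynomials to that plane. *)
Definition mirror_proj v : 'M[R]_3 := 1%:M - v *m v^T.

Lemma mirror_projT v : (mirror_proj v)^T = mirror_proj v.
Proof.
apply/matrixP => i j; rewrite !mxE (eq_sym j); congr (_ - _).
by apply: eq_bigr => k _; rewrite !mxE mulrC.
Qed.

Lemma mirror_proj_mul v w : mirror_proj v *m w = w - dot3 v w *: v.
Proof.
rewrite /mirror_proj mulmxBl mul1mx -mulmxA; congr (_ - _).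
rewrite [v^T *m w]mx11_scalar mul_mx_scalar; congr (_ *: _).
by rewrite mxE sum3 /dot3 !mxE.
Qed.

Lemma poly_comp_mirror_var v i : poly_comp (mirror_proj v) (var R i) = var R i - mpolyC 3 (v i 0) * linform v.
Proof.
rewrite poly_compX linformE mulr_sumr -[var R i]poly_comp1 poly_compX -sumrB.
apply: eq_bigr => j _; rewrite !mxE big_ord1 !mxE mpolyCB mpolyCM /pos; ring.
Qed.

(** The projection moves each coordinate by a multiple of the linear form of [v]. *)
Lemma divides_sub_mirror v p : divides (linform v) (p - poly_comp (mirror_proj v) p).
Proof.
elim/mpoly_ring_ind: p => [c|i|p r [a ea] [b eb]|p r [a ea] [b eb]].
- by exists 0; rewrite poly_compC subrr mulr0.
- by exists (mpolyC 3 (v i 0)); rewrite poly_comp_mirror_var; ring.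
- by exists (a + b); rewrite rmorphD mulrDr -ea -eb /=; ring.
- exists (a * r + poly_comp (mirror_proj v) p * b); rewrite rmorphM mulrDr mulrA -ea.
  by rewrite mulrCA -eb /=; ring.
Qed.

Lemma divides_mirror v p : poly_comp (mirror_proj v) p = 0 -> divides (linform v) p.
Proof. by move=> h; have := divides_sub_mirror v p; rewrite h subr0. Qed.

Lemma mirror_linform v w : unit_vec v -> unit_vec w -> ~ (w = v \/ w = - v) ->
  poly_comp (mirror_proj v) (linform w) != 0.
Proof.
move=> uv uw nc; rewrite linform_comp mirror_projT mirror_proj_mul linform_eq0 subr_eq0.
apply/eqP => e; apply: nc.
have t2 : dot3 v w ^+ 2 = 1 by rewrite -[RHS](unit_dot3 uw) {2}e dot3Z expr2.
by case: (pm1 t2) => t; rewrite e t ?scale1r ?scaleN1r; [left|right].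
Qed.

(** Otherwise [sqnorm] would be the square of one linear form, and second derivatives would make the
    identity matrix equal to [v v^T], of rank one. *)
Lemma mirror_sqnorm v : unit_vec v -> poly_comp (mirror_proj v) (sqnorm R) != 0.
Proof.
move=> uv; have e : poly_comp (mirror_proj v) (sqnorm R) = sqnorm R - linform v * linform v.
  rewrite /sqnorm /dotv rmorph_sum /= !sum3 !rmorphM /= /pos !poly_comp_mirror_var.
  have /(congr1 (@mpolyC 3 R)) := unit_dot3 uv; rewrite /dot3 !mpolyCD !mpolyCM mpolyC1 => u.
  rewrite -/(pos R i0) -/(pos R i1) -/(pos R i2).
  set l := linform v; have el : l = mpolyC 3 (v i0 0) * pos R i0 + mpolyC 3 (v i1 0) * pos R i1 + mpolyC 3 (v i2 0) * pos R i2.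
    by rewrite /l linformE sum3.
  transitivity (pos R i0 * pos R i0 + pos R i1 * pos R i1 + pos R i2 * pos R i2
    - 2 * l * (mpolyC 3 (v i0 0) * pos R i0 + mpolyC 3 (v i1 0) * pos R i1 + mpolyC 3 (v i2 0) * pos R i2)
    + (mpolyC 3 (v i0 0) * mpolyC 3 (v i0 0) + mpolyC 3 (v i1 0) * mpolyC 3 (v i1 0) + mpolyC 3 (v i2 0) * mpolyC 3 (v i2 0)) * (l * l)); first by ring.
  by rewrite u -el; ring.
rewrite e subr_eq0; apply/eqP => h.
have h2 (i j : 'I_3) : 2%:R * ((i == j)%:R : mpoly 3 R) = mpolyC 3 (2%:R * (v i 0 * v j 0)).
  have e1 : mpolyC 3 2%:R * pos R i = mpolyC 3 (2%:R * v i 0) * linform v.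
    by rewrite mpolyC_natE -mderiv_sqnorm h mderivM mderiv_linform mpolyCM mpolyC_natE; ring.
  have := congr1 (mderiv j) e1; rewrite !mderiv_mulC mderiv_pos mderiv_linform eq_sym mpolyC_natE => ->.
  by rewrite -mpolyCM mulrA.
have h3 (i j : 'I_3) : (i == j)%:R = v i 0 * v j 0.
  have two : (2%:R : R) != 0 by rewrite pnatr_eq0.
  apply: (mulfI two); apply/eqP; rewrite -(mpolyC_eq 3) -h2 mpolyCM !mpolyC_natE.
  by [].
have := h3 i0 i1; have := h3 i0 i0; have := h3 i1 i1; rewrite /= => e1 e0 e01.
have : (v i0 0 * v i1 0) ^+ 2 = 1 by rewrite exprMn !expr2 -e0 -e1 mulr1.
by rewrite -e01 expr0n /= => /eqP; rewrite eq_sym oner_eq0.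
Qed.

(** For [w] orthogonal to the axis, [L w + w] is fixed by the involution and orthogonal to the axis,
    hence zero because the axis is unique. *)
Lemma half_turn (L : 'M[R]_3) v : orthogonal L -> \det L = 1 -> L != 1%:M -> L *m L = 1%:M ->
  unit_vec v -> L *m v = v -> L *m mirror_proj v = (-1)%:M *m mirror_proj v.
Proof.
move=> oL dL L1 L2 uv ev.
have flip w : dot3 v w = 0 -> L *m w = - w.
  move=> vw; apply/eqP; rewrite -addr_eq0; apply: contraT => u0.
  have [a a0 ua] := normalize u0; set u := a *: _ in ua.
  have eu : L *m u = u by rewrite /u -scalemxAr mulmxDr mulmxA L2 mul1mx addrC.
  have vu : dot3 u v = 0.
    rewrite /u dot3Z; apply/eqP; rewrite mulf_eq0 (negPf a0) /=; apply/eqP.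
    have -> : dot3 (L *m w + w) v = dot3 (L *m w) (L *m v) + dot3 v w by rewrite ev /dot3 !mxE; ring.
    by rewrite dot3_orthogonal // vw addr0 -[RHS]vw /dot3; ring.
  have one0 : (1 : R) = 0 -> false by move/eqP; rewrite oner_eq0.
  case: (axis_unique oL dL L1 uv ua ev eu) => e; rewrite e in vu.
    by apply: one0; rewrite -[RHS]vu unit_dot3.
  by apply: one0; rewrite -scaleN1r dot3Z (unit_dot3 uv) in vu; apply: oppr_inj; rewrite oppr0 -[RHS]vu mulr1.
have flipc j : L *m col j (mirror_proj v) = - col j (mirror_proj v).
  apply: flip; have e : v^T *m mirror_proj v = 0.
    by rewrite /mirror_proj mulmxBr mulmx1 mulmxA uv mul1mx subrr.
  by move/matrixP/(_ 0 j): e; rewrite !mxE sum3 /dot3 => <-; rewrite !mxE.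
have {}flipc j : col j (L *m mirror_proj v) = - col j (mirror_proj v).
  by rewrite -flipc !colE mulmxA.
apply/matrixP => i j; move/matrixP/(_ i 0): (flipc j); rewrite [LHS]mxE => ->.
by rewrite mul_scalar_mx !mxE mulN1r.
Qed.

End Mirrors.

(** * The icosahedral case *)

Section Icosahedral.
Variables (R : realType) (T : finGroupType) (M : T -> 'M[R]_3).
Hypothesis M1 : M 1%g = 1%:M.
Hypothesis MM : forall x y, M (x * y)%g = M x *m M y.
Hypothesis M_inj : injective M.
Hypothesis oM : forall t, orthogonal (M t).
Hypothesis noeig : forall v : 'cV[R]_3, v != 0 -> ~ (forall t, exists a : R, M t *m v = a *: v).
Variables (d : nat) (P : 'I_3 -> mpoly 3 R) (D : mpoly 3 R) (chi : T -> R).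
Hypothesis mw : minimal_with M d P D chi.
Hypothesis no_char : forall psi : T -> bool, (forall x y, psi (x * y)%g = psi x (+) psi y) -> forall x, psi x = false.
Variables (S : {set {group T}}) (axv : {group T} -> 'cV[R]_3).
Hypothesis S_unit : forall A, A \in S -> unit_vec (axv A) /\ forall h, (h \in A) = (rotation_part M h *m axv A == axv A).
Hypothesis S_move : forall A x, A \in S ->
  rotation_part M x *m axv A = axv (A :^ x^-1%g)%G \/ rotation_part M x *m axv A = - axv (A :^ x^-1%g)%G.
Hypothesis S_inj : forall A B, A \in S -> B \in S -> axv A = axv B \/ axv A = - axv B -> A = B.

Let q := sqnorm R.

Lemma no_real_char (f : T -> R) : (forall x, f x ^+ 2 = 1) -> (forall x y, f (x * y)%g = f x * f y) ->
  forall x, f x = 1.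
Proof.
move=> f2 fM x; have n1 : (1 == -1 :> R) = false.
  by apply/negbTE; rewrite -addr_eq0 -[1 + 1]/(2%:R) pnatr_eq0.
have h x' y' : (f (x' * y')%g == -1) = (f x' == -1) (+) (f y' == -1).
  rewrite fM; case: (pm1 (f2 x')) => ->; case: (pm1 (f2 y')) => ->;
  by rewrite ?mulr1 ?mul1r ?mulrNN ?mulr1 ?eqxx ?n1.
by have := no_char h x; case: (pm1 (f2 x)) => // ->; rewrite eqxx.
Qed.

Let detM t : \det (M t) = 1.
Proof.
by apply: (no_real_char (f := fun t => \det (M t))) => [x|x y]; [exact: det_rep_sqr|rewrite MM det_mulmx].
Qed.

Let rotE t : rotation_part M t = M t.
Proof. by rewrite /rotation_part detM scale1r. Qed.

Let chi1 t : chi t = 1.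
Proof.
apply: no_real_char => [x|x y]; first exact: (mw_sqr mw).
apply: (semi_unique (mw_denom0 mw) (mw_denom mw _)); rewrite MM.
by apply: semi_mul; exact: (mw_denom mw).
Qed.

Section AxisProduct.
Variable A : {group T}.
Hypothesis AS : A \in S.
Hypothesis orbS : forall B, B \in orbit 'JG [set: T] A -> B \in S.

Let W := orbit 'JG [set: T] A.

Definition axis_product : mpoly 3 R := \prod_(B in W) linform (axv B).

Let orb_conj B t : ((B :^ t)%G \in W) = (B \in W).
Proof.
apply/idP/idP => /orbitP[x _ e]; apply/orbitP.
  exists (x * t^-1)%g; rewrite ?inE //; apply/val_inj; rewrite /= conjsgM.
  by move/(congr1 val): e => /= ->; rewrite -conjsgM mulgV conjsg1.
exists (x * t)%g; rewrite ?inE //; apply/val_inj; rewrite /= conjsgM.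
by move/(congr1 val): e => /= ->.
Qed.

Lemma axis_product_neq0 : axis_product != 0.
Proof. by apply/prodf_neq0 => B /orbS/S_unit[uB _]; rewrite linform_eq0 unit_vec_neq0. Qed.

Lemma homogen_axis_product : homogen #|W| axis_product.
Proof.
rewrite -sum1_card /axis_product; apply: (big_rec2 (fun p n => homogen n p)).
  by rewrite -mpolyC1; exact: homogenC.
by move=> B n p _ hp; apply: dhomogM => //; exact: homogen_linform.
Qed.

Lemma semi_axis_product t : semi (M t) 1 axis_product.
Proof.
(* The choice of a unit vector on each axis costs signs, so a character with values 1 and -1 appears
   first; [no_real_char] then makes it trivial. *)
have ex s : exists a : R, a ^+ 2 = 1 /\ semi (M s) a axis_product.
  have /choice[f fP] : forall B : {group T}, exists a : R, B \in W -> a ^+ 2 = 1 /\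
      poly_comp (M s) (linform (axv B)) = mpolyC 3 a * linform (axv (B :^ s)%G).
    move=> B; have [BW|no] := boolP (B \in W); last by exists 1.
    have eT : (M s)^T = M s^-1%g.
      by rewrite -[LHS]mulmx1 -M1 -(mulgV s) MM mulmxA oM mul1mx.
    have := S_move s^-1%g (orbS BW); rewrite rotE invgK => -[e|e]; [exists 1|exists (-1)] => _.
      by rewrite expr1n linform_comp eT e mpolyC1 mul1r.
    by rewrite sqrrN expr1n linform_comp eT e linformN mpolyCN mpolyC1 mulN1r.
  exists (\prod_(B in W) f B); split.
    by rewrite -prodrXl; apply: big1 => B BW; case: (fP B BW).
  rewrite /semi /axis_product rmorph_prod /=.
  transitivity (\prod_(B in W) (mpolyC 3 (f B) * linform (axv (B :^ s)%G))).
    by apply: eq_bigr => B BW; case: (fP B BW).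
  rewrite big_split /= rmorph_prod; congr (_ * _).
  rewrite [RHS](reindex_inj (act_inj 'JG s)) /=.
  by apply: eq_bigl => B; rewrite orb_conj.
have /choice[f fP] := ex; rewrite -(@no_real_char f _ _ t); [by case: (fP t)|by move=> x; case: (fP x)|].
move=> x y; apply: (semi_unique axis_product_neq0 (proj2 (fP _))).
by rewrite MM; apply: semi_mul; apply: (proj2 (fP _)).
Qed.

(** The product vanishes on the plane orthogonal to one of its axes, where [sqnorm] does not. *)
Lemma axis_product_not_radial k : ~ exists c : R, axis_product = mpolyC 3 c * q ^+ k.
Proof.
case=> c ec; have [uA _] := S_unit AS; have AW : A \in W by exact: orbit_refl.
have := congr1 (poly_comp (mirror_proj (axv A))) ec.
rewrite {1}/axis_product rmorph_prod (bigD1 A) //= linform_comp mirror_projT mirror_proj_mul.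
rewrite (unit_dot3 uA) scale1r subrr (_ : linform 0 = 0) ?mul0r; last by apply/eqP; rewrite linform_eq0.
rewrite rmorphM rmorphXn /= poly_compC => /esym/eqP.
rewrite mulf_eq0 expf_eq0 (negPf (mirror_sqnorm uA)) andbF orbF mpolyC_eq0 => /eqP c0.
by have := axis_product_neq0; rewrite ec c0 mpolyC0 mul0r eqxx.
Qed.

End AxisProduct.

(** Restriction to a mirror is a ring morphism into a domain under which the forms of the other axes
    stay nonzero, so the factors already found cancel there. *)
Lemma divides_mirrors (s : seq {group T}) f : uniq s -> {subset s <= S} ->
  (forall B, B \in s -> poly_comp (mirror_proj (axv B)) f = 0) ->
  exists g, f = \prod_(B <- s) linform (axv B) * g.
Proof.
elim: s => [|B s IH] /=; first by exists f; rewrite big_nil mul1r.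
case/andP => Bs us sS hf; have BS : B \in S by apply: sS; rewrite mem_head.
have [||C Cs|g eg] := IH.
- exact: us.
- by move=> C Cs; apply: sS; rewrite inE Cs orbT.
- by apply: hf; rewrite inE Cs orbT.
have uB := (S_unit BS).1.
have /divides_mirror[g' eg'] : poly_comp (mirror_proj (axv B)) g = 0.
  have := hf B (mem_head _ _); rewrite eg rmorphM rmorph_prod /= => /eqP.
  rewrite mulf_eq0 => /orP[|/eqP//]; rewrite prodf_seq_eq0 => /hasP[C Cs] /=.
  have CS : C \in S by apply: sS; rewrite inE Cs orbT.
  move=> /eqP h; have := @mirror_linform R (axv B) (axv C) uB (S_unit CS).1; rewrite h eqxx => nc.
  have : false; last by []; apply: nc => e; move: Bs; rewrite (S_inj BS CS) ?Cs //.
  by case: e => ->; rewrite ?opprK; [left|right].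
by exists g'; rewrite eg eg' big_cons; ring.
Qed.

Variables (A5 A2 : {group T}).
Hypothesis A5S : A5 \in S.
Hypothesis orb5 : #|orbit 'JG [set: T] A5| = 6%N.
Hypothesis A2S : A2 \in S.
Hypothesis A2_card : #|A2| = 2%N.
Hypothesis orb2 : #|orbit 'JG [set: T] A2| = 15%N.
Hypothesis S_conj : forall A (x : T), A \in S -> (A :^ x)%G \in S.

Let orbS A : A \in S -> forall B, B \in orbit 'JG [set: T] A -> B \in S.
Proof. by move=> AS B /orbitP[x _ <-]; exact: S_conj. Qed.

(* f is odd as a polynomial and invariant under the half-turns, so it vanishes on their 15 mirrors. *)
Lemma quintic_invariant_eq0 f : homogen 5%N f -> (forall t, semi (M t) 1 f) -> f = 0.
Proof.
move=> hf sf; apply/eqP; apply: contraT => f0.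
pose W := orbit 'JG [set: T] A2.
have [|||g eg] := @divides_mirrors (enum W) f.
- exact: enum_uniq.
- by move=> B; rewrite mem_enum; exact: orbS.
- move=> B; rewrite mem_enum => BW; have BS := orbS A2S BW; have [uB mB] := S_unit BS.
  have B2 : #|B| = 2%N by case/orbitP: BW => x _ <-; rewrite /= cardJg.
  have [h hB h1] : exists2 h, h \in B & h != 1%g.
    by have /trivgPn : B :!=: 1%g; [rewrite -cardG_gt1 B2|].
  have hh : (h * h = 1)%g.
    have /dvdnP[k ek] : (#[h]%g %| 2)%N by rewrite -B2; apply: cardSg; rewrite cycle_subG.
    by rewrite -[(h * h)%g]/(h ^+ 2)%g ek mulnC expgM expg_order expg1n.
  have L1 : M h != 1%:M by apply: contraNneq h1 => e; apply/eqP/M_inj; rewrite e M1.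
  have L2 : M h *m M h = 1%:M by rewrite -MM hh M1.
  have ev : M h *m axv B = axv B by apply/eqP; rewrite -[M h]rotE -mB.
  have turn := half_turn (oM h) (detM h) L1 L2 uB ev.
  have : poly_comp (mirror_proj (axv B)) (poly_comp (M h) f) =
      poly_comp (mirror_proj (axv B)) (poly_comp (-1)%:M f) by rewrite !poly_comp_comp turn.
  have odd_f : poly_comp (-1)%:M f = - f.
    rewrite (homogen_scaling _ hf); have -> : (-1) ^+ 5 = -1 :> R by ring.
    by rewrite mpolyCN mpolyC1 mulN1r.
  rewrite sf odd_f rmorphN mpolyC1 mul1r /= => /eqP; rewrite -addr_eq0 -mulr2n -mulr_natl mulf_eq0.
  by rewrite -mpolyC_natE mpolyC_eq0 pnatr_eq0 => /eqP.
(* A nonzero quintic has no divisor of degree 15. *)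
have h15 := @homogen_axis_product A2; rewrite orb2 in h15.
have l0 : axis_product A2 != 0 by apply: axis_product_neq0; exact: orbS.
have ef : f = axis_product A2 * g by rewrite eg big_enum.
have g0 : g != 0 by apply: contraNneq f0 => g0; rewrite ef g0 mulr0.
have := msizeM l0 g0; rewrite -ef (msize_homogen f0 hf) (msize_homogen l0 h15).
have : (0 < mmeasure mdeg g)%N by rewrite lt0n mmeasure_poly_eq0.
by case: (mmeasure mdeg g).
Qed.

(** The product over the six fivefold axes has degree [6 = 2 * 3], so [tangential_pair] settles
    [d >= 4]; below, parity leaves 0 and 2. For [d = 2], [D] is proportional to [sqnorm], whose
    gradient is radial, and [P . x] is an invariant quintic, hence zero. *)
Lemma icosahedral_divergence : divergence (fracv P D) = 0.
Proof.
have h6 := @homogen_axis_product A5; rewrite orb5 in h6.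
have [d4|d4] := leqP (2 * 2) d.
  have nr := @axis_product_not_radial A5 A5S (orbS A5S) 3.
  by have [] := tangential_pair oM mw (h6 : homogen (2 * 3)%N _) (semi_axis_product (orbS A5S)) detM nr d4.
have ev := trivial_character_even oM mw chi1.
have [d0|dpos] := posnP d; first exact: (divergence_degree0 oM mw d0).
have d2 : d = 2%N by case: (d) ev d4 dpos => [|[|[|[|]]]].
have [b eb] : exists b : R, q = mpolyC 3 b * D.
  apply: (minimal_denom mw) => [|t]; first by rewrite d2; exact: homogen_sqnorm.
  by rewrite chi1; exact: semi_sqnorm.
have b0 : b != 0 by apply: contraNneq (sqnorm_neq0 R) => b0; rewrite -/q eb b0 mpolyC0 mul0r.
have f0 : dotv P (@pos R 3) = 0.
  apply: quintic_invariant_eq0.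
    have := homogen_dot (mw_field_homog mw) (@homogen_pos R 3); rewrite d2.
    by [].
  move=> t; rewrite -[1]mulr1 -{1}(chi1 t); apply: cov_dot => //; [exact: (mw_field mw)|exact: cov_pos].
apply/(divergence_fracv _ (mw_denom0 mw)); rewrite (minimal_div0 oM mw) mulr0.
have B0 : mpolyC 3 b != 0 :> mpoly 3 R by rewrite mpolyC_eq0.
apply: (mulfI B0); rewrite mulr0 -dotv_scale.
transitivity (dotv (fun i => 2 * pos R i) P); last first.
  by apply: eq_bigr => i _; rewrite /grad -mderiv_mulC -eb mderiv_sqnorm.
by rewrite dotv_scale dotvC f0 mulr0.
Qed.

End Icosahedral.

(** * Divergence and order bound without common eigenvectors *)

Section IrreducibleDivergence.
Variables (R : realType) (T : finGroupType) (M : T -> 'M[R]_3).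
Hypothesis M1 : M 1%g = 1%:M.
Hypothesis MM : forall x y, M (x * y)%g = M x *m M y.
Hypothesis M_inj : injective M.
Hypothesis oM : forall t, orthogonal (M t).
Hypothesis noeig : forall v : 'cV[R]_3, v != 0 -> ~ (forall t, exists a : R, M t *m v = a *: v).

Lemma rotation_partK t (w : 'cV[R]_3) : M t *m w = \det (M t) *: (rotation_part M t *m w).
Proof. by rewrite /rotation_part -scalemxAl scalerA -expr2 det_rep_sqr // scale1r. Qed.

(** An axis normalised by the whole group would be a common eigenvector, so only the last two
    outcomes of [axis_count] survive. [M t] and its rotation part differ by a sign and therefore
    permute the same lines. *)
Lemma irreducible_divergence d P D : min_pair M d P D ->
  (#|T| <= 60)%N /\ divergence (fracv P D) = 0.
Proof.
move=> /min_pair_character[chi mw].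
have [S [axv [S1 S2 S3 S4 [S5 S6 S7 S8]]]] := axis_system (rotation_part1 M1) (rotation_partM MM)
  (rotation_part_inj M1 MM M_inj oM mw) (rotation_part_orth oM) (rotation_part_det oM).
have Sorb A B : A \in S -> B \in orbit 'JG [set: T] A -> B \in S.
  by move=> AS /orbitP[x _ <-]; exact: S4.
have [[A AS nA]|[le [A AS eA]]|[eN [[A5 A5S [_ orb5]] [A2 A2S [c2 orb2]] psi]]] :=
    axis_count S1 S2 S3 S4 S5 (rep_card_gt1 M1 noeig).
- have [uv _] := S6 A AS; case: (noeig (unit_vec_neq0 uv)) => t.
  have e : (A :^ t^-1%g)%G = A by apply/val_inj/normP; rewrite nA inE.
  have := S7 A t AS; rewrite e [M t *m _]rotation_partK => -[]->; first by exists (\det (M t)).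
  by exists (- \det (M t)); rewrite scalerN scaleNr.
- split; first exact: leq_trans le _.
  pose O := orbit 'JG [set: T] A; have cO : #|O| = 3%N by [].
  pose L i := enum_val (cast_ord (esym cO) i).
  have LS i : L i \in S by apply: Sorb AS _; exact: enum_valP.
  have L_inj : injective L by move=> i j /enum_val_inj/cast_ord_inj.
  have Lsurj B : B \in O -> exists i, L i = B.
    by move=> BO; exists (cast_ord cO (enum_rank_in BO B)); rewrite /L cast_ordK enum_rankK_in.
  have OJ B x : B \in O -> (B :^ x)%G \in O.
    by case/orbitP => y _ <-; apply/orbitP; exists (y * x)%g; rewrite ?inE // actM.
  have /fin_all_exists[p pP] : forall t, exists f : 'I_3 -> 'I_3, forall i, L (f i) = (L i :^ t^-1%g)%G.
    move=> t; have /fin_all_exists[f fP] i : exists j, L j = (L i :^ t^-1%g)%G.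
      by apply: Lsurj; apply: OJ; exact: enum_valP.
    by exists f.
  pose v i := axv (L i).
  have /fin_all_exists[eps epsP] : forall t, exists e : 'I_3 -> R, forall i,
      M t *m v i = e i *: v (p t i) /\ e i ^+ 2 = 1.
    move=> t; suff /fin_all_exists[e eP] i : exists a : R, M t *m v i = a *: v (p t i) /\ a ^+ 2 = 1.
      by exists e.
    have := S7 (L i) t (LS i); rewrite -pP.
    rewrite [M t *m _]rotation_partK => -[]->; first by exists (\det (M t)); rewrite det_rep_sqr.
    by exists (- \det (M t)); rewrite scalerN scaleNr sqrrN det_rep_sqr.
  apply: (three_lines_divergence M1 MM oM noeig mw (v := v) (prm := p) (eps := eps)).
  + by move=> i; have [] := S6 (L i) (LS i).
  + by move=> i j /(S8 _ _ (LS i) (LS j))/L_inj.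
  + by move=> t i; have [] := epsP t i.
  + by move=> t i; have [] := epsP t i.
  move=> i j; have : L j \in orbit 'JG [set: T] (L i).
    have -> : orbit 'JG [set: T] (L i) = O by apply/orbit_eqP; exact: enum_valP.
    exact: enum_valP.
  case/orbitP => x _ e; exists x^-1%g; apply: L_inj; rewrite pP invgK.
  exact: e.
split; first by rewrite eN.
exact: (@icosahedral_divergence R T M M1 MM M_inj oM d P D chi mw psi S axv S6 S7 S8 A5 A2 A5S orb5 A2S c2 orb2 S4).
Qed.

End IrreducibleDivergence.

(** * Embedding into a fixed symmetric group *)

Section Cayley.
Variables (T : finGroupType) (n : nat) (h : T -> 'I_n).
Hypothesis h_inj : injective h.

(** Right translation on the image of [h], the identity elsewhere, so that the degree [n] may exceed
    the order of the group. *)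
Definition translation_fun (x : T) (i : 'I_n) : 'I_n :=
  if [pick t | h t == i] is Some t then h (t * x)%g else i.

Lemma translation_funE x t : translation_fun x (h t) = h (t * x)%g.
Proof.
rewrite /translation_fun; case: pickP => [t' /eqP/h_inj-> //|/(_ t)].
by rewrite eqxx.
Qed.

Lemma translation_fun_id i : (exists t, i = h t) \/ forall x, translation_fun x i = i.
Proof.
case: (pickP (fun t => h t == i)) => [t /eqP e|no]; first by left; exists t.
by right=> x; rewrite /translation_fun; case: pickP => // t; rewrite no.
Qed.

Lemma translation_funK x i : translation_fun x^-1%g (translation_fun x i) = i.
Proof.
case: (translation_fun_id i) => [[t ->]|e]; last by rewrite !e.
by rewrite !translation_funE mulgK.
Qed.

Definition translation x : 'S_n := perm (can_inj (translation_funK x)).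

Lemma translation_inj : injective translation.
Proof.
move=> x y /permP/(_ (h 1%g)); rewrite !permE !translation_funE !mul1g.
exact: h_inj.
Qed.

Lemma translationM : {morph translation : x y / (x * y)%g}.
Proof.
move=> x y; apply/permP => i; rewrite permM !permE.
case: (translation_fun_id i) => [[t ->]|e]; last by rewrite !e.
by rewrite !translation_funE mulgA.
Qed.

End Cayley.

(** A fixed finite group has finitely many subgroups, so the bound on the order becomes finiteness
    up to isomorphism. *)
Lemma cayley_embedding (T : finGroupType) n : (#|T| <= n)%N ->
  exists2 f : T -> 'S_n, injective f & {morph f : x y / (x * y)%g}.
Proof.
move=> le; pose h (t : T) := widen_ord le (enum_rank t).
have h_inj : injective h.
  by move=> s t e; apply/enum_rank_inj/val_inj; move/(congr1 val): e.
by exists (translation h_inj); [exact: translation_inj|exact: translationM].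
Qed.

(** * Finitely many classes of linearly equivalent fields *)

Section FiniteCover.
Variables (R : realType) (n : nat).
Implicit Types Q : vfield R n.

Definition linearly_equivalent Q Q' := exists2 L, L \in unitmx & Q' = lin_conj L Q.

Lemma linearly_equivalent_sym Q Q' : linearly_equivalent Q Q' -> linearly_equivalent Q' Q.
Proof.
case=> L uL ->; exists (invmx L); rewrite ?unitmx_inv //.
by rewrite lin_conj_mul ?unitmx_inv // mulmxV // lin_conj1.
Qed.

Lemma linearly_equivalent_trans Q1 Q2 Q3 :
  linearly_equivalent Q1 Q2 -> linearly_equivalent Q2 Q3 -> linearly_equivalent Q1 Q3.
Proof.
case=> L uL -> [L' uL' ->]; exists (L *m L'); first by rewrite unitmx_mul uL.
by rewrite lin_conj_mul.
Qed.

(** Classes may be empty and carry no representative, because it is not decided which of them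
    contain a field. *)
Definition finite_cover (S : vfield R n -> Prop) :=
  exists (I : finType) (cls : I -> vfield R n -> Prop),
    (forall Q, S Q -> exists i, cls i Q) /\
    forall i Q Q', cls i Q -> cls i Q' -> linearly_equivalent Q Q'.

Lemma finite_cover_sub (S S' : vfield R n -> Prop) : (forall Q, S Q -> S' Q) ->
  finite_cover S' -> finite_cover S.
Proof. by move=> sub [I [cls [h1 h2]]]; exists I, cls; split=> // Q /sub/h1. Qed.

Lemma finite_cover_union (J : finType) (S : J -> vfield R n -> Prop) :
  (forall j, finite_cover (S j)) -> finite_cover (fun Q => exists j, S j Q).
Proof.
move=> h; have /fin_all_exists[I /fin_all_exists[cls hc]] := h.
exists {j : J & I j}, (fun p => cls (tag p) (tagged p)); split=> [Q [j]|[j i] Q Q'] /=.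
  by case: (hc j) => h1 _ /h1[i hi]; exists (Tagged I i).
by case: (hc j) => _; apply.
Qed.

Lemma finite_coverU (S S' : vfield R n -> Prop) : finite_cover S -> finite_cover S' ->
  finite_cover (fun Q => S Q \/ S' Q).
Proof.
move=> h h'; apply: (@finite_cover_sub _ (fun Q => exists b : bool, (if b then S else S') Q)).
  by move=> Q [hQ|hQ]; [exists true|exists false].
by apply: finite_cover_union => -[].
Qed.

End FiniteCover.

Lemma min_pair_reindex (R : realType) n (T T' : Type) (M : T -> 'M[R]_n) (f : T' -> T) (g : T -> T') d P D :
  cancel g f -> min_pair M d P D -> min_pair (M \o f) d P D.
Proof.
move=> gK [[D0 P0 hD hP [chi chi2 cP]] mP]; split.
  by split=> //; exists (chi \o f) => t /=; [exact: chi2|exact: cP].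
move=> d' P' D' [D0' P0' hD' hP' [chi' chi2' cP']]; apply: (mP).
split=> //; exists (chi' \o g) => t /=; first exact: chi2'.
by have := cP' (g t); rewrite /= gK.
Qed.

(** The pair of larger degree admits the other as a competitor, so the fields are proportional; in
    degree 2 a constant factor is itself a conjugation. *)
Lemma min_pair_unique (R : realType) (T : Type) (M : T -> 'M[R]_3) d P D d' P' D' :
  min_pair M d P D -> min_pair M d' P' D' -> linearly_equivalent (fracv P D) (fracv P' D').
Proof.
wlog le : d P D d' P' D' / (d' <= d)%N.
  move=> wl h h'; have [le|/ltnW le] := leqP d' d; first exact: (wl _ _ _ _ _ _ le).
  by apply: linearly_equivalent_sym; exact: (wl _ _ _ _ _ _ le).
move=> [[D0 _ hD hP _] mP] [cP' _]; have [D0' _ _ _ _] := cP'.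
have [_ [c c0 e]] := mP _ _ _ cP' le.
exists c%:M; first exact: scalar_unit.
rewrite (lin_conj_scalar c0 D0 hD hP); apply/(eq_fracv _ _ D0' D0) => i.
by rewrite mulrC e; ring.
Qed.

(** * Finiteness over irreducible representations *)

Section IrreducibleRepresentation.
Variables (R : realType) (gT : finGroupType) (G : {group gT}) (rG : mx_representation R G 3).
Hypothesis oG : forall g, g \in G -> orthogonal (rG g).
Hypothesis noeig : forall v : 'cV[R]_3, v != 0 -> ~ (forall g, g \in G -> exists a : R, rG g *m v = a *: v).

Lemma rank1_eigen (A N : 'M[R]_3) (r : 'rV[R]_3) : \rank A = 1%N -> r != 0 -> (r <= A)%MS ->
  (A *m N <= A)%MS -> exists a : R, r *m N = a *: r.
Proof.
move=> rA r0 rsub AN; have Asub : (A <= r)%MS.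
  by rewrite -(geq_leqif (mxrank_leqif_sup rsub)) rA rank_rV r0.
apply/sub_rVP; apply: submx_trans Asub; apply: submx_trans AN.
exact: submxMr.
Qed.

(** A submodule of rank one gives an eigenvector directly; for rank two its orthogonal complement,
    the kernel of [U^T], does. Submodules consist of row vectors, hence the transpositions. *)
Lemma no_eigenvector_irreducible : mx_irreducible rG.
Proof.
apply/mx_irrP; split=> // U /mxmoduleP mU U0.
have no (r : 'rV[R]_3) (a_ : forall g, g \in G -> exists a : R, r *m (rG g)^T = a *: r) : r != 0 -> False.
  move=> r0; apply: (@noeig r^T); first by rewrite trmx_eq0.
  move=> g gG; have [a e] := a_ g gG; exists a.
  by have := congr1 trmx e; rewrite trmx_mul trmxK linearZ.
have oV g : g \in G -> (rG g)^T = rG g^-1%g.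
  move=> gG; rewrite -[LHS]mulmx1 -(repr_mx1 rG) -(mulgV g) repr_mxM ?groupV //.
  by rewrite mulmxA oG // mul1mx.
have nz (A : 'M[R]_3) : \rank A = 1%N -> exists2 r : 'rV_3, r != 0 & (r <= A)%MS.
  by move=> rA; exists (nz_row A); [rewrite nz_row_eq0 -mxrank_eq0 rA|exact: nz_row_sub].
have le3 := rank_leq_row U.
have : (0 < \rank U)%N by rewrite lt0n mxrank_eq0.
rewrite /row_full; move: le3; case e: (\rank U) => [|[|[|[|k]]]] // _ _.
- have [r r0 rU] := nz U e; case: (no r _ r0) => g gG; rewrite oV //.
  by apply: (rank1_eigen e r0 rU); apply: mU; rewrite groupV.
pose K := kermx U^T; have rK : \rank K = 1%N by rewrite mxrank_ker mxrank_tr e.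
have [r r0 rsub] := nz K rK; case: (no r _ r0) => g gG.
apply: (rank1_eigen rK r0 rsub); apply/sub_kermxP.
have /submxP[X eX] := mU g gG.
by rewrite -mulmxA -trmx_mul eX trmx_mul mulmxA mulmx_ker mul0mx.
Qed.

End IrreducibleRepresentation.

Lemma pchar_realType_group (R : realType) (gT : finGroupType) (G : {group gT}) : ([pchar R]^'.-group G)%g.
Proof. by apply/pgroupP => p _ _; rewrite inE /= pchar_num. Qed.

(** Classes are indexed by the finitely many simple modules of the group algebra. Isomorphic
    representations are conjugate by some [B], which carries minimal pairs to minimal pairs, and
    [min_pair_unique] compares them. *)
Lemma finite_irreducible_fields (R : realType) (gT : finGroupType) (H : {group gT}) :
  finite_cover (fun Q : vfield R 3 => exists (rH : mx_representation R H 3) d P D,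
    [/\ mx_irreducible rH, min_pair (rep_family rH) d P D & linearly_equivalent (fracv P D) Q]).
Proof.
have [sG] : inhabited (irrType R H).
  (* The decomposition into simple modules is available only for proving booleans, so excluded
     middle extracts the index type. *)
  apply: contrapT => no; suff: false by [].
  by apply: (@socle_exists R _ H _ (regular_repr R H)) => s; case: no.
exists sG, (fun i Q => exists (rH : mx_representation R H 3) d P D,
  [/\ mx_irreducible rH, min_pair (rep_family rH) d P D, linearly_equivalent (fracv P D) Q & irr_comp sG rH = i]).
split=> [Q [rH [d [P [D [irr mp e]]]]]|i Q1 Q2]; first by exists (irr_comp sG rH), rH, d, P, D.
case=> r1 [d1 [P1 [D1 [irr1 mp1 e1 c1]]]] [r2 [d2 [P2 [D2 [irr2 mp2 e2 c2]]]]].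
have := rsim_irr_comp_pchar sG (pchar_realType_group R H) irr1; rewrite c1 -c2.
have /mx_rsim_sym s2 := rsim_irr_comp_pchar sG (pchar_realType_group R H) irr2.
move=> /mx_rsim_trans/(_ s2)/mx_rsim_sym/mx_rsim_def[B [B' B'B eB]].
have uB : B \in unitmx by case/mulmx1_unit: B'B.
have B'E : B' = invmx B by rewrite -[B']mulmx1 -(mulmxV uB) mulmxA B'B mul1mx.
have eM : (fun t => B *m rep_family r1 t *m invmx B) = rep_family r2.
  by apply/funext => t; rewrite /rep_family eB ?subgP // B'E.
have := min_pair_conj uB mp1; rewrite eM => mp1'.
apply: linearly_equivalent_trans (linearly_equivalent_sym e1) _.
apply: linearly_equivalent_trans e2; apply: linearly_equivalent_trans (min_pair_unique mp1' mp2).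
have [[D10 _ _ _ _] _] := mp1.
by exists (invmx B); rewrite ?unitmx_inv // fracv_push.
Qed.

(** * Classification of superflow fields *)

Section Classification.
Variable R : realType.

Definition irreducible_class (Q : vfield R 3) := exists (H : {group 'S_60}) (rH : mx_representation R H 3) d P D,
  [/\ mx_irreducible rH, min_pair (rep_family rH) d P D & linearly_equivalent (fracv P D) Q].

Lemma finite_irreducible_class : finite_cover irreducible_class.
Proof. by apply: finite_cover_union => H; exact: finite_irreducible_fields. Qed.

Lemma finite_model_class : finite_cover (fun Q => exists i, linearly_equivalent (model R i) Q).
Proof.
apply: finite_cover_union => i; exists unit, (fun _ Q => linearly_equivalent (model R i) Q); split=> [Q h|_ Q Q' h h'].
  by exists tt.
exact: linearly_equivalent_trans (linearly_equivalent_sym h) h'.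
Qed.

Lemma irreducible_classI (T : finGroupType) (M : T -> 'M[R]_3) d P D :
  M 1%g = 1%:M -> (forall x y, M (x * y)%g = M x *m M y) -> (forall t, orthogonal (M t)) ->
  (forall v : 'cV[R]_3, v != 0 -> ~ (forall t, exists a : R, M t *m v = a *: v)) ->
  (#|T| <= 60)%N -> min_pair M d P D -> irreducible_class (fracv P D).
Proof.
move=> M1 MM oM noeig le mp; have [f f_inj fM] := cayley_embedding le.
have f1 : f 1%g = 1%g by apply: (mulgI (f 1%g)); rewrite -fM !mulg1.
(* A left inverse of the embedding, used to pull the representation back to the image of [f]. *)
pose g x := odflt 1%g [pick t | f t == x].
have gK t : g (f t) = t.
  rewrite /g; case: pickP => [u /eqP/f_inj-> //|/(_ t)].
  by rewrite eqxx.
have gH : group_set [set f t | t : T].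
  apply/group_setP; split=> [|_ _ /imsetP[s _ ->] /imsetP[t _ ->]]; first by rewrite -f1 imset_f.
  by rewrite -fM imset_f.
pose H := Group gH; have fH t : f t \in H by rewrite imset_f.
have rP : mx_repr H (M \o g).
  split=> [|_ _ /imsetP[s _ ->] /imsetP[t _ ->]] /=; first by rewrite -f1 gK.
  by rewrite -fM !gK.
exists H, (MxRepresentation rP), d, P, D; split.
- apply: no_eigenvector_irreducible => [x _|v v0 h] /=; first exact: oM.
  by apply: (noeig v v0) => t; have [a] := h _ (fH t); rewrite /= gK => e; exists a.
- apply: (min_pair_reindex (f := g \o sgval) (g := fun t => subg H (f t))) mp => t /=.
  by rewrite subgK.
by exists 1%:M; rewrite ?unitmx1 // lin_conj1.
Qed.

Lemma orthogonal_classification (T : finGroupType) (M : T -> 'M[R]_3) d P D :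
  M 1%g = 1%:M -> (forall x y, M (x * y)%g = M x *m M y) -> injective M -> (forall t, orthogonal (M t)) ->
  min_pair M d P D -> divergence (fracv P D) = 0 /\
    ((exists i, linearly_equivalent (model R i) (fracv P D)) \/ irreducible_class (fracv P D)).
Proof.
move=> M1 MM M_inj oM mp.
have [[v [v0 ev]]|no] := pselect (exists v : 'cV[R]_3, v != 0 /\ forall t, exists a : R, M t *m v = a *: v).
  have [[i [L [uL e]]] dv] := reducible_classification mp oM v0 ev.
  by split=> //; left; exists i, L.
have noeig (v : 'cV[R]_3) : v != 0 -> ~ (forall t, exists a : R, M t *m v = a *: v).
  by move=> v0 ev; apply: no; exists v.
have [le dv] := irreducible_divergence M1 MM M_inj oM noeig mp.
by split=> //; right; exact: irreducible_classI M1 MM oM noeig le mp.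
Qed.

Lemma superfield_classification (gT : finGroupType) (G : {group gT}) (rG : mx_representation R G 3)
    (Q : vfield R 3) : mx_faithful rG -> superfield rG Q ->
  divergence Q = 0 /\ ((exists i, linearly_equivalent (model R i) Q) \/ irreducible_class Q).
Proof.
move=> inj_rG /superfield_min_pair[d [P [D [-> mp]]]].
have [B uB oM] := orthogonalizable rG; pose M t := B *m rep_family rG t *m invmx B.
have [[D0 _ _ _ _] _] := mp; pose Q' := fracv (pushv B P) (poly_comp (invmx B) D).
have eQ : fracv P D = lin_conj B Q' by rewrite /Q' fracv_push // lin_conjK.
have eqQ : linearly_equivalent Q' (fracv P D) by exists B.
have M1 : M 1%g = 1%:M by rewrite /M /rep_family repr_mx1 mulmx1 mulmxV.
have MM x y : M (x * y)%g = M x *m M y.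
  by rewrite /M /rep_family repr_mxM ?subgP // !mulmxA mulmxKV.
have M_inj : injective M.
  move=> x y /(congr1 (fun A => invmx B *m A *m B)); rewrite /M !mulmxA !(mulmxKV uB) mulVmx // !mul1mx.
  by move/(mx_faithful_inj inj_rG); rewrite !subgP => /(_ isT isT)/val_inj.
have [dv cl] := orthogonal_classification M1 MM M_inj oM (min_pair_conj uB mp).
split; first by rewrite eQ divergence_lin_conj.
case: cl => [[i h]|[H [rH [d' [P' [D' [irr mp' h]]]]]]]; [left|right].
  by exists i; exact: linearly_equivalent_trans eqQ.
by exists H, rH, d', P', D'; split=> //; exact: linearly_equivalent_trans eqQ.
Qed.

Lemma superflow_field (Phi : local_map R 3) : superflow Phi -> exists Q,
  [/\ has_vfield Phi Q, divergence Q = 0 & (exists i, linearly_equivalent (model R i) Q) \/ irreducible_class Q].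
Proof.
case=> gT [G [rG [inj_rG [_ [Q [hv Q0 hQ iQ mQ]]]]]]; exists Q.
by have [dv cl] := superfield_classification inj_rG (And4 Q0 hQ iQ mQ).
Qed.

End Classification.

Theorem corollary1 (R : realType) :
  (exists (m : nat) (F : 'I_m -> local_map R 3),
     (forall i, superflow (F i)) /\
     (forall Phi : local_map R 3, superflow Phi ->
        exists i, linearly_conjugate (F i) Phi)) /\
  (forall Phi : local_map R 3, superflow Phi -> solenoidal Phi).
Proof.
split; last by move=> Phi /superflow_field[Q [hv dv _]]; exists Q.
have [I [cls [cov same]]] := finite_coverU (@finite_model_class R) (@finite_irreducible_class R).
(* Only classes containing the field of an actual superflow are kept, and one superflow is chosen in
   each; this is the list [F]. *)
pose realized i := exists2 Phi : local_map R 3, superflow Phi & exists2 Q, has_vfield Phi Q & cls i Q.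
pose J := [set i | `[< realized i >]].
have /fin_all_exists2[F sF hF] (k : 'I_#|J|) : exists2 Phi : local_map R 3, superflow Phi &
    exists2 Q, has_vfield Phi Q & cls (enum_val k) Q.
  by have := enum_valP k; rewrite inE => /asboolP.
exists #|J|, F; split=> // Phi sPhi; have [Q' [hv _ /cov[i ci]]] := superflow_field sPhi.
have iJ : i \in J by rewrite inE; apply/asboolP; exists Phi => //; exists Q'.
exists (enum_rank_in iJ i); have [Q hQ cQ] := hF (enum_rank_in iJ i).
rewrite enum_rankK_in // in cQ; have [L uL e] := same _ _ _ cQ ci.
by exists Q, Q', L.
Qed.
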